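(* Let $M$ be an Einstein four-dimensional Lorentzian manifold with nonzero constant scalar curvature. Then $M$ is semi-symmetric if and only if it is locally symmetric.
   Context: A pseudo-Riemannian manifold with curvature tensor $K$ and Levi-Civita connection $\nabla$ is semi-symmetric if $[K(X,Y),K(Z,T)]=K(K(X,Y)Z,T)+K(Z,K(X,Y)T)$ for all vector fields $X,Y,Z,T$, and locally symmetric if $\nabla K=0$. *)

(* Defs.v *)
From mathcomp Require Import all_boot all_order all_algebra.
From mathcomp Require Import all_classical all_reals all_analysis.

Set Implicit Arguments.
Unset Strict Implicit.
Unset Printing Implicit Defensive.

Import Order.TTheory GRing.Theory Num.Theory.
Import numFieldNormedType.Exports.

Local Open Scope classical_set_scope.
Local Open Scope ring_scope.

(* [U] is meant to be open: differentiability at [x] is that of the total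
   function [f], hence it only depends on [f] restricted to [U]. *)
Fixpoint differentiable_upto (R : realType) (V W : normedModType R)
    (k : nat) (U : set V) (f : V -> W) : Prop :=
  if k is k'.+1 then
    (forall x, U x -> differentiable f x) /\
    (forall v, differentiable_upto k' U ('D_v f))
  else True.

Definition smooth_on (R : realType) (V W : normedModType R)
    (U : set V) (f : V -> W) : Prop :=
  forall k, differentiable_upto k U f.

(* The atlas need not be maximal.  [coord i] is only meaningful on
   [chart_dom i], and its inverse [param i] on the image of [chart_dom i]. *)
Record smooth_manifold (R : realType) (n : nat) := SmoothManifold {
  points :> topologicalType;
  chart : Type;
  chart_dom : chart -> set points;
  coord : chart -> points -> 'rV[R]_n;
  param : chart -> 'rV[R]_n -> points;
  points_hausdorff : hausdorff_space points;
  points_second_countable : @second_countable points;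
  chart_cover : forall p, exists i, chart_dom i p;
  chart_dom_open : forall i, open (chart_dom i);
  chart_image_open : forall i, open (coord i @` chart_dom i);
  coordK : forall i p, chart_dom i p -> param i (coord i p) = p;
  coord_continuous : forall i, {within chart_dom i, continuous (coord i)};
  param_continuous : forall i,
    {within coord i @` chart_dom i, continuous (param i)};
  transition_smooth : forall i j,
    smooth_on (coord i @` (chart_dom i `&` chart_dom j)) (coord j \o param i)
}.

Section Tensors.
Variables (R : realType) (n : nat) (M : smooth_manifold R n).

Definition in_chart (i : chart M) (U : set M) : set 'rV[R]_n :=
  @coord _ _ M i @` (chart_dom i `&` U).

Definition transition (i j : chart M) : 'rV[R]_n -> 'rV[R]_n :=
  @coord _ _ M j \o @param _ _ M i.

(* A vector field on [U] is the family of its component functions, one for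
   each chart [i], with [X i x] the components at the point of coordinates
   [x]; they transform by the differential of the change of coordinates. *)
Record vector_field_on (U : set M) (X : chart M -> 'rV[R]_n -> 'rV[R]_n)
    : Prop := VectorFieldOn {
  vector_field_smooth : forall i, smooth_on (in_chart i U) (X i);
  vector_field_compat : forall i j x, in_chart i (chart_dom j `&` U) x ->
    X j (transition i j x) = 'd (transition i j) x (X i x)
}.

Definition pairing (G : 'M[R]_n) (u v : 'rV[R]_n) : R := (u *m G *m v^T) 0 0.

Record pseudo_metric := PseudoMetric {
  gram :> chart M -> 'rV[R]_n -> 'M[R]_n;
  gram_smooth : forall i, smooth_on (in_chart i setT) (gram i);
  gram_sym : forall i x, in_chart i setT x -> (gram i x)^T = gram i x;
  gram_nondegenerate : forall i x, in_chart i setT x -> gram i x \in unitmx;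
  gram_compat : forall i j x, in_chart i (chart_dom j) x -> forall u v,
    pairing (gram i x) u v =
    pairing (gram j (transition i j x))
      ('d (transition i j) x u) ('d (transition i j) x v)
}.

(* The rows of [P] form a frame orthonormal for the signature (-, +, ..., +). *)
Definition lorentzian (g : pseudo_metric) : Prop :=
  forall i x, in_chart i setT x ->
    exists2 P : 'M[R]_n, P \in unitmx &
      P *m g i x *m P^T = diag_mx (\row_k (if k == 0%N :> nat then -1 else 1)).

End Tensors.

(* Levi-Civita connection and curvature of the metric with Gram matrix [g] in
   a coordinate domain; vector fields are given by their components. *)
Section Coordinates.
Variables (R : realType) (n : nat) (g : 'rV[R]_n -> 'M[R]_n).

Definition coord_field (a : 'I_n) : 'rV[R]_n -> 'rV[R]_n :=
  fun=> delta_mx 0 a.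

Definition partial (a : 'I_n) (f : 'rV[R]_n -> R) (x : 'rV[R]_n) : R :=
  'D_(delta_mx 0 a) f x.

Definition christoffel (k i j : 'I_n) (x : 'rV[R]_n) : R :=
  2^-1 * \sum_l invmx (g x) k l *
    (partial i (fun y => g y j l) x + partial j (fun y => g y i l) x
     - partial l (fun y => g y i j) x).

Definition nabla (X Y : 'rV[R]_n -> 'rV[R]_n) : 'rV[R]_n -> 'rV[R]_n :=
  fun x => 'D_(X x) Y x +
    \row_k \sum_i \sum_j christoffel k i j x * X x 0 i * Y x 0 j.

Definition lie_bracket (X Y : 'rV[R]_n -> 'rV[R]_n) : 'rV[R]_n -> 'rV[R]_n :=
  fun x => 'D_(X x) Y x - 'D_(Y x) X x.

(* Semi-symmetry is insensitive to the sign convention for [curvature]: both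
   sides are quadratic in it. *)
Definition curvature (X Y Z : 'rV[R]_n -> 'rV[R]_n) : 'rV[R]_n -> 'rV[R]_n :=
  fun x => nabla X (nabla Y Z) x - nabla Y (nabla X Z) x
           - nabla (lie_bracket X Y) Z x.

Definition nabla_curvature (V X Y Z : 'rV[R]_n -> 'rV[R]_n)
    : 'rV[R]_n -> 'rV[R]_n :=
  fun x => nabla V (curvature X Y Z) x - curvature (nabla V X) Y Z x
           - curvature X (nabla V Y) Z x - curvature X Y (nabla V Z) x.

(* Ric(X, Y) is the trace of Z |-> K(Z, X)Y. *)
Definition ricci (x : 'rV[R]_n) : 'M[R]_n :=
  \matrix_(a, b) \sum_c
    curvature (coord_field c) (coord_field a) (coord_field b) x 0 c.

Definition scalar_curvature (x : 'rV[R]_n) : R :=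
  \tr (invmx (g x) *m ricci x).

End Coordinates.

Section Geometry.
Variables (R : realType) (n : nat) (M : smooth_manifold R n).
Variable g : pseudo_metric M.

Definition einstein : Prop :=
  exists lambda : R, forall i x, in_chart i setT x ->
    ricci (g i) x = lambda *: g i x.

Definition constant_scalar_curvature (s : R) : Prop :=
  forall i x, in_chart i setT x -> scalar_curvature (g i) x = s.

(* Vector fields may be defined on any open subset [U] of [M]; [U = setT]
   gives the globally defined ones. *)
Definition semi_symmetric : Prop :=
  forall (U : set M) (X Y Z T W : chart M -> 'rV[R]_n -> 'rV[R]_n),
    open U ->
    vector_field_on U X -> vector_field_on U Y -> vector_field_on U Z ->
    vector_field_on U T -> vector_field_on U W ->
    forall i x, in_chart i U x ->
      let K := curvature (g i) in
      K (X i) (Y i) (K (Z i) (T i) (W i)) x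
        - K (Z i) (T i) (K (X i) (Y i) (W i)) x
      = K (K (X i) (Y i) (Z i)) (T i) (W i) x
        + K (Z i) (K (X i) (Y i) (T i)) (W i) x.

Definition locally_symmetric : Prop :=
  forall (U : set M) (V X Y Z : chart M -> 'rV[R]_n -> 'rV[R]_n),
    open U ->
    vector_field_on U V -> vector_field_on U X -> vector_field_on U Y ->
    vector_field_on U Z ->
    forall i x, in_chart i U x ->
      nabla_curvature (g i) (V i) (X i) (Y i) (Z i) x = 0.

End Geometry.

(* Main.v *)
Require Import Defs.
From mathcomp Require Import all_boot all_order all_algebra.
From mathcomp Require Import all_classical all_reals all_analysis.
From mathcomp Require Import ring lra.
From mathcomp Require Import complex.

Set Implicit Arguments.
Unset Strict Implicit.
Unset Printing Implicit Defensive.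

Import Order.TTheory GRing.Theory Num.Theory.
Import numFieldNormedType.Exports.

Local Open Scope classical_set_scope.
Local Open Scope ring_scope.

(* In an orthonormal frame the curvature operator of an Einstein metric commutes
   with the Hodge star of bivectors, so it is a complex symmetric matrix Z on C^3,
   of trace lambda = s / 4 <> 0. Semi-symmetry reads Z u x Z v = Z (Z u x v), and
   amounts to the cofactor matrix of Z being scalar: Z is scalar or of rank one.
   The covariant derivatives z_e of Z are trace-free solutions of the linearized
   condition at Z, so no information on neighbouring points is needed. If Z is
   scalar then z_e = 0. If Z is proportional to a a^T then z_e is proportional to
   m_e a^T + a m_e^T with m_e orthogonal to a; contracting the second Bianchi
   identity with a and then using the rest of it gives m_e = 0.
   Conversely, if the curvature K is parallel then every covariant derivative is a
   derivation of K, hence so is K(X, Y) = [nabla_X, nabla_Y] - nabla_[X, Y]. *)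

(** * Smooth functions *)

(** Nonzero scalar curvature acts through one fact: if [Z] is proportional to [a a^T], then [a . a]
    is proportional to its trace, so [a] is not isotropic and every vector splits into a multiple of
    [a] and a vector orthogonal to [a]. Ricci-flat plane waves, where [a] is isotropic, show what
    would otherwise survive.

    An orthonormal frame is only given point by point, whereas the curvature must be differentiated.
    Hence each identity of the curvature is differentiated in coordinates by the product rule. The
    covariant derivative differs from the coordinate one by the action of the connection matrix,
    seen as an element of gl_n; the identities are either invariant under this action or vary with
    the metric, and metric compatibility absorbs that variation. The frame comes in only when
    everything is an algebraic statement at one point.

    The semi-symmetry condition is quadratic. It is written throughout as a bilinear expression in
    two tensors, so that its linearization is the sum of the two mixed values. *)

Section SmoothExt.
Context {R : realType} {V W : normedModType R}.
Implicit Types (f g : V -> W) (U : set V) (x : V).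

(** [differentiable] refers to the chosen differential ['d]. For the difference of the two
    functions, which vanishes near [x], uniqueness identifies it as 0. *)
Lemma near_eq_differentiable f g x :
  (\near x, f x = g x) -> differentiable f x -> differentiable g x.
Proof.
move=> fg df.
pose h := g - f.
have h0 : \forall y \near x, h y = 0.
  near=> y; rewrite /h /= !fctE; apply/eqP; rewrite subr_eq0.
  by apply/eqP/esym; near: y.
have E : h \o shift x = cst (h x) + \0 +o_ (0 : V) id.
  apply/eqaddoP => e e0.
  have h0' : \forall y \near (0 : V), h (y + x) = 0.
    by move: h0; rewrite (near_shift 0) subr0.
  near=> y; rewrite !fctE /= (nbhs_singleton h0) !addr0.
  have -> : h (y + x) = 0 by near: y.
  by rewrite subr0 normr0 mulr_ge0 // ltW.
have dh0 : 'd h x = 0 :> (V -> W).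
  by apply: diff_unique E => y; exact: cst_continuous.
have dh : differentiable h x.
  by apply/diff_locallyP; rewrite dh0; split => // y; exact: cst_continuous.
have -> : g = f + h by rewrite /h addrC subrK.
exact: differentiableD.
Unshelve. all: by end_near. Qed.

Lemma open_near U f g x : open U -> U x -> {in U, f =1 g} -> \near x, f x = g x.
Proof.
move=> oU Ux fg; near=> y; apply: fg; rewrite inE; near: y.
exact: open_nbhs_nbhs.
Unshelve. all: by end_near. Qed.

Lemma derive_ext U f g x v : open U -> U x -> {in U, f =1 g} ->
  'D_v f x = 'D_v g x.
Proof. by move=> oU Ux fg; apply/near_eq_derive/(open_near oU Ux fg). Qed.

(** The rules of calculus compute iterated derivatives only at points of [U], although the functions
    are total. Equality on an open set survives each differentiation, which is what the later
    inductions on the order rely on. *)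
Lemma differentiable_upto_ext k U f g : open U -> {in U, f =1 g} ->
  differentiable_upto k U f -> differentiable_upto k U g.
Proof.
move=> oU; elim: k f g => [//|k IH] f g fg [df Df]; split=> [x Ux|v].
  by apply: near_eq_differentiable (df x Ux); exact: open_near oU Ux fg.
apply: IH (Df v) => x /[!inE] Ux; exact: derive_ext oU Ux fg.
Qed.

Lemma smooth_ext U f g : open U -> {in U, f =1 g} ->
  smooth_on U f -> smooth_on U g.
Proof. by move=> oU fg sf k; apply: differentiable_upto_ext oU fg (sf k). Qed.

Lemma differentiable_upto_sub k (U U' : set V) f : U' `<=` U ->
  differentiable_upto k U f -> differentiable_upto k U' f.
Proof.
move=> sU; elim: k f => [//|k IH] f [df Df]; split=> [x /sU/df//|v].
by apply: IH; exact: Df.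
Qed.

Lemma smooth_sub (U U' : set V) f : U' `<=` U -> smooth_on U f -> smooth_on U' f.
Proof. by move=> sU sf k; exact: differentiable_upto_sub sU (sf k). Qed.

Lemma differentiable_uptoS k U f :
  differentiable_upto k.+1 U f -> differentiable_upto k U f.
Proof.
elim: k f => [//|k IH] f [df Df]; split=> // v.
by apply: IH; exact: Df.
Qed.

Lemma smooth_differentiable U f x : smooth_on U f -> U x -> differentiable f x.
Proof. by move=> /(_ 1)[+ _]; exact. Qed.

Lemma smooth_derivable U f x v : smooth_on U f -> U x -> derivable f x v.
Proof. by move=> sf Ux; apply/diff_derivable/(smooth_differentiable sf Ux). Qed.

Lemma smooth_derive U f v : smooth_on U f -> smooth_on U ('D_v f).
Proof. by move=> sf k; have [_ +] := sf k.+1; exact. Qed.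

Lemma differentiable_upto_cst k U (c : W) : differentiable_upto k U (cst c : V -> W).
Proof.
elim: k c => // k IH c; split=> [x _|v]; first exact: differentiable_cst.
have -> : 'D_v (cst c : V -> W) = cst 0 by apply/funext => x; rewrite derive_cst.
exact: IH.
Qed.

Lemma smooth_cst U (c : W) : smooth_on U (cst c : V -> W).
Proof. by move=> k; exact: differentiable_upto_cst. Qed.

Lemma differentiable_uptoD k U f g : open U -> differentiable_upto k U f ->
  differentiable_upto k U g -> differentiable_upto k U (f + g).
Proof.
move=> oU; elim: k f g => // k IH f g [df Df] [dg Dg]; split=> [x Ux|v].
  by apply: differentiableD; [exact: df|exact: dg].
apply: differentiable_upto_ext oU _ (IH _ _ (Df v) (Dg v)) => x /[!inE] Ux.
by rewrite fctE deriveD //; apply: diff_derivable; [exact: df|exact: dg].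
Qed.

Lemma smoothD U f g : open U -> smooth_on U f -> smooth_on U g ->
  smooth_on U (f + g).
Proof. by move=> oU sf sg k; exact: differentiable_uptoD. Qed.

End SmoothExt.

Section SmoothScalar.
Context {R : realType} {V : normedModType R}.
Implicit Types (f g : V -> R) (U : set V) (x : V).

Lemma differentiable_uptoM k U f g : open U -> differentiable_upto k U f ->
  differentiable_upto k U g -> differentiable_upto k U (f * g).
Proof.
move=> oU; elim: k f g => // k IH f g sf sg.
have [df Df] := sf; have [dg Dg] := sg; split=> [x Ux|v].
  by apply: differentiableM; [exact: df|exact: dg].
apply: (@differentiable_upto_ext _ _ _ _ _ (f * 'D_v g + g * 'D_v f)) => //.
  move=> x /[!inE] Ux.
  by rewrite !fctE deriveM //; apply: diff_derivable; [exact: df|exact: dg].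
by apply: differentiable_uptoD => //; apply: IH => //; by [exact: Df|exact: Dg|exact: differentiable_uptoS].
Qed.

Lemma smoothM U f g : open U -> smooth_on U f -> smooth_on U g ->
  smooth_on U (f * g).
Proof. by move=> oU sf sg k; exact: differentiable_uptoM. Qed.

Lemma smoothN U f : open U -> smooth_on U f -> smooth_on U (- f).
Proof.
move=> oU sf; have -> : - f = cst (-1) * f.
  by apply/funext => x; rewrite !fctE mulN1r.
by apply: smoothM => //; exact: smooth_cst.
Qed.

Lemma smoothB U f g : open U -> smooth_on U f -> smooth_on U g ->
  smooth_on U (f - g).
Proof. by move=> oU sf sg; apply: smoothD => //; exact: smoothN. Qed.

(** The derivative of [1/f] is [-(1/f)^2] times that of [f], so order [k] for [1/f] itself yields
    order [k.+1]. *)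
Lemma smoothV U f : open U -> (forall x, U x -> f x != 0) -> smooth_on U f ->
  smooth_on U (fun x => (f x)^-1).
Proof.
move=> oU f0 sf; elim=> // k IH; split=> [x Ux|v].
  by apply: differentiableV; [exact: (smooth_differentiable _ Ux)|exact: f0].
apply: (@differentiable_upto_ext _ _ _ _ _
  (- (((fun x => (f x)^-1) * (fun x => (f x)^-1)) * 'D_v f))) => //.
  move=> x /[!inE] Ux; rewrite !fctE deriveV; [|exact: f0|exact: (smooth_derivable sf Ux)].
  by rewrite [in RHS]scaleNr; congr (- _); rewrite -expr2 -exprVn.
have -> : forall h, - h = cst (-1) * h :> (V -> R).
  by move=> h; apply/funext => x; rewrite !fctE mulN1r.
apply: differentiable_uptoM => //; first exact: differentiable_upto_cst.
apply: differentiable_uptoM => //; first exact: differentiable_uptoM.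
exact: smooth_derive.
Qed.

Lemma smooth_sum (I : Type) (r : seq I) (P : pred I) (F : I -> V -> R) U : open U ->
  (forall i, P i -> smooth_on U (F i)) ->
  smooth_on U (fun x => \sum_(i <- r | P i) F i x).
Proof.
move=> oU sF.
have -> : (fun x => \sum_(i <- r | P i) F i x) = \sum_(i <- r | P i) F i.
  by apply/funext => x; rewrite fct_sumE.
elim/big_ind : _ => //; first exact: smooth_cst.
by move=> f g; exact: smoothD.
Qed.

Lemma smooth_prod (I : Type) (r : seq I) (P : pred I) (F : I -> V -> R) U : open U ->
  (forall i, P i -> smooth_on U (F i)) ->
  smooth_on U (fun x => \prod_(i <- r | P i) F i x).
Proof.
move=> oU sF; elim: r => [|i r IH].
  by under eq_fun do rewrite big_nil; exact: smooth_cst.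
under eq_fun do rewrite big_cons; case Pi: (P i) => //.
by apply: (@smoothM U (F i) (fun x => \prod_(j <- r | P j) F j x)) => //; exact: sF.
Qed.

End SmoothScalar.

Section SmoothMatrix.
Context {R : realType} {V : normedModType R} {m n : nat}.
Implicit Types (F : V -> 'M[R]_(m, n)) (U : set V).

Lemma derive_entry F x v i j : derivable F x v ->
  'D_v F x i j = 'D_v (fun y => F y i j) x.
Proof. by move=> dF; rewrite derive_mx // mxE. Qed.

Lemma smooth_entry U F i j : open U -> smooth_on U F ->
  smooth_on U (fun y => F y i j).
Proof.
move=> oU sF k; elim: k F sF => // k IH F sF; split=> [x Ux|v].
  apply: (@differentiable_comp _ _ _ _ F (fun M => M i j)).
    exact: (smooth_differentiable sF Ux).
  exact: differentiable_coord.
apply: differentiable_upto_ext oU _ (IH _ (smooth_derive v sF)) => x /[!inE] Ux.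
by rewrite derive_entry //; exact: (smooth_derivable sF Ux).
Qed.

Lemma smooth_mx U F : open U -> (forall i j, smooth_on U (fun y => F y i j)) ->
  smooth_on U F.
Proof.
move=> oU + k; elim: k F => // k IH F sF; split=> [x Ux|v]; last first.
  apply: (@differentiable_upto_ext _ _ _ _ _
    (fun x => \matrix_(i, j) 'D_v (fun y => F y i j) x)) => //.
    move=> x /[!inE] Ux; rewrite derive_mx //; apply/derivable_mxP => i j.
    exact: (smooth_derivable (sF i j) Ux).
  apply: IH => i j; under eq_fun do rewrite mxE; exact: (smooth_derive v (sF i j)).
have -> : F = \sum_i \sum_j (fun y => F y i j *: delta_mx i j).
  apply/funext => y; rewrite fct_sumE {1}[F y]matrix_sum_delta.
  by apply: eq_bigr => i _; rewrite fct_sumE.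
apply: differentiable_sum => i; apply: differentiable_sum => j.
by apply: differentiableZl; exact: (smooth_differentiable (sF i j) Ux).
Qed.

End SmoothMatrix.


(** * Symmetry of second derivatives *)

Section MeanValue.
Context {R : realType} {V : normedModType R}.
Implicit Types (f g : V -> R) (U : set V) (x y u v w : V).

Lemma is_derive_line g y w (s : R) : differentiable g (s *: w + y) ->
  is_derive s (1 : R) (fun t : R => g (t *: w + y)) ('D_w g (s *: w + y)).
Proof.
move=> dg.
have dl : is_diff s (fun t : R => t *: w + y) ( *:%R ^~ w).
  have -> : ( *:%R ^~ w) = (( *:%R ^~ w : R -> V) + 0) by apply/funext => t; rewrite fctE addr0.
  exact: is_diffD.
have [dl1 dl2] := dl.
have dc : differentiable (g \o (fun t : R => t *: w + y)) s.
  exact: differentiable_comp.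
apply: DeriveDef; first exact: diff_derivable.
by rewrite deriveE // diff_comp //= dl2 scale1r deriveE.
Qed.

Lemma mean_value_line g y w (h : R) : 0 < h ->
  (forall s : R, 0 <= s <= h -> differentiable g (s *: w + y)) ->
  exists2 s : R, 0 <= s <= h & g (h *: w + y) - g y = h * 'D_w g (s *: w + y).
Proof.
move=> h0 dg.
have [|||s] := @MVT R (fun s => g (s *: w + y)) (fun s => 'D_w g (s *: w + y)) 0 h => //.
- by move=> s /[!in_itv]/= /andP[s0 sh]; apply: is_derive_line; apply: dg; rewrite !ltW.
- apply: continuous_in_subspaceT => s /[!inE]/= /[!in_itv]/= sh.
  apply/differentiable_continuous/derivable1_diffP.
  by have [] := is_derive_line (dg _ sh).
- rewrite in_itv/= => /andP[s0 sh]; rewrite scale0r add0r subr0 => e.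
  by exists s; [rewrite !ltW|rewrite mulrC].
Qed.

(** The mean value theorem is used twice: along [u] for the increment of [f] by [h *: v], then along
    [v] for ['D_u f]. The left-hand side is symmetric in [u] and [v], the right-hand side is not. *)
Lemma second_difference U f x u v (h : R) : smooth_on U f -> 0 < h ->
  (forall s t : R, 0 <= s <= h -> 0 <= t <= h -> U (s *: u + (t *: v + x))) ->
  exists s t : R, [/\ 0 <= s <= h, 0 <= t <= h &
    f (h *: u + (h *: v + x)) - f (h *: u + x) - f (h *: v + x) + f x =
    h * (h * 'D_v ('D_u f) (s *: u + (t *: v + x)))].
Proof.
move=> sf h0 hU; have hh : 0 <= h <= h by rewrite lexx ltW.
have h00 : 0 <= (0 : R) <= h by apply/andP; split; [exact: lexx|exact: ltW].
pose g y := f (y + h *: v) - f y.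
have sg (s : R) : 0 <= s <= h -> differentiable g (s *: u + x) /\
    'D_u g (s *: u + x) = 'D_u f (s *: u + (h *: v + x)) - 'D_u f (s *: u + x).
  move=> hs.
  have d1 : differentiable f (s *: u + x).
    by apply: smooth_differentiable sf _; have := hU _ _ hs h00; rewrite scale0r add0r.
  have d2 : differentiable f (s *: u + x + h *: v).
    by apply: smooth_differentiable sf _; rewrite -addrA [x + _]addrC; exact: hU.
  have dsh : is_diff (s *: u + x) (fun y => y + h *: v) id.
    have -> : (id : V -> V) = (id : V -> V) + 0 by apply/funext => t; rewrite fctE addr0.
    exact: is_diffD.
  have [ds1 ds2] := dsh.
  have d3 : differentiable (f \o (fun y => y + h *: v)) (s *: u + x).
    exact: differentiable_comp.
  have d4 : differentiable g (s *: u + x) by apply: differentiableB.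
  split => //; rewrite deriveE //.
  have -> : g = (f \o (fun y => y + h *: v)) - f by [].
  rewrite diffB // diff_comp // !fctE /= ds2 /= -!deriveE //.
  by rewrite -addrA [x + _]addrC.
have [s hs] := mean_value_line h0 (fun s hs => (sg s hs).1).
rewrite (sg s hs).2 => e1.
have d5 (t : R) : 0 <= t <= h -> differentiable ('D_u f) (t *: v + (s *: u + x)).
  move=> ht; apply: (smooth_differentiable (smooth_derive u sf)).
  by rewrite addrCA; exact: hU.
have [t ht e2] := mean_value_line h0 d5.
exists s, t; split => //; rewrite [s *: u + (t *: v + x)]addrCA -e2.
rewrite [h *: v + (s *: u + x)]addrCA -e1 /g.
by rewrite -[h *: u + x + _]addrA [x + h *: v]addrC; ring.
Qed.

(** Replaces the limit in Schwarz's theorem: the mean value points are only known to lie near [x],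
    and differ for the two orders of differentiation. *)
Lemma continuous_common_value (A B : V -> R) x :
  {for x, continuous A} -> {for x, continuous B} ->
  (forall r : R, 0 < r -> exists y z, [/\ ball x r y, ball x r z & A y = B z]) ->
  A x = B x.
Proof.
move=> cA cB AB; apply/eqP; rewrite -subr_eq0 -normr_le0.
apply/ler_addgt0Pl => e e0; rewrite addr0.
have e20 : 0 < e / 2 by rewrite divr_gt0.
move/cvgrPdist_lt/(_ _ e20): cA => nA; move/cvgrPdist_lt/(_ _ e20): cB => nB.
have [r /= r0 rP] := (nbhs_ballP _ _).1 (filterI nA nB).
have [y [z [xy xz yz]]] := AB r r0.
have [/= lA _] := rP _ xy; have [/= _ lB] := rP _ xz.
rewrite (splitr e); apply: le_trans (ltW (ltrD lA lB)).
by rewrite yz [`|B x - _|]distrC; exact: ler_distD.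
Qed.

Lemma small_parallelogram x u v (r : R) : 0 < r -> exists2 h : R, 0 < h &
  forall s t : R, 0 <= s <= h -> 0 <= t <= h -> ball x r (s *: u + (t *: v + x)).
Proof.
move=> r0; pose c := `|u| + `|v| + 1.
have c0 : 0 < c by rewrite ltr_wpDl // addr_ge0.
(* The [+ 1] keeps [c] positive when [u] and [v] vanish; the factor 2 makes the final inequality
   strict. *)
exists (r / (2 * c)); first by rewrite divr_gt0 // mulr_gt0.
set h := r / _ => s t /andP[s0 sh] /andP[t0 th].
have h0 : 0 < h by rewrite divr_gt0 // mulr_gt0.
rewrite -ball_normE /= addrA opprD addrCA subrr addr0 normrN.
apply: le_lt_trans (ler_normD _ _) _; rewrite !normrZ !ger0_norm //.
apply: (@le_lt_trans _ _ (h * c)).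
  by rewrite /c !mulrDr mulr1 -[leLHS]addr0 !lerD ?ler_wpM2r // ltW.
by rewrite /h invfM mulrA divfK ?gt_eqF // ltr_pdivrMr // ltr_pMr // ltr1n.
Qed.

(** One second difference over a small parallelogram, computed in both orders, makes the two mixed
    derivatives take a common value near [x]; continuity concludes. *)
Lemma derive_swap U f x u v : open U -> smooth_on U f -> U x ->
  'D_u ('D_v f) x = 'D_v ('D_u f) x.
Proof.
move=> oU sf Ux; apply: (@continuous_common_value ('D_u ('D_v f)) ('D_v ('D_u f))).
- exact/differentiable_continuous/(smooth_differentiable (smooth_derive u (smooth_derive v sf)) Ux).
- exact/differentiable_continuous/(smooth_differentiable (smooth_derive v (smooth_derive u sf)) Ux).
move=> r r0.
have [q /= q0 qU] := (nbhs_ballP _ _).1 (open_nbhs_nbhs (conj oU Ux)).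
have m0 : 0 < Num.min r q by rewrite lt_min r0.
have [h h0 small] := small_parallelogram x u v m0.
have [mr mq] : Num.min r q <= r /\ Num.min r q <= q by rewrite !ge_min !lexx orbT.
have inU (s t : R) : 0 <= s <= h -> 0 <= t <= h -> U (s *: u + (t *: v + x)).
  by move=> hs ht; exact: (qU _ (le_ball mq (small _ _ hs ht))).
have inr (s t : R) : 0 <= s <= h -> 0 <= t <= h -> ball x r (s *: u + (t *: v + x)).
  by move=> hs ht; exact: (le_ball mr (small _ _ hs ht)).
have [s [t [hs ht eB]]] := second_difference sf h0 inU.
have [|t' [s' [ht' hs' eA]]] := @second_difference U f x v u h sf h0.
  by move=> t' s' ht' hs'; rewrite addrCA; exact: inU.
exists (t' *: v + (s' *: u + x)), (s *: u + (t *: v + x)); split.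
- by rewrite addrCA; exact: inr.
- exact: inr.
apply: (mulfI (lt0r_neq0 h0)); apply: (mulfI (lt0r_neq0 h0)).
refine (etrans (esym eA) (etrans _ eB)).
by rewrite (addrCA (h *: v)); congr (_ + _); exact: addrAC.
Qed.

End MeanValue.

Section Composition.
Context {R : realType} {n : nat}.

Lemma derive_delta_sum (W : normedModType R) (f : 'rV[R]_n -> W) x w :
  differentiable f x -> 'D_w f x = \sum_j w 0 j *: 'D_(delta_mx 0 j) f x.
Proof.
move=> df; rewrite deriveE // {1}[w]row_sum_delta linear_sum.
by apply: eq_bigr => j _; rewrite linearZ deriveE.
Qed.

(** The chain rule expresses ['D_v (f \o h)] by the components of ['D_v h] and the partial
    derivatives of [f] composed with the same [h], so the induction varies [f] and keeps [h]. *)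
Lemma smooth_comp (V : normedModType R) (U : set V) (U' : set 'rV[R]_n)
    (f : 'rV[R]_n -> R) (h : V -> 'rV[R]_n) :
  open U -> smooth_on U h -> (forall x, U x -> U' (h x)) -> smooth_on U' f ->
  smooth_on U (f \o h).
Proof.
move=> oU sh hU + k; elim: k f => // k IH f sf.
have dh x : U x -> differentiable h x by exact: smooth_differentiable.
have df x : U x -> differentiable f (h x) by move=> /hU; exact: smooth_differentiable.
split=> [x Ux|v]; first by apply: differentiable_comp; [exact: dh|exact: df].
apply: (@differentiable_upto_ext _ _ _ _ _ (fun x => \sum_j
   (((fun y => 'D_v h y 0 j) : V -> R) * (('D_(delta_mx 0 j) f) \o h)) x)) => //.
  move=> x /[!inE] Ux.
  rewrite [RHS]deriveE; last by apply: differentiable_comp; [exact: dh|exact: df].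
  rewrite diff_comp; [|exact: dh|exact: df].
  rewrite /= -deriveE; last exact: df.
  rewrite derive_delta_sum; last exact: df.
  by apply: eq_bigr => j _; rewrite !fctE -deriveE //; exact: dh.
rewrite (_ : (fun x => _) = \sum_j (((fun y => 'D_v h y 0 j) : V -> R) * (('D_(delta_mx 0 j) f) \o h))); last first.
  by apply/funext => x; rewrite fct_sumE.
elim/big_ind : _ => [|? ?|j _].
- exact: differentiable_upto_cst.
- exact: differentiable_uptoD.
- apply: differentiable_uptoM => //.
    by apply: smooth_entry => //; exact: smooth_derive.
  by apply: IH; exact: smooth_derive.
Qed.

End Composition.

(** * Curvature in coordinates *)

Section Tensor.
Context {A : comNzRingType} {n : nat}.
Implicit Types (T : 'I_n -> 'I_n -> 'M[A]_n) (u v w : 'rV[A]_n) (L : 'M[A]_n).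

(** [T a b] is the matrix of the endomorphism attached to two basis vectors. Vectors are rows and
    matrices act on the right, so a product applies its left factor first. *)
Definition tens T u v w : 'rV[A]_n :=
  \sum_a \sum_b (u 0 a * v 0 b) *: (w *m T a b).

Lemma tens_lin1 T v w : linear (fun u => tens T u v w).
Proof.
move=> c u u'; rewrite /tens scaler_sumr -big_split; apply: eq_bigr => a _ /=.
rewrite scaler_sumr -big_split; apply: eq_bigr => b _ /=.
by rewrite !mxE scalerA -scalerDl mulrDl mulrA.
Qed.

Lemma tens_lin2 T u w : linear (fun v => tens T u v w).
Proof.
move=> c v v'; rewrite /tens scaler_sumr -big_split; apply: eq_bigr => a _ /=.
rewrite scaler_sumr -big_split; apply: eq_bigr => b _ /=.
by rewrite !mxE scalerA -scalerDl mulrDr mulrCA.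
Qed.

Lemma tens_lin3 T u v : linear (tens T u v).
Proof.
move=> c w w'; rewrite /tens scaler_sumr -big_split; apply: eq_bigr => a _ /=.
rewrite scaler_sumr -big_split; apply: eq_bigr => b _ /=.
by rewrite mulmxDl -scalemxAl scalerDr !scalerA mulrC.
Qed.


Lemma tensD1 T u u' v w : tens T (u + u') v w = tens T u v w + tens T u' v w.
Proof. by have := tens_lin1 T v w 1 u u'; rewrite !scale1r. Qed.
Lemma tensD2 T u v v' w : tens T u (v + v') w = tens T u v w + tens T u v' w.
Proof. by have := tens_lin2 T u w 1 v v'; rewrite !scale1r. Qed.
Lemma tensD3 T u v w w' : tens T u v (w + w') = tens T u v w + tens T u v w'.
Proof. by have := tens_lin3 T u v 1 w w'; rewrite !scale1r. Qed.
Lemma tens01 T v w : tens T 0 v w = 0.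
Proof. by apply: (addrI (tens T 0 v w)); rewrite -tensD1 !addr0. Qed.
Lemma tens02 T u w : tens T u 0 w = 0.
Proof. by apply: (addrI (tens T u 0 w)); rewrite -tensD2 !addr0. Qed.
Lemma tens03 T u v : tens T u v 0 = 0.
Proof. by apply: (addrI (tens T u v 0)); rewrite -tensD3 !addr0. Qed.
Lemma tensZ1 T c u v w : tens T (c *: u) v w = c *: tens T u v w.
Proof. by have := tens_lin1 T v w c u 0; rewrite tens01 !addr0. Qed.
Lemma tensZ2 T c u v w : tens T u (c *: v) w = c *: tens T u v w.
Proof. by have := tens_lin2 T u w c v 0; rewrite tens02 !addr0. Qed.
Lemma tensZ3 T c u v w : tens T u v (c *: w) = c *: tens T u v w.
Proof. by have := tens_lin3 T u v c w 0; rewrite tens03 !addr0. Qed.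
Lemma tensN1 T u v w : tens T (- u) v w = - tens T u v w.
Proof. by rewrite -scaleN1r tensZ1 scaleN1r. Qed.
Lemma tensN2 T u v w : tens T u (- v) w = - tens T u v w.
Proof. by rewrite -scaleN1r tensZ2 scaleN1r. Qed.
Lemma tensN3 T u v w : tens T u v (- w) = - tens T u v w.
Proof. by rewrite -scaleN1r tensZ3 scaleN1r. Qed.
Lemma tens_comb1 T (c : 'rV[A]_n) F v w :
  tens T (\sum_e c 0 e *: F e) v w = \sum_e c 0 e *: tens T (F e) v w.
Proof.
rewrite (big_morph (fun u => tens T u v w) (fun u u' => tensD1 T u u' v w) (tens01 T v w)).
by apply: eq_bigr => e _; rewrite tensZ1.
Qed.

Lemma tens_comb2 T (c : 'rV[A]_n) F u w :
  tens T u (\sum_e c 0 e *: F e) w = \sum_e c 0 e *: tens T u (F e) w.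
Proof.
rewrite (big_morph (fun v => tens T u v w) (fun v v' => tensD2 T u v v' w) (tens02 T u w)).
by apply: eq_bigr => e _; rewrite tensZ2.
Qed.

Lemma tens_comb3 T (c : 'rV[A]_n) F u v :
  tens T u v (\sum_e c 0 e *: F e) = \sum_e c 0 e *: tens T u v (F e).
Proof.
rewrite (big_morph (tens T u v) (tensD3 T u v) (tens03 T u v)).
by apply: eq_bigr => e _; rewrite tensZ3.
Qed.

Lemma tens_delta T a b w : tens T (delta_mx 0 a) (delta_mx 0 b) w = w *m T a b.
Proof.
rewrite /tens (bigD1 a) //= (bigD1 b) //= !mxE !eqxx mul1r scale1r.
rewrite big1 ?addr0 => [|b' /negPf b'b]; last by rewrite !mxE !eqxx b'b mulr0 scale0r.
rewrite big1 ?addr0 // => a' /negPf a'a; rewrite big1 // => b' _.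
by rewrite !mxE !eqxx a'a mul0r scale0r.
Qed.

Lemma tens_deltaE T a b c d :
  tens T (delta_mx 0 a) (delta_mx 0 b) (delta_mx 0 c) 0 d = T a b c d.
Proof. by rewrite tens_delta -rowE mxE. Qed.

(** Infinitesimal action on tensors of the endomorphism [u |-> u *m L]. For a connection matrix [L]
    these are the Christoffel terms of the covariant derivative. *)
Definition gl_act L T a b : 'M[A]_n :=
  T a b *m L - L *m T a b - \sum_d L a d *: T d b - \sum_d L b d *: T a d.

Lemma tens_gl_act L T u v w :
  tens (gl_act L T) u v w = tens T u v w *m L - tens T u v (w *m L)
    - tens T (u *m L) v w - tens T u (v *m L) w.
Proof.
have e1 : tens T u v w *m L = \sum_a \sum_b (u 0 a * v 0 b) *: (w *m (T a b *m L)).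
  rewrite mulmx_suml; apply: eq_bigr => a _; rewrite mulmx_suml; apply: eq_bigr => b _.
  by rewrite -scalemxAl mulmxA.
have e2 : tens T u v (w *m L) = \sum_a \sum_b (u 0 a * v 0 b) *: (w *m (L *m T a b)).
  by apply: eq_bigr => a _; apply: eq_bigr => b _; rewrite mulmxA.
have e3 : tens T (u *m L) v w = \sum_a \sum_b (u 0 a * v 0 b) *: (w *m \sum_d L a d *: T d b).
  rewrite /tens exchange_big [RHS]exchange_big; apply: eq_bigr => b _ /=.
  under eq_bigr => d _ do rewrite mxE big_distrl /= scaler_suml.
  rewrite exchange_big; apply: eq_bigr => a _ /=.
  rewrite mulmx_sumr scaler_sumr; apply: eq_bigr => d _.
  by rewrite -scalemxAr scalerA; congr (_ *: _); ring.
have e4 : tens T u (v *m L) w = \sum_a \sum_b (u 0 a * v 0 b) *: (w *m \sum_d L b d *: T a d).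
  apply: eq_bigr => a _ /=.
  under eq_bigr => d _ do rewrite mxE big_distrr /= scaler_suml.
  rewrite exchange_big; apply: eq_bigr => b _ /=.
  rewrite mulmx_sumr scaler_sumr; apply: eq_bigr => d _.
  by rewrite -scalemxAr scalerA; congr (_ *: _); ring.
rewrite e1 e2 e3 e4 -!sumrB; apply: eq_bigr => a _; rewrite -!sumrB.
by apply: eq_bigr => b _; rewrite -!scalerBr -!mulmxBr.
Qed.

End Tensor.

(** * Coordinate derivatives of functions and matrices *)

Section Partial.
Context {R : realType} {n : nat}.
Variables (U : set 'rV[R]_n).
Hypothesis oU : open U.
Implicit Types (f h : 'rV[R]_n -> R) (x : 'rV[R]_n) (a b : 'I_n).

Lemma partial_ext a f h x : U x -> {in U, f =1 h} -> partial a f x = partial a h x.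
Proof. by move=> Ux fh; exact: derive_ext oU Ux fh. Qed.

Lemma partial_cst a (c : R) x : partial a (fun=> c) x = 0.
Proof. exact: derive_cst. Qed.

Lemma partialD a f h x : U x -> smooth_on U f -> smooth_on U h ->
  partial a (fun y => f y + h y) x = partial a f x + partial a h x.
Proof.
move=> Ux sf sh; rewrite /partial.
exact: (deriveD (smooth_derivable sf Ux) (smooth_derivable sh Ux)).
Qed.

Lemma partialB a f h x : U x -> smooth_on U f -> smooth_on U h ->
  partial a (fun y => f y - h y) x = partial a f x - partial a h x.
Proof.
move=> Ux sf sh; rewrite /partial.
exact: (deriveB (smooth_derivable sf Ux) (smooth_derivable sh Ux)).
Qed.

Lemma partialM a f h x : U x -> smooth_on U f -> smooth_on U h ->
  partial a (fun y => f y * h y) x = partial a f x * h x + f x * partial a h x.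
Proof.
move=> Ux sf sh; rewrite /partial.
rewrite [LHS](deriveM (smooth_derivable sf Ux) (smooth_derivable sh Ux)).
by rewrite addrC; congr (_ + _); exact: mulrC.
Qed.

Lemma partial_sum (I : Type) (r : seq I) a (F : I -> 'rV[R]_n -> R) x : U x ->
  (forall i, smooth_on U (F i)) ->
  partial a (fun y => \sum_(i <- r) F i y) x = \sum_(i <- r) partial a (F i) x.
Proof.
move=> Ux sF; elim: r => [|i r IH].
  rewrite big_nil -[RHS](partial_cst a 0 x).
  by apply: partial_ext => // y _; rewrite big_nil.
rewrite big_cons -IH -partialD //; last exact: smooth_sum.
by apply: partial_ext => // y _; rewrite big_cons.
Qed.

Lemma partial_swap a b f x : U x -> smooth_on U f ->
  partial a (partial b f) x = partial b (partial a f) x.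
Proof. by move=> Ux sf; exact: derive_swap oU sf Ux. Qed.

Lemma smooth_partial a f : smooth_on U f -> smooth_on U (partial a f).
Proof. exact: smooth_derive. Qed.

End Partial.

(* Unification would otherwise unfold derivatives down to limits and diverge. *)
Opaque partial.

Section SmoothMul.
Context {R : realType} {V : normedModType R}.

Lemma smooth_mul (U : set V) (f h : V -> R) : open U ->
  smooth_on U f -> smooth_on U h -> smooth_on U (fun x => f x * h x).
Proof. by move=> oU sf sh; exact: (smoothM oU sf sh). Qed.

End SmoothMul.

Section MatrixPartial.
Context {R : realType} {n : nat}.
Variables (U : set 'rV[R]_n).
Hypothesis oU : open U.

Definition partial_mx p q (a : 'I_n) (F : 'rV[R]_n -> 'M[R]_(p, q)) x :=
  \matrix_(i, j) partial a (fun y => F y i j) x.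

Lemma partial_mxE p q a (F : 'rV[R]_n -> 'M[R]_(p, q)) x i j :
  partial_mx a F x i j = partial a (fun y => F y i j) x.
Proof. by rewrite mxE. Qed.

Definition smooth_entries p q (F : 'rV[R]_n -> 'M[R]_(p, q)) :=
  forall i j, smooth_on U (fun y => F y i j).

Lemma smooth_entriesP p q (F : 'rV[R]_n -> 'M[R]_(p, q)) :
  smooth_entries F <-> smooth_on U F.
Proof. by split=> [/(smooth_mx oU)|sF i j]; [|exact: smooth_entry]. Qed.

Lemma smooth_on_entries p q (F : 'rV[R]_n -> 'M[R]_(p, q)) :
  smooth_on U F -> smooth_entries F.
Proof. by move/smooth_entriesP. Qed.

Variables (p q r : nat).
Implicit Types (F : 'rV[R]_n -> 'M[R]_(p, q)) (G : 'rV[R]_n -> 'M[R]_(q, r)).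

Lemma smooth_entries_ext F F' : {in U, F =1 F'} ->
  smooth_entries F -> smooth_entries F'.
Proof. by move=> FF sF i j; apply: smooth_ext (sF i j) => // y /FF ->. Qed.

Lemma smooth_entries_cst (M : 'M[R]_(p, q)) : smooth_entries (fun=> M).
Proof. by move=> i j; exact: smooth_cst. Qed.

Lemma smooth_entriesD F F' : smooth_entries F -> smooth_entries F' ->
  smooth_entries (fun y => F y + F' y).
Proof.
move=> sF sF' i j; apply: (smooth_ext (f := (fun y => F y i j) + (fun y => F' y i j))) => //.
  by move=> y _; rewrite mxE.
exact: smoothD.
Qed.

Lemma smooth_entriesB F F' : smooth_entries F -> smooth_entries F' ->
  smooth_entries (fun y => F y - F' y).
Proof.
move=> sF sF' i j; apply: (smooth_ext (f := (fun y => F y i j) - (fun y => F' y i j))) => //.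
  by move=> y _; rewrite !mxE.
exact: smoothB.
Qed.

Lemma smooth_entries_sum (I : Type) (s : seq I) (F : I -> 'rV[R]_n -> 'M[R]_(p, q)) :
  (forall i, smooth_entries (F i)) -> smooth_entries (fun y => \sum_(i <- s) F i y).
Proof.
move=> sF i j; apply: (smooth_ext (f := fun y => \sum_(k <- s) F k y i j)) => //.
  by move=> y _; rewrite summxE.
by apply: smooth_sum => // k _; exact: sF.
Qed.

Lemma smooth_entries_mul F G : smooth_entries F -> smooth_entries G ->
  smooth_entries (fun y => F y *m G y).
Proof.
move=> sF sG i j; apply: (smooth_ext (f := fun y => \sum_k F y i k * G y k j)) => //.
  by move=> y _; rewrite mxE.
apply: smooth_sum => // k _.
exact: (@smoothM _ _ U (fun y => F y i k) (fun y => G y k j)).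
Qed.

Lemma smooth_entriesZ (f : 'rV[R]_n -> R) F : smooth_on U f -> smooth_entries F ->
  smooth_entries (fun y => f y *: F y).
Proof.
move=> sf sF i j; apply: (smooth_ext (f := f * (fun y => F y i j))) => //.
  by move=> y _; rewrite mxE.
exact: smoothM.
Qed.

Lemma smooth_entries_tr F : smooth_entries F -> smooth_entries (fun y => (F y)^T).
Proof.
by move=> sF i j; apply: smooth_ext (sF j i) => // y _; rewrite mxE.
Qed.

Lemma smooth_entries_partial a F : smooth_entries F ->
  smooth_entries (partial_mx a F).
Proof.
move=> sF i j; apply: (smooth_ext (f := partial a (fun y => F y i j))) => //.
  by move=> y _; rewrite mxE.
exact: smooth_partial.
Qed.

Lemma partial_mx_ext a F F' x : U x -> {in U, F =1 F'} ->
  partial_mx a F x = partial_mx a F' x.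
Proof.
move=> Ux FF; apply/matrixP => i j; rewrite !mxE.
by apply: (partial_ext oU) => // y /FF ->.
Qed.

Lemma partial_mx_cst a (M : 'M[R]_(p, q)) x : partial_mx a (fun=> M) x = 0.
Proof. by apply/matrixP => i j; rewrite !mxE partial_cst. Qed.

Lemma partial_mxD a F F' x : U x -> smooth_entries F -> smooth_entries F' ->
  partial_mx a (fun y => F y + F' y) x = partial_mx a F x + partial_mx a F' x.
Proof.
move=> Ux sF sF'; apply/matrixP => i j; rewrite !mxE -(partialD _ Ux) //.
by apply: (partial_ext oU) => // y _; rewrite mxE.
Qed.

Lemma partial_mxB a F F' x : U x -> smooth_entries F -> smooth_entries F' ->
  partial_mx a (fun y => F y - F' y) x = partial_mx a F x - partial_mx a F' x.
Proof.
move=> Ux sF sF'; apply/matrixP => i j; rewrite !mxE -(partialB _ Ux) //.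
by apply: (partial_ext oU) => // y _; rewrite !mxE.
Qed.

Lemma partial_mx_sum (I : Type) (s : seq I) a (F : I -> 'rV[R]_n -> 'M[R]_(p, q)) x :
  U x -> (forall i, smooth_entries (F i)) ->
  partial_mx a (fun y => \sum_(i <- s) F i y) x = \sum_(i <- s) partial_mx a (F i) x.
Proof.
move=> Ux sF; apply/matrixP => i j; rewrite summxE mxE.
under eq_bigr do rewrite mxE.
rewrite -(partial_sum oU) // => [|k]; last exact: sF.
by apply: (partial_ext oU) => // y _; rewrite summxE.
Qed.

Lemma partial_mxM a F G x : U x -> smooth_entries F -> smooth_entries G ->
  partial_mx a (fun y => F y *m G y) x =
    partial_mx a F x *m G x + F x *m partial_mx a G x.
Proof.
move=> Ux sF sG; apply/matrixP => i j; rewrite !mxE -big_split /=.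
transitivity (partial a (fun y => \sum_k F y i k * G y k j) x).
  by apply: (partial_ext oU) => // y _; rewrite mxE.
rewrite (partial_sum oU) // => [|k]; last first.
  exact: (@smoothM _ _ U (fun y => F y i k) (fun y => G y k j)).
by apply: eq_bigr => k _; rewrite (partialM _ Ux) // !mxE.
Qed.

Lemma partial_mxZ a (f : 'rV[R]_n -> R) F x : U x -> smooth_on U f -> smooth_entries F ->
  partial_mx a (fun y => f y *: F y) x =
    partial a f x *: F x + f x *: partial_mx a F x.
Proof.
move=> Ux sf sF; apply/matrixP => i j; rewrite !mxE -(partialM _ Ux) //.
by apply: (partial_ext oU) => // y _; rewrite mxE.
Qed.

Lemma partial_mx_tr a F x : partial_mx a (fun y => (F y)^T) x = (partial_mx a F x)^T.
Proof.
apply/matrixP => i j; rewrite partial_mxE [RHS]mxE partial_mxE; congr (partial a _ x).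
by apply/funext => y; rewrite mxE.
Qed.

Lemma partial_mx_swap a b F x : U x -> smooth_entries F ->
  partial_mx a (partial_mx b F) x = partial_mx b (partial_mx a F) x.
Proof.
move=> Ux sF; apply/matrixP => i j.
have E c d : partial_mx c (partial_mx d F) x i j =
    partial c (partial d (fun y => F y i j)) x.
  rewrite partial_mxE; apply: (partial_ext oU) => // y _; exact: partial_mxE.
exact: (etrans (E a b) (etrans (partial_swap oU a b Ux (sF i j)) (esym (E b a)))).
Qed.

Lemma derive_partial_mx (Y : 'rV[R]_n -> 'rV[R]_p) w x : U x -> smooth_on U Y ->
  'D_w Y x = \sum_a w 0 a *: partial_mx a Y x.
Proof.
move=> Ux sY; rewrite derive_delta_sum; last exact: smooth_differentiable sY Ux.
apply: eq_bigr => a _; congr (_ *: _).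
rewrite derive_mx; last exact: smooth_derivable sY Ux.
by apply/matrixP => i j; rewrite !mxE.
Qed.

End MatrixPartial.

Opaque partial_mx.

Section InverseMatrix.
Context {R : realType} {n : nat}.
Variable U : set 'rV[R]_n.
Hypothesis oU : open U.

Lemma smooth_det p (F : 'rV[R]_n -> 'M[R]_p) :
  smooth_entries U F -> smooth_on U (fun y => \det (F y)).
Proof.
move=> sF; rewrite /determinant; apply: smooth_sum => // s _.
apply: smooth_mul => //.
  exact: smooth_cst.
by apply: smooth_prod => // i _; exact: sF.
Qed.

(** Cramer's formula: the inverse is the adjugate over the determinant, both polynomial in the
    entries. *)
Lemma smooth_entries_inv p (F : 'rV[R]_n -> 'M[R]_p) :
  (forall y, U y -> F y \in unitmx) -> smooth_entries U F ->
  smooth_entries U (fun y => invmx (F y)).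
Proof.
move=> uF sF; apply: (@smooth_entries_ext _ _ _ oU _ _ (fun y => (\det (F y))^-1 *: \adj (F y))).
  by move=> y /[!inE] Uy; rewrite /invmx uF.
apply: smooth_entriesZ => // [|i j].
  apply: smoothV => // [y Uy|]; last exact: smooth_det.
  by rewrite -unitfE -unitmxE uF.
apply: (@smooth_ext _ _ _ _ (fun y => (-1) ^+ (j + i) * \det (row' j (col' i (F y))))) => //.
  by move=> y _; rewrite mxE.
apply: smooth_mul => //.
  exact: smooth_cst.
by apply: smooth_det => k l; apply: smooth_ext (sF (lift j k) (lift i l)) => // y _; rewrite !mxE.
Qed.

End InverseMatrix.

(** * Algebra behind the curvature identities *)

Section MatrixIdentities.
Context {R : comNzRingType} {m n : nat}.

Lemma addmxE (A B : 'M[R]_(m, n)) i j : (A + B) i j = A i j + B i j.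
Proof. by rewrite mxE. Qed.

Lemma oppmxE (A : 'M[R]_(m, n)) i j : (- A) i j = - A i j.
Proof. by rewrite mxE. Qed.

Lemma scalemxE (k : R) (A : 'M[R]_(m, n)) i j : (k *: A) i j = k * A i j.
Proof. by rewrite mxE. Qed.

Lemma trmxE (A : 'M[R]_(m, n)) i j : A^T i j = A j i.
Proof. by rewrite mxE. Qed.

End MatrixIdentities.

Section CurvatureIdentities.
Context {R : comNzRingType} {n : nat}.

Lemma bianchi1_alg (x y z p1 p2 p3 p4 p5 p6 q1 q2 q3 q4 q5 q6 : R) :
  x = p1 - p2 + q1 - q2 -> y = p3 - p4 + q3 - q4 -> z = p5 - p6 + q5 - q6 ->
  p1 = p6 -> p3 = p2 -> p5 = p4 -> q1 = q6 -> q3 = q2 -> q5 = q4 -> x + y + z = 0.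
Proof. by move=> -> -> -> -> -> -> -> -> ->; ring. Qed.

(** [A] and [B] stand for the connection matrices in two directions, [P] and [Q] for their cross
    derivatives. The hypothesis is the symmetry of the second derivatives of the metric [G],
    expanded by metric compatibility applied twice. *)
Lemma curvature_skew_alg (G A B P Q : 'M[R]_n) :
  P *m G + B *m (A *m G + G *m A^T) + ((A *m G + G *m A^T) *m B^T + G *m P^T) =
  Q *m G + A *m (B *m G + G *m B^T) + ((B *m G + G *m B^T) *m A^T + G *m Q^T) ->
  (P - Q + B *m A - A *m B) *m G + G *m (P - Q + B *m A - A *m B)^T = 0.
Proof.
move/eqP; rewrite -subr_eq0 => /eqP <-.
have -> : (P - Q + B *m A - A *m B)^T = P^T - Q^T + A^T *m B^T - B^T *m A^T.
  by rewrite -!trmx_mul; apply/matrixP => i j; rewrite !(addmxE, oppmxE, trmxE).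
rewrite !(mulmxBl, mulmxDl, mulmxBr, mulmxDr, mulNmx, mulmxN, mulmxA).
by apply/matrixP => i j; rewrite !(addmxE, oppmxE); ring.
Qed.

(* Here [Pab] is the derivative in the direction [a] of the connection matrix
   [B], and [Sabc] that of [Pbc]. *)
Lemma bianchi2_alg (A B C Pab Pac Pba Pbc Pca Pcb Sabc Sbca Scab Sacb Sbac Scba
    Da Db Dc Ra Rb Rc : 'M[R]_n) :
  Sacb = Scab -> Sbac = Sabc -> Scba = Sbca ->
  Ra = Pbc - Pcb + C *m B - B *m C ->
  Rb = Pca - Pac + A *m C - C *m A ->
  Rc = Pab - Pba + B *m A - A *m B ->
  Da = Sabc - Sacb + (Pac *m B + C *m Pab) - (Pab *m C + B *m Pac) ->
  Db = Sbca - Sbac + (Pba *m C + A *m Pbc) - (Pbc *m A + C *m Pba) ->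
  Dc = Scab - Scba + (Pcb *m A + B *m Pca) - (Pca *m B + A *m Pcb) ->
  (Da + Ra *m A - A *m Ra) + (Db + Rb *m B - B *m Rb) + (Dc + Rc *m C - C *m Rc) = 0.
Proof.
move=> -> -> -> -> -> -> -> -> ->.
rewrite !(mulmxBl, mulmxDl, mulmxBr, mulmxDr, mulNmx, mulmxN, mulmxA).
by apply/matrixP => i j; rewrite !(addmxE, oppmxE) [RHS]mxE; ring.
Qed.

End CurvatureIdentities.

(** * Connection and curvature matrices *)

Section LeviCivita.
Context {R : realType} {n : nat}.
Variables (g : 'rV[R]_n -> 'M[R]_n) (U : set 'rV[R]_n).
Hypotheses (oU : open U) (sg : smooth_entries U g).
Hypothesis g_sym : forall x, U x -> (g x)^T = g x.
Hypothesis g_unit : forall x, U x -> g x \in unitmx.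
Implicit Types (x : 'rV[R]_n) (a b c : 'I_n).

(** Row [b] holds the covariant derivative of the coordinate field [b] along the coordinate field
    [a], so that a field [Z] has covariant derivative [partial_mx a Z x + Z x *m gam a x]. *)
Definition gam a x : 'M[R]_n := \matrix_(b, c) christoffel g c a b x.

Definition gam_low a x : 'M[R]_n := \matrix_(b, c) (2^-1 *
  (partial a (fun y => g y b c) x + partial b (fun y => g y a c) x
   - partial c (fun y => g y a b) x)).

Lemma gamE a x : U x -> gam a x = gam_low a x *m invmx (g x).
Proof.
move=> Ux; apply/matrixP => b c; rewrite !mxE /christoffel big_distrr /=.
have inv_sym k l : invmx (g x) k l = invmx (g x) l k.
  by rewrite -[in LHS](g_sym Ux) -trmx_inv mxE.
by apply: eq_bigr => l _; rewrite mxE (inv_sym c l) [in RHS]mulrAC mulrA.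
Qed.

Lemma gam_mul a x : U x -> gam a x *m g x = gam_low a x.
Proof. by move=> Ux; rewrite gamE // mulmxKV ?g_unit. Qed.

Lemma partial_g_sym a b c x : U x ->
  partial a (fun y => g y b c) x = partial a (fun y => g y c b) x.
Proof.
by move=> Ux; apply: (partial_ext oU) => // y /[!inE] Uy; rewrite -{1}(g_sym Uy) mxE.
Qed.

(** The last two derivatives of [g] in [gam_low a] are antisymmetric in the matrix indices, so
    adding the transpose leaves only the first. *)
Lemma metric_compat a x : U x ->
  partial_mx a g x = gam a x *m g x + g x *m (gam a x)^T.
Proof.
move=> Ux; have -> : g x *m (gam a x)^T = (gam a x *m g x)^T.
  by rewrite trmx_mul g_sym.
rewrite gam_mul //; apply/matrixP => b c; rewrite partial_mxE !mxE.
by rewrite (partial_g_sym a c b Ux) (partial_g_sym b a c) // (partial_g_sym c a b) //; field.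
Qed.

Lemma torsion_free a b c x : U x -> gam a x b c = gam b x a c.
Proof.
move=> Ux; rewrite !gamE // !mxE; apply: eq_bigr => l _; rewrite !mxE.
by rewrite (partial_g_sym l a b Ux); congr (_ * _ * _); ring.
Qed.

Lemma smooth_gam a : smooth_entries U (gam a).
Proof.
apply: (@smooth_entries_ext _ _ _ oU _ _ (fun x => gam_low a x *m invmx (g x))).
  by move=> y /[!inE] Uy; rewrite gamE.
apply: smooth_entries_mul => //; last exact: smooth_entries_inv.
move=> b c; pose f i j k : 'rV[R]_n -> R := partial i (fun y => g y j k).
have sf i j k : smooth_on U (f i j k) by apply: smooth_partial; exact: sg.
apply: (@smooth_ext _ _ _ _ (cst 2^-1 * (f a b c + f b a c - f c a b))) => //.
  by move=> y _; rewrite mxE.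
apply: smoothM => //; first exact: smooth_cst.
by apply: smoothB => //; exact: smoothD.
Qed.

Lemma gam_entry a x b c : gam a x b c = christoffel g c a b x.
Proof. by rewrite mxE. Qed.

Opaque gam.

(** The products come in the order opposite to the usual one because matrices act on rows from the
    right: [Z *m riem a b] is the commutator of the covariant derivatives [a] and [b] of [Z], see
    [cov_comm]. *)
Definition riem a b x : 'M[R]_n :=
  partial_mx a (gam b) x - partial_mx b (gam a) x
  + gam b x *m gam a x - gam a x *m gam b x.

Lemma riem_def a b x : riem a b x =
  partial_mx a (gam b) x - partial_mx b (gam a) x
  + gam b x *m gam a x - gam a x *m gam b x.
Proof. by []. Qed.

Lemma riemE a b x c d : riem a b x c d =
  partial a (fun y => gam b y c d) x - partial b (fun y => gam a y c d) x
  + (gam b x *m gam a x) c d - (gam a x *m gam b x) c d.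
Proof.
have E (P Q S T : 'M[R]_n) : (P - Q + S - T) c d = P c d - Q c d + S c d - T c d.
  by rewrite !(addmxE, oppmxE).
rewrite -(partial_mxE a (gam b)) -(partial_mxE b (gam a)); exact: E.
Qed.

Lemma smooth_riem a b : smooth_entries U (riem a b).
Proof.
have sp c d := smooth_entries_partial oU c (smooth_gam d).
have sm c d := smooth_entries_mul oU (smooth_gam c) (smooth_gam d).
by do 2?[apply: smooth_entriesB => //]; apply: smooth_entriesD => //; exact: smooth_entriesB.
Qed.

Lemma riem_anti a b x : riem b a x = - riem a b x.
Proof. rewrite /riem; move: (partial_mx a _ _) (partial_mx b _ _) (_ *m _) (_ *m _) => P Q S T.
by apply/matrixP => i j; rewrite !(addmxE, oppmxE); ring. Qed.

(** Torsion-freeness exchanges lower indices inside the derivatives and inside the products; the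
    twelve terms then cancel in pairs. *)
Lemma riem_bianchi1 a b c d x : U x ->
  riem a b x c d + riem b c x a d + riem c a x b d = 0.
Proof.
move=> Ux.
have P e p q : partial e (fun y => gam p y q d) x = partial e (fun y => gam q y p d) x.
  by apply: (partial_ext oU) => // y /[!inE] Uy; exact: torsion_free.
have Q p q r : (gam p x *m gam q x) r d = (gam r x *m gam q x) p d.
  by rewrite !mxE; apply: eq_bigr => k _; rewrite torsion_free.
exact: (bianchi1_alg (riemE a b x c d) (riemE b c x a d) (riemE c a x b d)
  (P a b c) (P b c a) (P c a b) (Q b a c) (Q c b a) (Q a c b)).
Qed.

Lemma riem_skew a b x : U x -> riem a b x *m g x + g x *m (riem a b x)^T = 0.
Proof.
move=> Ux.
have sG c := smooth_gam c.
have sGt c := smooth_entries_tr oU (sG c).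
have second c d : partial_mx c (partial_mx d g) x =
    partial_mx c (gam d) x *m g x
    + gam d x *m (gam c x *m g x + g x *m (gam c x)^T)
    + ((gam c x *m g x + g x *m (gam c x)^T) *m (gam d x)^T
       + g x *m (partial_mx c (gam d) x)^T).
  rewrite -(metric_compat c Ux).
  transitivity (partial_mx c (fun y => gam d y *m g y + g y *m (gam d y)^T) x).
    by apply: (partial_mx_ext oU) => // y /[!inE]; exact: metric_compat.
  have s1 := smooth_entries_mul oU (sG d) sg.
  have s2 := smooth_entries_mul oU sg (sGt d).
  rewrite (partial_mxD oU c Ux s1 s2); congr (_ + _).
    exact: (partial_mxM oU c Ux (sG d) sg).
  rewrite -(partial_mx_tr c (gam d) x).
  exact: (partial_mxM oU c Ux sg (sGt d)).
apply: (@curvature_skew_alg _ _ (g x) (gam a x) (gam b x) (partial_mx a (gam b) x)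
  (partial_mx b (gam a) x)).
exact: (etrans (esym (second a b)) (etrans (partial_mx_swap oU a b Ux sg) (second b a))).
Qed.

(** [D] corrects the derivative only for the two matrix indices of the curvature. The corrections
    for [p] and [q] cancel among themselves in the cyclic sum and are added in
    [nabla_riem_bianchi2]. *)
Lemma riem_bianchi2 a b c x : U x ->
  let D e p q := partial_mx e (riem p q) x + riem p q x *m gam e x - gam e x *m riem p q x in
  D a b c + D b c a + D c a b = 0.
Proof.
move=> Ux D.
have sG d := smooth_gam d.
have sp d e := smooth_entries_partial oU d (sG e).
have sm d e := smooth_entries_mul oU (sG d) (sG e).
have E e p q : partial_mx e (riem p q) x =
    partial_mx e (partial_mx p (gam q)) x - partial_mx e (partial_mx q (gam p)) x
    + (partial_mx e (gam q) x *m gam p x + gam q x *m partial_mx e (gam p) x)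
    - (partial_mx e (gam p) x *m gam q x + gam p x *m partial_mx e (gam q) x).
  have s1 := smooth_entriesB oU (sp p q) (sp q p).
  have s2 := smooth_entriesD oU s1 (sm q p).
  rewrite (partial_mxB oU e Ux s2 (sm p q)) (partial_mxD oU e Ux s1 (sm q p)).
  rewrite (partial_mxB oU e Ux (sp p q) (sp q p)).
  by rewrite (partial_mxM oU e Ux (sG q) (sG p)) (partial_mxM oU e Ux (sG p) (sG q)).
exact: (bianchi2_alg (partial_mx_swap oU a c Ux (sG b)) (partial_mx_swap oU b a Ux (sG c))
  (partial_mx_swap oU c b Ux (sG a)) (erefl (riem b c x)) (erefl (riem c a x))
  (erefl (riem a b x)) (E a b c) (E b c a) (E c a b)).
Qed.

End LeviCivita.

Opaque riem.

(** * Covariant derivatives and tensoriality of the curvature *)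

Section ConnectionAlgebra.
Context {R : comNzRingType} {n : nat}.

(** [C] and [C2] stand for the first and second covariant derivatives of a field, [dX] and [dY] for
    the derivatives of the components of [X] and [Y]. The terms in [C] are exactly those of the Lie
    bracket, whence tensoriality. *)
Lemma curvature_sum_alg (X Y : 'rV[R]_n) (dX dY : 'I_n -> 'I_n -> R)
    (C : 'I_n -> 'rV[R]_n) (C2 : 'I_n -> 'I_n -> 'rV[R]_n) :
  \sum_a X 0 a *: (\sum_b (dY a b *: C b + Y 0 b *: C2 a b))
  - \sum_a Y 0 a *: (\sum_b (dX a b *: C b + X 0 b *: C2 a b))
  - \sum_b (\sum_a X 0 a * dY a b - \sum_a Y 0 a * dX a b) *: C b
  = \sum_a \sum_b (X 0 a * Y 0 b) *: (C2 a b - C2 b a).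
Proof.
have E (P Q : 'rV[R]_n) (dQ : 'I_n -> 'I_n -> R) :
    \sum_a P 0 a *: (\sum_b (dQ a b *: C b + Q 0 b *: C2 a b)) =
    \sum_b (\sum_a P 0 a * dQ a b) *: C b
      + \sum_a \sum_b (P 0 a * Q 0 b) *: C2 a b.
  have -> : \sum_b (\sum_a P 0 a * dQ a b) *: C b =
      \sum_a \sum_b (P 0 a * dQ a b) *: C b.
    by rewrite exchange_big; apply: eq_bigr => b _; rewrite scaler_suml.
  rewrite -big_split; apply: eq_bigr => a _ /=.
  rewrite scaler_sumr -big_split; apply: eq_bigr => b _ /=.
  by rewrite scalerDr !scalerA.
rewrite !E.
under [X in _ - X]eq_bigr do rewrite scalerBl.
rewrite sumrB.
have -> : \sum_a \sum_b (Y 0 a * X 0 b) *: C2 a b =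
    \sum_a \sum_b (X 0 a * Y 0 b) *: C2 b a.
  rewrite exchange_big; apply: eq_bigr => a _; apply: eq_bigr => b _.
  by rewrite mulrC.
have -> : \sum_a \sum_b (X 0 a * Y 0 b) *: (C2 a b - C2 b a) =
    \sum_a \sum_b (X 0 a * Y 0 b) *: C2 a b - \sum_a \sum_b (X 0 a * Y 0 b) *: C2 b a.
  rewrite -sumrB; apply: eq_bigr => a _; rewrite -sumrB; apply: eq_bigr => b _.
  by rewrite scalerBr.
move: (\sum_b _) (\sum_b _) (\sum_a _) (\sum_a _) => P Q S T.
by apply/matrixP => i j; rewrite !(addmxE, oppmxE); ring.
Qed.

Lemma sumrB3 (F G H K : 'I_n -> 'rV[R]_n) :
  \sum_i (F i - G i - H i - K i) = \sum_i F i - \sum_i G i - \sum_i H i - \sum_i K i.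
Proof. by rewrite !sumrB. Qed.

Lemma commutator_alg (P Pa Pb Z : 'rV[R]_n) (A B Pab Pba : 'M[R]_n) :
  P + (Pa *m B + Z *m Pab) + (Pb + Z *m B) *m A
  - (P + (Pb *m A + Z *m Pba) + (Pa + Z *m A) *m B)
  = Z *m (Pab - Pba + B *m A - A *m B).
Proof.
rewrite !(mulmxDl, mulmxDr, mulmxN, mulmxA).
by apply/matrixP => i j; rewrite !(addmxE, oppmxE); ring.
Qed.

End ConnectionAlgebra.

Section Connection.
Context {R : realType} {n : nat}.
Variables (g : 'rV[R]_n -> 'M[R]_n) (U : set 'rV[R]_n).
Hypotheses (oU : open U) (sg : smooth_entries U g).
Hypothesis g_sym : forall x, U x -> (g x)^T = g x.
Hypothesis g_unit : forall x, U x -> g x \in unitmx.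
Implicit Types (x : 'rV[R]_n) (a b c : 'I_n) (X Y Z V : 'rV[R]_n -> 'rV[R]_n).

Local Notation gam := (gam g).
Local Notation riem := (riem g).
Let sG a : smooth_entries U (gam a) := smooth_gam oU sg g_sym g_unit a.
Let sR a b : smooth_entries U (riem a b) := smooth_riem oU sg g_sym g_unit a b.

Definition cov a Z x := partial_mx a Z x + Z x *m gam a x.

Lemma cov_ext a Z Z' x : U x -> {in U, Z =1 Z'} -> cov a Z x = cov a Z' x.
Proof.
by move=> Ux ZZ; rewrite /cov (partial_mx_ext oU a Ux ZZ) ZZ ?inE.
Qed.

Lemma smooth_cov a Z : smooth_entries U Z -> smooth_entries U (cov a Z).
Proof.
move=> sZ.
exact: (smooth_entriesD oU (smooth_entries_partial oU a sZ) (smooth_entries_mul oU sZ (sG a))).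
Qed.

Lemma covD a Z Z' x : U x -> smooth_entries U Z -> smooth_entries U Z' ->
  cov a (fun y => Z y + Z' y) x = cov a Z x + cov a Z' x.
Proof.
by move=> Ux sZ sZ'; rewrite /cov (partial_mxD oU a Ux sZ sZ') mulmxDl addrACA.
Qed.

Lemma cov_sum (I : Type) (r : seq I) a (Z : I -> 'rV[R]_n -> 'rV[R]_n) x :
  U x -> (forall i, smooth_entries U (Z i)) ->
  cov a (fun y => \sum_(i <- r) Z i y) x = \sum_(i <- r) cov a (Z i) x.
Proof.
by move=> Ux sZ; rewrite /cov (partial_mx_sum oU r a Ux sZ) mulmx_suml big_split.
Qed.

Lemma covZ a (f : 'rV[R]_n -> R) Z x : U x -> smooth_on U f -> smooth_entries U Z ->
  cov a (fun y => f y *: Z y) x = partial a f x *: Z x + f x *: cov a Z x.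
Proof.
by move=> Ux sf sZ; rewrite /cov (partial_mxZ oU a Ux sf sZ) scalerDr -scalemxAl addrA.
Qed.

Lemma cov_comm a b Z x : U x -> smooth_entries U Z ->
  cov a (cov b Z) x - cov b (cov a Z) x = Z x *m riem a b x.
Proof.
move=> Ux sZ.
have E c d : cov c (cov d Z) x = partial_mx c (partial_mx d Z) x
    + (partial_mx c Z x *m gam d x + Z x *m partial_mx c (gam d) x)
    + (partial_mx d Z x + Z x *m gam d x) *m gam c x.
  rewrite /cov; congr (_ + _).
  rewrite -(partial_mxM oU c Ux sZ (sG d)).
  exact: (partial_mxD oU c Ux (smooth_entries_partial oU d sZ) (smooth_entries_mul oU sZ (sG d))).
rewrite (E a b) (E b a) (partial_mx_swap oU b a Ux sZ) riem_def.
exact: commutator_alg.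
Qed.

Lemma nabla_cov Y Z x : U x -> smooth_entries U Z ->
  nabla g Y Z x = \sum_a Y x 0 a *: cov a Z x.
Proof.
move=> Ux sZ; rewrite /nabla (derive_partial_mx _ Ux); last exact/smooth_entriesP.
rewrite /cov; under [RHS]eq_bigr do rewrite scalerDr.
rewrite big_split; congr (_ + _).
apply/rowP => k; rewrite mxE summxE; apply: eq_bigr => a _.
rewrite [RHS]mxE [X in _ * X]mxE big_distrr; apply: eq_bigr => j _ /=.
by rewrite gam_entry; ring.
Qed.

Lemma nabla_ext Y Z Z' x : U x -> {in U, Z =1 Z'} -> nabla g Y Z x = nabla g Y Z' x.
Proof.
by move=> Ux ZZ; rewrite /nabla (derive_ext (Y x) oU Ux ZZ) (ZZ x) ?inE.
Qed.

Lemma smooth_cov_sum Y Z : smooth_entries U Y -> smooth_entries U Z ->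
  smooth_entries U (fun x => \sum_a Y x 0 a *: cov a Z x).
Proof.
move=> sY sZ; apply: smooth_entries_sum => // a.
by apply: smooth_entriesZ => //; exact: smooth_cov.
Qed.

Lemma smooth_nabla Y Z : smooth_entries U Y -> smooth_entries U Z ->
  smooth_entries U (nabla g Y Z).
Proof.
move=> sY sZ; apply: smooth_entries_ext (smooth_cov_sum sY sZ) => //.
by move=> x /[!inE] Ux; rewrite nabla_cov.
Qed.

Lemma lie_bracketE X Y x b : U x -> smooth_entries U X -> smooth_entries U Y ->
  lie_bracket X Y x 0 b = \sum_a X x 0 a * partial a (fun y => Y y 0 b) x
    - \sum_a Y x 0 a * partial a (fun y => X y 0 b) x.
Proof.
move=> Ux sX sY; rewrite /lie_bracket addmxE oppmxE.
rewrite (derive_partial_mx _ Ux); last exact/smooth_entriesP.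
rewrite (derive_partial_mx _ Ux); last exact/smooth_entriesP.
rewrite !summxE; congr (_ - _); apply: eq_bigr => a _.
  by rewrite mxE partial_mxE.
by rewrite mxE partial_mxE.
Qed.

Definition riemt x := tens (fun a b => riem a b x).

Lemma curvature_tens X Y Z x : U x ->
  smooth_entries U X -> smooth_entries U Y -> smooth_entries U Z ->
  curvature g X Y Z x = riemt x (X x) (Y x) (Z x).
Proof.
move=> Ux sX sY sZ.
have E P Q : smooth_entries U P -> smooth_entries U Q ->
    nabla g P (nabla g Q Z) x = \sum_a P x 0 a *: (\sum_b
      (partial a (fun y => Q y 0 b) x *: cov b Z x + Q x 0 b *: cov a (cov b Z) x)).
  move=> sP sQ.
  rewrite (@nabla_ext P _ (fun y => \sum_b Q y 0 b *: cov b Z y)) //; last first.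
    by move=> y /[!inE] Uy; exact: nabla_cov.
  rewrite nabla_cov //; last exact: smooth_cov_sum.
  apply: eq_bigr => a _; congr (_ *: _).
  rewrite cov_sum // => [|b]; last by apply: smooth_entriesZ => //; exact: smooth_cov.
  by apply: eq_bigr => b _; rewrite covZ //; exact: smooth_cov.
rewrite /curvature (E X Y) // (E Y X) // (nabla_cov _ Ux sZ).
under [X in _ - X]eq_bigr do rewrite (lie_bracketE _ Ux sX sY).
rewrite (curvature_sum_alg (X x) (Y x) (fun a b => partial a (fun y => X y 0 b) x)
  (fun a b => partial a (fun y => Y y 0 b) x) (fun b => cov b Z x) (fun a b => cov a (cov b Z) x)).
by apply: eq_bigr => a _; apply: eq_bigr => b _; rewrite cov_comm.
Qed.

Lemma smooth_riemt X Y Z :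
  smooth_entries U X -> smooth_entries U Y -> smooth_entries U Z ->
  smooth_entries U (fun x => riemt x (X x) (Y x) (Z x)).
Proof.
move=> sX sY sZ; apply: smooth_entries_sum => // a; apply: smooth_entries_sum => // b.
apply: smooth_entriesZ => //; first exact: (smooth_mul oU (sX _ _) (sY _ _)).
exact: (smooth_entries_mul oU sZ (sR a b)).
Qed.

Lemma smooth_curvature X Y Z :
  smooth_entries U X -> smooth_entries U Y -> smooth_entries U Z ->
  smooth_entries U (curvature g X Y Z).
Proof.
move=> sX sY sZ; apply: smooth_entries_ext (smooth_riemt sX sY sZ) => //.
by move=> x /[!inE] Ux; rewrite curvature_tens.
Qed.

(** The two summands are treated apart later: differentiating an identity of the curvature controls
    the first, the behaviour of that identity under [gl_act] controls the second. *)
Definition nabla_riem e x a b : 'M[R]_n :=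
  partial_mx e (riem a b) x + gl_act (gam e x) (fun a b => riem a b x) a b.

Lemma cov_riemt e X Y Z x : U x ->
  smooth_entries U X -> smooth_entries U Y -> smooth_entries U Z ->
  cov e (fun y => riemt y (X y) (Y y) (Z y)) x =
  tens (nabla_riem e x) (X x) (Y x) (Z x) + riemt x (cov e X x) (Y x) (Z x)
  + riemt x (X x) (cov e Y x) (Z x) + riemt x (X x) (Y x) (cov e Z x).
Proof.
move=> Ux sX sY sZ.
pose T a b := riem a b x.
have E : partial_mx e (fun y => riemt y (X y) (Y y) (Z y)) x =
    tens (fun a b => partial_mx e (riem a b) x) (X x) (Y x) (Z x)
    + tens T (partial_mx e X x) (Y x) (Z x) + tens T (X x) (partial_mx e Y x) (Z x)
    + tens T (X x) (Y x) (partial_mx e Z x).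
  have sXY a b : smooth_on U (fun y => X y 0 a * Y y 0 b).
    exact: (smooth_mul oU (sX _ _) (sY _ _)).
  have sZR a b := smooth_entries_mul oU sZ (sR a b).
  have sT a b := smooth_entriesZ oU (sXY a b) (sZR a b).
  rewrite /riemt /tens (partial_mx_sum oU _ e Ux) => [|a]; last exact: smooth_entries_sum.
  rewrite -!big_split; apply: eq_bigr => a _.
  rewrite (partial_mx_sum oU _ e Ux) => [|b]; last exact: sT.
  rewrite -!big_split; apply: eq_bigr => b _ /=.
  rewrite (partial_mxZ oU e Ux (sXY a b) (sZR a b)) (partialM e Ux (sX _ _) (sY _ _)).
  rewrite (partial_mxM oU e Ux sZ (sR a b)) !partial_mxE.
  rewrite scalerDl scalerDr -/(T a b).
  move: (_ *: (partial_mx e Z x *m _)) (_ *: (Z x *m partial_mx _ _ _)) (_ *: (Z x *m T a b)) (_ *: (Z x *m T a b)) => *.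
  by apply/matrixP => i j; rewrite !(addmxE, oppmxE); ring.
have D : tens (nabla_riem e x) (X x) (Y x) (Z x) =
    tens (fun a b => partial_mx e (riem a b) x) (X x) (Y x) (Z x)
    + tens (gl_act (gam e x) T) (X x) (Y x) (Z x).
  rewrite /tens -big_split; apply: eq_bigr => a _; rewrite -big_split.
  by apply: eq_bigr => b _; rewrite /nabla_riem mulmxDr scalerDr.
rewrite /cov E D tens_gl_act /riemt -/T !(tensD1, tensD2, tensD3).
move: (tens _ _ _ _) (tens _ _ _ _) (tens _ _ _ _) (tens _ _ _ _) (tens _ _ _ _) (tens _ _ _ _) (tens _ _ _ _) (_ *m _) => *.
by apply/matrixP => i j; rewrite !(addmxE, oppmxE); ring.
Qed.

Lemma nabla_curvature_tens V X Y Z x : U x -> smooth_entries U V ->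
  smooth_entries U X -> smooth_entries U Y -> smooth_entries U Z ->
  nabla_curvature g V X Y Z x =
  \sum_e V x 0 e *: tens (nabla_riem e x) (X x) (Y x) (Z x).
Proof.
move=> Ux sV sX sY sZ; rewrite /nabla_curvature.
rewrite (@nabla_ext V _ (fun y => riemt y (X y) (Y y) (Z y))) //; last first.
  by move=> y /[!inE] Uy; exact: curvature_tens.
rewrite nabla_cov //; last exact: smooth_riemt.
have [sVX sVY sVZ] := And3 (smooth_nabla sV sX) (smooth_nabla sV sY) (smooth_nabla sV sZ).
rewrite (curvature_tens Ux sVX sY sZ) (curvature_tens Ux sX sVY sZ) (curvature_tens Ux sX sY sVZ).
rewrite (nabla_cov V Ux sX) (nabla_cov V Ux sY) (nabla_cov V Ux sZ).
rewrite (_ : riemt x (\sum_a _) _ _ = \sum_a V x 0 a *: riemt x (cov a X x) (Y x) (Z x));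
  last exact: tens_comb1.
rewrite (_ : riemt x _ (\sum_a _) _ = \sum_a V x 0 a *: riemt x (X x) (cov a Y x) (Z x));
  last exact: tens_comb2.
rewrite (_ : riemt x _ _ (\sum_a _) = \sum_a V x 0 a *: riemt x (X x) (Y x) (cov a Z x));
  last exact: tens_comb3.
apply: etrans (esym (sumrB3 _ _ _ _)) _.
apply: eq_bigr => e _; rewrite cov_riemt // -!scalerBr /riemt.
congr (_ *: _).
move: (tens _ _ _ _) (tens _ _ _ _) (tens _ _ _ _) (tens _ _ _ _) => *.
by apply/matrixP => i j; rewrite !(addmxE, oppmxE); ring.
Qed.

End Connection.

(** * Rigidity in a Lorentz frame *)

Section Rigidity.
Context {F : fieldType}.

(* The symmetric matrix [[x1, y3, y2], [y3, x2, y1], [y2, y1, x3]]. *)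
Record sym3 (A : Type) := Sym3 { x1 : A; x2 : A; x3 : A; y1 : A; y2 : A; y3 : A }.

Definition tr3 (p : sym3 F) := x1 p + x2 p + x3 p.

(* Polarization of the condition that the cofactor matrix be scalar. *)
Definition cofactor_scalar (p q : sym3 F) : Prop :=
  exists c : F,
  [/\ x2 p * x3 q + x3 p * x2 q - (y1 p * y1 q) *+ 2 = c,
      x1 p * x3 q + x3 p * x1 q - (y2 p * y2 q) *+ 2 = c &
      x1 p * x2 q + x2 p * x1 q - (y3 p * y3 q) *+ 2 = c] /\
  [/\ y2 p * y3 q + y3 p * y2 q - (x1 p * y1 q + y1 p * x1 q) = 0,
      y1 p * y3 q + y3 p * y1 q - (x2 p * y2 q + y2 p * x2 q) = 0 &
      y1 p * y2 q + y2 p * y1 q - (x3 p * y3 q + y3 p * x3 q) = 0].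

(** The second Bianchi identity of the complexified derivatives, with [w] in the role of the
    imaginary unit. The first three equations say that the divergence of [p1, p2, p3] vanishes, the
    other nine that [w p0] plus their curl does, as in the complex form of Maxwell's equations. *)
Definition sym3_bianchi (w : F) (p0 p1 p2 p3 : sym3 F) : Prop :=
  [/\ x1 p1 + y3 p2 + y2 p3 = 0, y3 p1 + x2 p2 + y1 p3 = 0
    & y2 p1 + y1 p2 + x3 p3 = 0] /\
  [/\ [/\ w * x1 p0 + y2 p2 - y3 p3 = 0, w * y3 p0 + y1 p2 - x2 p3 = 0
        & w * y2 p0 + x3 p2 - y1 p3 = 0],
      [/\ w * y3 p0 + x1 p3 - y2 p1 = 0, w * x2 p0 + y3 p3 - y1 p1 = 0
        & w * y1 p0 + y2 p3 - x3 p1 = 0]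
    & [/\ w * y2 p0 + y3 p1 - x1 p2 = 0, w * y1 p0 + x2 p1 - y3 p2 = 0
        & w * x3 p0 + y1 p1 - y2 p2 = 0]].

Definition sym3_zero (p : sym3 F) : Prop :=
  [/\ x1 p = 0, x2 p = 0 & x3 p = 0] /\ [/\ y1 p = 0, y2 p = 0 & y3 p = 0].

Hypotheses (two_neq0 : 2 != 0 :> F) (three_neq0 : 3 != 0 :> F).

(** At [q = p] the condition makes twice the cofactor matrix equal to [c] times the identity. If
    [c != 0], the relation between a matrix and its adjugate forces [p] to be scalar. If [c = 0],
    all minors of size 2 vanish; then [d] is a nonzero diagonal entry, which the trace provides, and
    [a] is its row, so that no square root is needed. *)
Lemma cofactor_scalar_cases p : cofactor_scalar p p -> tr3 p != 0 ->
  (exists2 a, a != 0 & [/\ x1 p = a, x2 p = a & x3 p = a] /\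
                       [/\ y1 p = 0, y2 p = 0 & y3 p = 0]) \/
  (exists d a1 a2 a3, [/\ d != 0, d * tr3 p = a1 ^+ 2 + a2 ^+ 2 + a3 ^+ 2,
     [/\ d * x1 p = a1 ^+ 2, d * x2 p = a2 ^+ 2 & d * x3 p = a3 ^+ 2] &
     [/\ d * y1 p = a2 * a3, d * y2 p = a1 * a3 & d * y3 p = a1 * a2]]).
Proof.
case: p => r1 r2 r3 s1 s2 s3; rewrite /tr3 => -[c] /= [] [k1 k2 k3] [h1 h2 h3] t0.
have half (u v : F) : u *+ 2 = v *+ 2 -> u = v.
  move/eqP; rewrite -subr_eq0 -mulrnBl -mulr_natl mulf_eq0 (negPf two_neq0) /= subr_eq0.
  by move/eqP.
have {}h1 : s2 * s3 = r1 * s1 by apply: half; apply/subr0_eq; rewrite -[RHS]h1; ring.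
have {}h2 : s1 * s3 = r2 * s2 by apply: half; apply/subr0_eq; rewrite -[RHS]h2; ring.
have {}h3 : s1 * s2 = r3 * s3 by apply: half; apply/subr0_eq; rewrite -[RHS]h3; ring.
have [c0|c0] := eqVneq c 0; last first.
  left.
  have z1 : s1 = 0.
    apply: (mulfI c0); rewrite mulr0 -k2.
    transitivity (s2 *+ 2 * (r3 * s3 - s1 * s2) + r3 *+ 2 * (r1 * s1 - s2 * s3)); first by ring.
    by rewrite h1 h3 !subrr !mulr0 addr0.
  have z2 : s2 = 0.
    apply: (mulfI c0); rewrite mulr0 -k3.
    transitivity (s3 *+ 2 * (r1 * s1 - s2 * s3) + r1 *+ 2 * (r2 * s2 - s1 * s3)); first by ring.
    by rewrite h1 h2 !subrr !mulr0 addr0.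
  have z3 : s3 = 0.
    apply: (mulfI c0); rewrite mulr0 -k1.
    transitivity (s1 *+ 2 * (r2 * s2 - s1 * s3) + r2 *+ 2 * (r3 * s3 - s1 * s2)); first by ring.
    by rewrite h2 h3 !subrr !mulr0 addr0.
  have r12 : r2 = r1.
    by apply: (mulfI c0); rewrite -{1}k2 -{1}k1 z1 z2; ring.
  have r13 : r3 = r1.
    by apply: (mulfI c0); rewrite -{1}k3 -{1}k1 z1 z3; ring.
  exists r1 => //; apply: contraNneq t0 => r10.
  by rewrite r12 r13 r10 !addr0.
right; rewrite {}c0 in k1 k2 k3.
have {}k1 : r2 * r3 = s1 ^+ 2 by apply: half; apply/subr0_eq; rewrite -[RHS]k1; ring.
have {}k2 : r1 * r3 = s2 ^+ 2 by apply: half; apply/subr0_eq; rewrite -[RHS]k2; ring.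
have {}k3 : r1 * r2 = s3 ^+ 2 by apply: half; apply/subr0_eq; rewrite -[RHS]k3; ring.
have [r10|r10] := eqVneq r1 0; last first.
  exists r1, r1, s3, s2; split=> //; first by rewrite !mulrDr k2 k3; ring.
  by split=> //; rewrite -h1 mulrC.
have [r20|r20] := eqVneq r2 0; last first.
  exists r2, s3, r2, s1; split=> //.
  - by rewrite !mulrDr k1 -k3; ring.
  - by split; rewrite -?k3 -?k1 ?expr2 // mulrC.
  - by split; rewrite -?h2 // mulrC.
have r30 : r3 != 0 by apply: contraNneq t0 => r30; rewrite r10 r20 r30 !addr0.
exists r3, s2, s1, r3; split=> //.
- by rewrite !mulrDr -k1 -k2; ring.
- by split; rewrite -?k2 -?k1 // mulrC.
- by split; rewrite -?h3; ring.
Qed.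

(** With [n = (n1, n2, n3)] and the cross product, the last three equations read
    [w n0 a + n x a = 0]. Contracting with [a] gives [n0 = 0], and then
    [(a . a) n = (a . n) a + a x (n x a) = 0]. *)
Lemma rank_one_rigidity (n0 n1 n2 n3 a1 a2 a3 w : F) : w != 0 ->
  a1 ^+ 2 + a2 ^+ 2 + a3 ^+ 2 != 0 -> a1 * n1 + a2 * n2 + a3 * n3 = 0 ->
  w * a1 * n0 + a3 * n2 - a2 * n3 = 0 -> w * a2 * n0 + a1 * n3 - a3 * n1 = 0 ->
  w * a3 * n0 + a2 * n1 - a1 * n2 = 0 -> [/\ n0 = 0, n1 = 0, n2 = 0 & n3 = 0].
Proof.
set s := a1 ^+ 2 + _ + _ => w0 s0 e0 e1 e2 e3.
have n00 : n0 = 0.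
  apply: (mulfI (mulf_neq0 w0 s0)); rewrite mulr0 /s.
  transitivity (a1 * (w * a1 * n0 + a3 * n2 - a2 * n3) + a2 * (w * a2 * n0 + a1 * n3 - a3 * n1)
    + a3 * (w * a3 * n0 + a2 * n1 - a1 * n2)); first by ring.
  by rewrite e1 e2 e3 !mulr0 !addr0.
rewrite n00 !mulr0 !add0r in e1 e2 e3.
split=> //; apply: (mulfI s0); rewrite mulr0 /s.
- transitivity (a1 * (a1 * n1 + a2 * n2 + a3 * n3) + a2 * (a2 * n1 - a1 * n2)
    - a3 * (a1 * n3 - a3 * n1)); first by ring.
  by rewrite e0 e2 e3 !mulr0 subr0 addr0.
- transitivity (a2 * (a1 * n1 + a2 * n2 + a3 * n3) + a3 * (a3 * n2 - a2 * n3)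
    - a1 * (a2 * n1 - a1 * n2)); first by ring.
  by rewrite e0 e1 e3 !mulr0 subr0 addr0.
- transitivity (a3 * (a1 * n1 + a2 * n2 + a3 * n3) + a1 * (a1 * n3 - a3 * n1)
    - a2 * (a3 * n2 - a2 * n3)); first by ring.
  by rewrite e0 e1 e2 !mulr0 subr0 addr0.
Qed.

(** For [p = a I] the polarized cofactor matrix is [a (tr q I - q)]. If it is scalar and [tr q = 0],
    then [q] is scalar, hence zero as 3 is invertible. *)
Lemma cofactor_scalar_umbilic p q a : a != 0 -> cofactor_scalar p q -> tr3 q = 0 ->
  [/\ x1 p = a, x2 p = a & x3 p = a] -> [/\ y1 p = 0, y2 p = 0 & y3 p = 0] ->
  sym3_zero q.
Proof.
case: p q => [? ? ? ? ? ?] [r1 r2 r3 s1 s2 s3] a0; rewrite /tr3 /sym3_zero.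
move=> -[c] /= [] [k1 k2 k3] [h1 h2 h3] t0 [e1 e2 e3] [f1 f2 f3].
rewrite {}e1 {}e2 {}e3 {}f1 {}f2 {}f3 in k1 k2 k3 h1 h2 h3.
have s10 : s1 = 0 by apply: (mulfI a0); rewrite mulr0 -[RHS]oppr0 -h1; ring.
have s20 : s2 = 0 by apply: (mulfI a0); rewrite mulr0 -[RHS]oppr0 -h2; ring.
have s30 : s3 = 0 by apply: (mulfI a0); rewrite mulr0 -[RHS]oppr0 -h3; ring.
have r12 : r1 = r2.
  by apply: (mulfI a0); apply/subr0_eq; rewrite -(subrr c) -{1}k2 -k1; ring.
have r13 : r1 = r3.
  by apply: (mulfI a0); apply/subr0_eq; rewrite -(subrr c) -{1}k3 -k1; ring.
have r10 : r1 = 0.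
  by apply: (mulfI three_neq0); rewrite mulr0 -t0 -r12 -r13; ring.
by rewrite -r12 -r13 r10.
Qed.

(* If [d * p = a a^T] then the infinitesimal deformations [q] of [p] with trace 0
   are of the form [m a^T + a m^T] up to a factor, where [m = q a] is orthogonal
   to [a]: contracting the condition twice with [a] shows that its constant is 0,
   and then its trace gives the orthogonality. *)
Lemma cofactor_scalar_rank_one p q d a1 a2 a3 :
  d != 0 -> a1 ^+ 2 + a2 ^+ 2 + a3 ^+ 2 != 0 ->
  [/\ d * x1 p = a1 ^+ 2, d * x2 p = a2 ^+ 2 & d * x3 p = a3 ^+ 2] ->
  [/\ d * y1 p = a2 * a3, d * y2 p = a1 * a3 & d * y3 p = a1 * a2] ->
  cofactor_scalar p q -> tr3 q = 0 ->
  let s := a1 ^+ 2 + a2 ^+ 2 + a3 ^+ 2 in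
  let m1 := x1 q * a1 + y3 q * a2 + y2 q * a3 in
  let m2 := y3 q * a1 + x2 q * a2 + y1 q * a3 in
  let m3 := y2 q * a1 + y1 q * a2 + x3 q * a3 in
  [/\ a1 * m1 + a2 * m2 + a3 * m3 = 0,
     [/\ s * x1 q = a1 * m1 *+ 2, s * x2 q = a2 * m2 *+ 2 & s * x3 q = a3 * m3 *+ 2] &
     [/\ s * y1 q = a2 * m3 + a3 * m2, s * y2 q = a1 * m3 + a3 * m1
       & s * y3 q = a1 * m2 + a2 * m1]].
Proof.
case: p q => [p1 p2 p3 q1 q2 q3] [r1 r2 r3 s1 s2 s3] d0 s0; rewrite /tr3.
move=> /= [e1 e2 e3] [f1 f2 f3] [c] /= [] [k1 k2 k3] [h1 h2 h3] t0.
have K1 : a2 ^+ 2 * r3 + a3 ^+ 2 * r2 - (a2 * a3 * s1) *+ 2 = d * c.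
  by rewrite -k1 -e2 -e3 -f1; ring.
have K2 : a1 ^+ 2 * r3 + a3 ^+ 2 * r1 - (a1 * a3 * s2) *+ 2 = d * c.
  by rewrite -k2 -e1 -e3 -f2; ring.
have K3 : a1 ^+ 2 * r2 + a2 ^+ 2 * r1 - (a1 * a2 * s3) *+ 2 = d * c.
  by rewrite -k3 -e1 -e2 -f3; ring.
have H1 : a1 * a3 * s3 + a1 * a2 * s2 - (a1 ^+ 2 * s1 + a2 * a3 * r1) = 0.
  by rewrite -[RHS](mulr0 d) -h1 -e1 -f1 -f2 -f3; ring.
have H2 : a2 * a3 * s3 + a1 * a2 * s1 - (a2 ^+ 2 * s2 + a1 * a3 * r2) = 0.
  by rewrite -[RHS](mulr0 d) -h2 -e2 -f1 -f2 -f3; ring.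
have H3 : a2 * a3 * s2 + a1 * a3 * s1 - (a3 ^+ 2 * s3 + a1 * a2 * r3) = 0.
  by rewrite -[RHS](mulr0 d) -h3 -e3 -f1 -f2 -f3; ring.
move: (d * c) K1 K2 K3 => g K1 K2 K3.
set s := a1 ^+ 2 + _ + _ in s0 *; set m1 := r1 * a1 + _ + _.
set m2 := s3 * a1 + _ + _; set m3 := s2 * a1 + _ + _.
(* The polarized cofactor matrix of [a a^T] and [q] is [[a] q [a]^T], where [[a]] is the matrix of
   the cross product by [a]. It kills [a], and it equals [g I], so [s g = 0]. *)
have g0 : g = 0.
  apply: (mulfI s0); rewrite mulr0.
  have : 0 =
      a1 ^+ 2 * (a2 ^+ 2 * r3 + a3 ^+ 2 * r2 - (a2 * a3 * s1) *+ 2)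
      + a2 ^+ 2 * (a1 ^+ 2 * r3 + a3 ^+ 2 * r1 - (a1 * a3 * s2) *+ 2)
      + a3 ^+ 2 * (a1 ^+ 2 * r2 + a2 ^+ 2 * r1 - (a1 * a2 * s3) *+ 2)
      + (a2 * a3 * (a1 * a3 * s3 + a1 * a2 * s2 - (a1 ^+ 2 * s1 + a2 * a3 * r1))
         + a1 * a3 * (a2 * a3 * s3 + a1 * a2 * s1 - (a2 ^+ 2 * s2 + a1 * a3 * r2))
         + a1 * a2 * (a2 * a3 * s2 + a1 * a3 * s1 - (a3 ^+ 2 * s3 + a1 * a2 * r3))) *+ 2.
    by ring.
  by rewrite K1 K2 K3 H1 H2 H3 => ->; rewrite /s; ring.
have q0 : a1 * m1 + a2 * m2 + a3 * m3 = 0.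
  have : a1 * m1 + a2 * m2 + a3 * m3 = s * (r1 + r2 + r3)
      - ((a2 ^+ 2 * r3 + a3 ^+ 2 * r2 - (a2 * a3 * s1) *+ 2)
         + (a1 ^+ 2 * r3 + a3 ^+ 2 * r1 - (a1 * a3 * s2) *+ 2)
         + (a1 ^+ 2 * r2 + a2 ^+ 2 * r1 - (a1 * a2 * s3) *+ 2)).
    by rewrite /m1 /m2 /m3 /s; ring.
  by rewrite K1 K2 K3 g0 t0 mulr0 !addr0 subr0.
(* These are the entries of [s q = a m^T + m a^T + (s tr q - a . m) I - tr q a a^T - C], with [C]
   the polarized cofactor matrix [g I]; here [tr q], [a . m] and [g] all vanish. *)
split=> //; split.
- transitivity (a1 * m1 *+ 2 + (s - a1 ^+ 2) * (r1 + r2 + r3) - (a1 * m1 + a2 * m2 + a3 * m3) - g).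
    by rewrite -K1 /m1 /m2 /m3 /s; ring.
  by rewrite q0 g0 t0 mulr0 !subr0 addr0.
- transitivity (a2 * m2 *+ 2 + (s - a2 ^+ 2) * (r1 + r2 + r3) - (a1 * m1 + a2 * m2 + a3 * m3) - g).
    by rewrite -K2 /m1 /m2 /m3 /s; ring.
  by rewrite q0 g0 t0 mulr0 !subr0 addr0.
- transitivity (a3 * m3 *+ 2 + (s - a3 ^+ 2) * (r1 + r2 + r3) - (a1 * m1 + a2 * m2 + a3 * m3) - g).
    by rewrite -K3 /m1 /m2 /m3 /s; ring.
  by rewrite q0 g0 t0 mulr0 !subr0 addr0.
- by rewrite -[RHS]subr0 -(mulr0 (a2 * a3)) -t0 -[RHS]subr0 -H1 /m2 /m3 /s; ring.
- by rewrite -[RHS]subr0 -(mulr0 (a1 * a3)) -t0 -[RHS]subr0 -H2 /m1 /m3 /s; ring.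
- by rewrite -[RHS]subr0 -(mulr0 (a1 * a2)) -t0 -[RHS]subr0 -H3 /m1 /m2 /s; ring.
Qed.

(** Contraction with [a] leaves [k s = 0]: a non-isotropic [a] is independent of the vectors
    orthogonal to it. *)
Lemma orthogonal_decomp (s a1 a2 a3 u1 u2 u3 k : F) : s != 0 ->
  s = a1 ^+ 2 + a2 ^+ 2 + a3 ^+ 2 -> a1 * u1 + a2 * u2 + a3 * u3 = 0 ->
  u1 + k * a1 = 0 -> u2 + k * a2 = 0 -> u3 + k * a3 = 0 ->
  [/\ u1 = 0, u2 = 0 & u3 = 0].
Proof.
move=> s0 es e e1 e2 e3.
have k0 : k = 0.
  apply: (mulfI s0); rewrite mulr0 es.
  transitivity (a1 * (u1 + k * a1) + a2 * (u2 + k * a2) + a3 * (u3 + k * a3)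
    - (a1 * u1 + a2 * u2 + a3 * u3)); first by ring.
  by rewrite e e1 e2 e3 !mulr0 !addr0 subr0.
by rewrite k0 !mul0r !addr0 in e1 e2 e3.
Qed.

Definition sym3_mul (s : F) (q : sym3 F) :=
  Sym3 (s * x1 q) (s * x2 q) (s * x3 q) (s * y1 q) (s * y2 q) (s * y3 q).

Definition sym3_outer (a1 a2 a3 m1 m2 m3 : F) :=
  Sym3 (a1 * m1 *+ 2) (a2 * m2 *+ 2) (a3 * m3 *+ 2)
    (a2 * m3 + a3 * m2) (a1 * m3 + a3 * m1) (a1 * m2 + a2 * m1).

Lemma sym3_bianchiZ w s q0 q1 q2 q3 : sym3_bianchi w q0 q1 q2 q3 ->
  sym3_bianchi w (sym3_mul s q0) (sym3_mul s q1) (sym3_mul s q2) (sym3_mul s q3).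
Proof.
have E a b c : a + b + c = 0 -> s * a + s * b + s * c = 0 :> F.
  by rewrite -!mulrDr => ->; rewrite mulr0.
have E' a b c : w * a + b - c = 0 -> w * (s * a) + s * b - s * c = 0 :> F.
  by move=> e; rewrite mulrCA -mulrDr -mulrBr e mulr0.
move=> [] [d1 d2 d3] [] [b1 b2 b3] [b4 b5 b6] [b7 b8 b9].
by split; split; [exact: E..| | |]; split; exact: E'.
Qed.

(** Each vector equation has the form [u + k a = 0], where [u] is a combination of the [m_e] and so
    is orthogonal to [a]; thus [u = 0]. For each fixed component of the [m_e], the equations [u = 0]
    form the system of [rank_one_rigidity]. *)
Lemma sym3_outer_bianchi w s a1 a2 a3 m01 m02 m03 m11 m12 m13 m21 m22 m23 m31 m32 m33 :
  w != 0 -> s != 0 -> s = a1 ^+ 2 + a2 ^+ 2 + a3 ^+ 2 ->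
  a1 * m01 + a2 * m02 + a3 * m03 = 0 -> a1 * m11 + a2 * m12 + a3 * m13 = 0 ->
  a1 * m21 + a2 * m22 + a3 * m23 = 0 -> a1 * m31 + a2 * m32 + a3 * m33 = 0 ->
  sym3_bianchi w (sym3_outer a1 a2 a3 m01 m02 m03) (sym3_outer a1 a2 a3 m11 m12 m13)
    (sym3_outer a1 a2 a3 m21 m22 m23) (sym3_outer a1 a2 a3 m31 m32 m33) ->
  [/\ [/\ m01 = 0, m02 = 0 & m03 = 0], [/\ m11 = 0, m12 = 0 & m13 = 0],
     [/\ m21 = 0, m22 = 0 & m23 = 0] & [/\ m31 = 0, m32 = 0 & m33 = 0]].
Proof.
move=> w0 s0 es e0 e1 e2 e3; rewrite /sym3_bianchi /=.
move=> [] [d1 d2 d3] [] [b1 b2 b3] [b4 b5 b6] [b7 b8 b9].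
have ss0 : a1 ^+ 2 + a2 ^+ 2 + a3 ^+ 2 != 0 by rewrite -es.
have [|||| f1 f2 f3] := @orthogonal_decomp s a1 a2 a3 (a1 * m11 + a2 * m21 + a3 * m31)
  (a1 * m12 + a2 * m22 + a3 * m32) (a1 * m13 + a2 * m23 + a3 * m33) (m11 + m22 + m33) s0 es.
- transitivity (a1 * (a1 * m11 + a2 * m12 + a3 * m13) + a2 * (a1 * m21 + a2 * m22 + a3 * m23)
    + a3 * (a1 * m31 + a2 * m32 + a3 * m33)); first by ring.
  by rewrite e1 e2 e3 !mulr0 !addr0.
- by rewrite -[RHS]d1; ring.
- by rewrite -[RHS]d2; ring.
- by rewrite -[RHS]d3; ring.
have [|||| g1 g2 g3] := @orthogonal_decomp s a1 a2 a3 (w * a1 * m01 + a3 * m21 - a2 * m31)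
  (w * a1 * m02 + a3 * m22 - a2 * m32) (w * a1 * m03 + a3 * m23 - a2 * m33)
  (w * m01 + m23 - m32) s0 es.
- transitivity (w * a1 * (a1 * m01 + a2 * m02 + a3 * m03)
    + a3 * (a1 * m21 + a2 * m22 + a3 * m23) - a2 * (a1 * m31 + a2 * m32 + a3 * m33)).
    by ring.
  by rewrite e0 e2 e3 !mulr0 subr0 addr0.
- by rewrite -[RHS]b1; ring.
- by rewrite -[RHS]b2; ring.
- by rewrite -[RHS]b3; ring.
have [|||| g4 g5 g6] := @orthogonal_decomp s a1 a2 a3 (w * a2 * m01 + a1 * m31 - a3 * m11)
  (w * a2 * m02 + a1 * m32 - a3 * m12) (w * a2 * m03 + a1 * m33 - a3 * m13)
  (w * m02 + m31 - m13) s0 es.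
- transitivity (w * a2 * (a1 * m01 + a2 * m02 + a3 * m03)
    + a1 * (a1 * m31 + a2 * m32 + a3 * m33) - a3 * (a1 * m11 + a2 * m12 + a3 * m13)).
    by ring.
  by rewrite e0 e3 e1 !mulr0 subr0 addr0.
- by rewrite -[RHS]b4; ring.
- by rewrite -[RHS]b5; ring.
- by rewrite -[RHS]b6; ring.
have [|||| g7 g8 g9] := @orthogonal_decomp s a1 a2 a3 (w * a3 * m01 + a2 * m11 - a1 * m21)
  (w * a3 * m02 + a2 * m12 - a1 * m22) (w * a3 * m03 + a2 * m13 - a1 * m23)
  (w * m03 + m12 - m21) s0 es.
- transitivity (w * a3 * (a1 * m01 + a2 * m02 + a3 * m03)
    + a2 * (a1 * m11 + a2 * m12 + a3 * m13) - a1 * (a1 * m21 + a2 * m22 + a3 * m23)).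
    by ring.
  by rewrite e0 e1 e2 !mulr0 subr0 addr0.
- by rewrite -[RHS]b7; ring.
- by rewrite -[RHS]b8; ring.
- by rewrite -[RHS]b9; ring.
have [-> -> -> ->] := rank_one_rigidity w0 ss0 f1 g1 g4 g7.
have [-> -> -> ->] := rank_one_rigidity w0 ss0 f2 g2 g5 g8.
by have [-> -> -> ->] := rank_one_rigidity w0 ss0 f3 g3 g6 g9.
Qed.

Lemma sym3_outer_zero s a1 a2 a3 m1 m2 m3 q : s != 0 ->
  sym3_mul s q = sym3_outer a1 a2 a3 m1 m2 m3 ->
  [/\ m1 = 0, m2 = 0 & m3 = 0] -> sym3_zero q.
Proof.
move=> s0 e [z1 z2 z3]; move: e; rewrite z1 z2 z3.
have E u v : s * u = v -> v = 0 -> u = 0 by move=> + v0; rewrite v0 => h; apply: (mulfI s0); rewrite h mulr0.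
by case=> h1 h2 h3 h4 h5 h6; split; split; (apply: E; [eassumption|rewrite !mulr0 ?addr0 ?mul0rn //]).
Qed.

Lemma sym3_rigidity w p q0 q1 q2 q3 : w != 0 -> tr3 p != 0 ->
  cofactor_scalar p p ->
  cofactor_scalar p q0 -> cofactor_scalar p q1 -> cofactor_scalar p q2 -> cofactor_scalar p q3 ->
  tr3 q0 = 0 -> tr3 q1 = 0 -> tr3 q2 = 0 -> tr3 q3 = 0 ->
  sym3_bianchi w q0 q1 q2 q3 ->
  [/\ sym3_zero q0, sym3_zero q1, sym3_zero q2 & sym3_zero q3].
Proof.
move=> w0 tp pp p0 p1 p2 p3 t0 t1 t2 t3 B.
have [[a a0 [ex ey]]|[d [a1 [a2 [a3 [d0 es ex ey]]]]]] := cofactor_scalar_cases pp tp.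
  by split; [move: p0 t0|move: p1 t1|move: p2 t2|move: p3 t3] => P T;
    exact: (cofactor_scalar_umbilic a0 P T ex ey).
(* The nonzero trace, that is the nonzero scalar curvature, makes [a] non-isotropic. *)
have s0 : a1 ^+ 2 + a2 ^+ 2 + a3 ^+ 2 != 0 by rewrite -es mulf_neq0.
have outer q : cofactor_scalar p q -> tr3 q = 0 -> exists m1 m2 m3,
    a1 * m1 + a2 * m2 + a3 * m3 = 0 /\
    sym3_mul (a1 ^+ 2 + a2 ^+ 2 + a3 ^+ 2) q = sym3_outer a1 a2 a3 m1 m2 m3.
  move=> P T; have [e [e1 e2 e3] [e4 e5 e6]] := cofactor_scalar_rank_one d0 s0 ex ey P T.
  by do 3!eexists; split; first exact: e; rewrite /sym3_mul e1 e2 e3 e4 e5 e6.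
have [m01 [m02 [m03 [N0 E0]]]] := outer _ p0 t0.
have [m11 [m12 [m13 [N1 E1]]]] := outer _ p1 t1.
have [m21 [m22 [m23 [N2 E2]]]] := outer _ p2 t2.
have [m31 [m32 [m33 [N3 E3]]]] := outer _ p3 t3.
have := sym3_bianchiZ (a1 ^+ 2 + a2 ^+ 2 + a3 ^+ 2) B; rewrite E0 E1 E2 E3 => {}B.
have [z0 z1 z2 z3] := sym3_outer_bianchi w0 s0 erefl N0 N1 N2 N3 B.
by split; [exact: sym3_outer_zero s0 E0 z0|exact: sym3_outer_zero s0 E1 z1
  |exact: sym3_outer_zero s0 E2 z2|exact: sym3_outer_zero s0 E3 z3].
Qed.

End Rigidity.

(** * Einstein curvature tensors in a Lorentz frame *)

Section LorentzFrame.
Context {R : realFieldType}.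
Implicit Types (K D : 'I_4 -> 'I_4 -> 'I_4 -> 'I_4 -> R) (a b c d e f : 'I_4).

Definition eta4 a : R := if a == 0 :> nat then -1 else 1.

(* [K a b c d] is the component along the frame vector [d] of the image of the
   frame vector [c] by the curvature operator of the frame vectors [a] and [b]. *)
Record lorentz_tensor (lam : R) K : Prop := LorentzTensor {
  lt_anti : forall a b c d, K b a c d = - K a b c d;
  lt_skew : forall a b c d, K a b d c * eta4 c = - (K a b c d * eta4 d);
  lt_bianchi : forall a b c d, K a b c d + K b c a d + K c a b d = 0;
  lt_ricci : forall a b, \sum_c K c a b c = lam * (if a == b then eta4 a else 0)
}.

(** Component along [f] of [[K_ab, K_cd] - K(K_ab c, d) - K(c, K_ab d)] applied to [e], made
    bilinear: [D] replaces the inner occurrence of the curvature in each term, [K] the outer one. *)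
Definition semi_comp K D a b c d e f : R :=
  \sum_h D c d e h * K a b h f - \sum_h D a b e h * K c d h f
  - \sum_h D a b c h * K h d e f - \sum_h D a b d h * K c h e f.

Definition i0 : 'I_4 := ord0.
Definition i1 : 'I_4 := lift ord0 ord0.
Definition i2 : 'I_4 := lift ord0 (lift ord0 ord0).
Definition i3 : 'I_4 := lift ord0 (lift ord0 (lift ord0 ord0)).

Lemma sum4 (V : nmodType) (F : 'I_4 -> V) : \sum_h F h = F i0 + (F i1 + (F i2 + F i3)).
Proof. by rewrite !big_ord_recl big_ord0 addr0. Qed.

Lemma eta40 : eta4 i0 = -1. Proof. by []. Qed.
Lemma eta41 : eta4 i1 = 1. Proof. by []. Qed.
Lemma eta42 : eta4 i2 = 1. Proof. by []. Qed.
Lemma eta43 : eta4 i3 = 1. Proof. by []. Qed.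

Section Table.
Variables (lam : R) (K : 'I_4 -> 'I_4 -> 'I_4 -> 'I_4 -> R).
Hypothesis hK : lorentz_tensor lam K.

Lemma lt_diag a c d : K a a c d = 0.
Proof. by have := lt_anti hK a a c d; lra. Qed.

Lemma lt_diag_r a b c : K a b c c = 0.
Proof.
have := lt_skew hK a b c c; rewrite /eta4; case: ifP => _; lra.
Qed.

Lemma lt_boost a b : [/\ K a b i1 i0 = K a b i0 i1, K a b i2 i0 = K a b i0 i2
  & K a b i3 i0 = K a b i0 i3].
Proof.
have := lt_skew hK a b i0 i1; have := lt_skew hK a b i0 i2.
have := lt_skew hK a b i0 i3; rewrite eta40 eta41 eta42 eta43 => *.
by split; lra.
Qed.

Lemma lt_rot a b : [/\ K a b i3 i2 = - K a b i2 i3, K a b i1 i3 = - K a b i3 i1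
  & K a b i2 i1 = - K a b i1 i2].
Proof.
have := lt_skew hK a b i2 i3; have := lt_skew hK a b i3 i1.
have := lt_skew hK a b i1 i2; rewrite eta41 eta42 eta43 => *.
by split; lra.
Qed.

Definition lt_pairs_l := (lt_anti hK i0 i1, lt_anti hK i0 i2, lt_anti hK i0 i3,
  lt_anti hK i2 i3, lt_anti hK i3 i1, lt_anti hK i1 i2, lt_diag).

Lemma lt_boost1 a b : K a b i1 i0 = K a b i0 i1. Proof. by have [] := lt_boost a b. Qed.
Lemma lt_boost2 a b : K a b i2 i0 = K a b i0 i2. Proof. by have [] := lt_boost a b. Qed.
Lemma lt_boost3 a b : K a b i3 i0 = K a b i0 i3. Proof. by have [] := lt_boost a b. Qed.
Lemma lt_rot1 a b : K a b i3 i2 = - K a b i2 i3. Proof. by have [] := lt_rot a b. Qed.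
Lemma lt_rot2 a b : K a b i1 i3 = - K a b i3 i1. Proof. by have [] := lt_rot a b. Qed.
Lemma lt_rot3 a b : K a b i2 i1 = - K a b i1 i2. Proof. by have [] := lt_rot a b. Qed.

Definition lt_pairs := (lt_pairs_l, lt_boost1, lt_boost2, lt_boost3,
  lt_rot1, lt_rot2, lt_rot3, lt_diag_r).

(** In the basis 01, 02, 03, 23, 31, 12 of bivectors the curvature operator has blocks [[[E, B],
    [B, -E]]] with [E] and [B] symmetric: it commutes with the Hodge star and is the real form of
    [E + i B]. *)
Definition lt_table_type : Prop :=
 [/\ [/\ K i0 i2 i0 i1 = K i0 i1 i0 i2, K i0 i3 i0 i1 = K i0 i1 i0 i3
       & K i0 i3 i0 i2 = K i0 i2 i0 i3],
     [/\ K i0 i2 i2 i3 = K i0 i1 i3 i1, K i0 i3 i2 i3 = K i0 i1 i1 i2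
       & K i0 i3 i3 i1 = K i0 i2 i1 i2],
     [/\ [/\ K i2 i3 i0 i1 = K i0 i1 i2 i3, K i2 i3 i0 i2 = K i0 i1 i3 i1
           & K i2 i3 i0 i3 = K i0 i1 i1 i2],
         [/\ K i3 i1 i0 i1 = K i0 i1 i3 i1, K i3 i1 i0 i2 = K i0 i2 i3 i1
           & K i3 i1 i0 i3 = K i0 i2 i1 i2]
       & [/\ K i1 i2 i0 i1 = K i0 i1 i1 i2, K i1 i2 i0 i2 = K i0 i2 i1 i2
           & K i1 i2 i0 i3 = K i0 i3 i1 i2]]
   & [/\ [/\ K i2 i3 i2 i3 = - K i0 i1 i0 i1, K i2 i3 i3 i1 = - K i0 i1 i0 i2
           & K i2 i3 i1 i2 = - K i0 i1 i0 i3],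
         [/\ K i3 i1 i2 i3 = - K i0 i1 i0 i2, K i3 i1 i3 i1 = - K i0 i2 i0 i2
           & K i3 i1 i1 i2 = - K i0 i2 i0 i3]
       & [/\ K i1 i2 i2 i3 = - K i0 i1 i0 i3, K i1 i2 i3 i1 = - K i0 i2 i0 i3
           & K i1 i2 i1 i2 = - K i0 i3 i0 i3]]].

(** All is linear in the components of [K]. The first Bianchi identity gives the pair symmetry and
    [tr B = 0]; the Einstein condition gives the block [-E], the symmetry of [B], and
    [tr E = lam]. *)
Lemma lt_table : lt_table_type /\
  (K i0 i1 i0 i1 + K i0 i2 i0 i2 + K i0 i3 i0 i3 = lam /\
   K i0 i1 i2 i3 + K i0 i2 i3 i1 + K i0 i3 i1 i2 = 0).
Proof.
have B d : K i0 i1 i2 d + K i1 i2 i0 d + K i2 i0 i1 d = 0 /\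
  K i0 i2 i3 d + K i2 i3 i0 d + K i3 i0 i2 d = 0 /\
  K i0 i3 i1 d + K i3 i1 i0 d + K i1 i0 i3 d = 0 /\
  K i1 i2 i3 d + K i2 i3 i1 d + K i3 i1 i2 d = 0.
  by do !split; exact: lt_bianchi hK _ _ _ _.
have [b1 [b2 [b3 b4]]] := B i0; have [b5 [b6 [b7 b8]]] := B i1.
have [b9 [b10 [b11 b12]]] := B i2; have [b13 [b14 [b15 b16]]] := B i3.
have r1 := lt_ricci hK i0 i0; have r2 := lt_ricci hK i1 i1.
have r3 := lt_ricci hK i2 i2; have r4 := lt_ricci hK i3 i3.
have r5 := lt_ricci hK i0 i1; have r6 := lt_ricci hK i0 i2.
have r7 := lt_ricci hK i0 i3; have r8 := lt_ricci hK i1 i2.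
have r9 := lt_ricci hK i1 i3; have r10 := lt_ricci hK i2 i3.
rewrite !sum4 /= !(eta40, eta41, eta42, eta43) in r1 r2 r3 r4 r5 r6 r7 r8 r9 r10.
rewrite !lt_pairs in r1 r2 r3 r4 r5 r6 r7 r8 r9 r10.
rewrite !lt_pairs in b1 b2 b3 b4 b5 b6 b7 b8 b9 b10 b11 b12 b13 b14 b15 b16.
clear B hK.
by do !split; lra.
Qed.

End Table.

End LorentzFrame.

(** * Complexification and rigidity at a point *)

Section LorentzRigidity.
Context {R : rcfType}.
Implicit Types (K D : 'I_4 -> 'I_4 -> 'I_4 -> 'I_4 -> R).

(* The curvature operator on bivectors commutes with the Hodge star, hence it is
   complex linear: this is its matrix on C^3, the bivectors [0j] being real. *)
Definition lt_complex K : sym3 R[i] :=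
  Sym3 (Complex (K i0 i1 i0 i1) (K i0 i1 i2 i3)) (Complex (K i0 i2 i0 i2) (K i0 i2 i3 i1))
    (Complex (K i0 i3 i0 i3) (K i0 i3 i1 i2)) (Complex (K i0 i2 i0 i3) (K i0 i2 i1 i2))
    (Complex (K i0 i1 i0 i3) (K i0 i1 i1 i2)) (Complex (K i0 i1 i0 i2) (K i0 i1 i3 i1)).

Lemma eq_complexP (x y : R[i]) :
  complex.Re x = complex.Re y -> complex.Im x = complex.Im y -> x = y.
Proof. by case: x y => [a b] [c d] /= -> ->. Qed.

(** The reason for [D = K]: exchanging [u] and [v] in [Z u x Z v = Z (Z u x v)] and subtracting
    gives [Z (tr Z - Z) = 2 cof Z], while Cayley-Hamilton gives [Z (tr Z - Z) = t - cof Z] with [t]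
    the second invariant; hence [3 cof Z = t]. The general case is the polarization of this, checked
    on components. *)
Lemma semi_comp_cofactor lam mu K D : lorentz_tensor lam K -> lorentz_tensor mu D ->
  (forall a b c d e f, semi_comp K D a b c d e f + semi_comp D K a b c d e f = 0) ->
  cofactor_scalar (lt_complex K) (lt_complex D).
Proof.
move=> hK hD hS.
(* The components go by twos: their last index pairs, such as 01 and 23, are Hodge dual and yield
   the real and imaginary parts of one complex equation. *)
have s1 := hS i0 i1 i0 i2 i0 i1; have s2 := hS i0 i1 i0 i2 i2 i3.
have s3 := hS i0 i1 i0 i3 i0 i1; have s4 := hS i0 i1 i0 i3 i2 i3.
have s5 := hS i0 i2 i0 i1 i0 i2; have s6 := hS i0 i2 i0 i1 i3 i1.
have s7 := hS i0 i1 i0 i2 i0 i3; have s8 := hS i0 i1 i0 i2 i1 i2.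
have s9 := hS i0 i2 i0 i1 i0 i3; have s10 := hS i0 i2 i0 i1 i1 i2.
have s11 := hS i0 i1 i0 i3 i0 i2; have s12 := hS i0 i1 i0 i3 i3 i1.
have s13 := hS i0 i3 i0 i1 i0 i2; have s14 := hS i0 i3 i0 i1 i3 i1.
have [[[k1 k2 k3] [k4 k5 k6] [[k7 k8 k9] [k10 k11 k12] [k13 k14 k15]]
  [[k16 k17 k18] [k19 k20 k21] [k22 k23 k24]]] _] := lt_table hK.
have [[[d1 d2 d3] [d4 d5 d6] [[d7 d8 d9] [d10 d11 d12] [d13 d14 d15]]
  [[d16 d17 d18] [d19 d20 d21] [d22 d23 d24]]] _] := lt_table hD.
rewrite /semi_comp !sum4 !(lt_pairs hK, lt_pairs hD) in s1 s2 s3 s4 s5 s6 s7 s8 s9 s10 s11 s12 s13 s14.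
rewrite ?(k1, k2, k3, k4, k5, k6, k7, k8, k9, k10, k11, k12, k13, k14, k15, k16, k17,
  k18, k19, k20, k21, k22, k23, k24, d1, d2, d3, d4, d5, d6, d7, d8, d9, d10, d11, d12,
  d13, d14, d15, d16, d17, d18, d19, d20, d21, d22, d23, d24)
  in s1 s2 s3 s4 s5 s6 s7 s8 s9 s10 s11 s12 s13 s14.
clear - s1 s2 s3 s4 s5 s6 s7 s8 s9 s10 s11 s12 s13 s14.
(* The constant is set to the first diagonal entry. *)
eexists; split; split; first (by []).
all: apply: eq_complexP; rewrite /=; lra.
Qed.

Lemma ord4_ind (P : 'I_4 -> Prop) : P i0 -> P i1 -> P i2 -> P i3 -> forall a, P a.
Proof.
move=> p0 p1 p2 p3 a.
have : a \in [:: i0; i1; i2; i3] by case: a => -[|[|[|[|]]]] // ?; rewrite !inE.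
by rewrite !inE => /or4P[] /eqP ->.
Qed.

Lemma lt_complex_tr lam K : lorentz_tensor lam K -> tr3 (lt_complex K) = (Complex lam 0 : R[i]).
Proof.
by move=> /lt_table[_ [e1 e2]]; apply: eq_complexP; rewrite /= ?e1 ?e2.
Qed.

(** The index triple 123 gives the divergence equations and the triples 0jk the curl equations. The
    imaginary unit arises because passing from a bivector 0j to its dual multiplies a row of the
    complex matrix by [-i]. *)
Lemma lt_complex_bianchi (D : 'I_4 -> 'I_4 -> 'I_4 -> 'I_4 -> 'I_4 -> R) :
  (forall e, lorentz_tensor 0 (D e)) ->
  (forall e a b c d, D e a b c d + D a b e c d + D b e a c d = 0) ->
  sym3_bianchi (Complex 0 1 : R[i]) (lt_complex (D i0)) (lt_complex (D i1))
    (lt_complex (D i2)) (lt_complex (D i3)).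
Proof.
move=> hD hB.
have table e := (lt_table (hD e)).1.
have B c d := (hB i1 i2 i3 c d, (hB i0 i2 i3 c d, (hB i0 i3 i1 c d, hB i0 i1 i2 c d))).
have [b1 [b2 [b3 b4]]] := B i0 i1; have [b5 [b6 [b7 b8]]] := B i0 i2.
have [b9 [b10 [b11 b12]]] := B i0 i3; have [b13 [b14 [b15 b16]]] := B i2 i3.
have [b17 [b18 [b19 b20]]] := B i3 i1; have [b21 [b22 [b23 b24]]] := B i1 i2.
rewrite !(lt_pairs_l (hD i0), lt_pairs_l (hD i1), lt_pairs_l (hD i2), lt_pairs_l (hD i3))
  in b1 b2 b3 b4 b5 b6 b7 b8 b9 b10 b11 b12 b13 b14 b15 b16 b17 b18 b19 b20 b21 b22 b23 b24.
have [[k1 k2 k3] [k4 k5 k6] [[k7 k8 k9] [k10 k11 k12] [k13 k14 k15]]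
  [[k16 k17 k18] [k19 k20 k21] [k22 k23 k24]]] := table i0.
have [[l1 l2 l3] [l4 l5 l6] [[l7 l8 l9] [l10 l11 l12] [l13 l14 l15]]
  [[l16 l17 l18] [l19 l20 l21] [l22 l23 l24]]] := table i1.
have [[m1 m2 m3] [m4 m5 m6] [[m7 m8 m9] [m10 m11 m12] [m13 m14 m15]]
  [[m16 m17 m18] [m19 m20 m21] [m22 m23 m24]]] := table i2.
have [[n1 n2 n3] [n4 n5 n6] [[n7 n8 n9] [n10 n11 n12] [n13 n14 n15]]
  [[n16 n17 n18] [n19 n20 n21] [n22 n23 n24]]] := table i3.
rewrite ?(k1, k2, k3, k4, k5, k6, k7, k8, k9, k10, k11, k12, k13, k14, k15, k16, k17, k18, k19, k20, k21, k22, k23, k24,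
  l1, l2, l3, l4, l5, l6, l7, l8, l9, l10, l11, l12, l13, l14, l15, l16, l17, l18, l19, l20, l21, l22, l23, l24,
  m1, m2, m3, m4, m5, m6, m7, m8, m9, m10, m11, m12, m13, m14, m15, m16, m17, m18, m19, m20, m21, m22, m23, m24,
  n1, n2, n3, n4, n5, n6, n7, n8, n9, n10, n11, n12, n13, n14, n15, n16, n17, n18, n19, n20, n21, n22, n23, n24)
  in b1 b2 b3 b4 b5 b6 b7 b8 b9 b10 b11 b12 b13 b14 b15 b16 b17 b18 b19 b20 b21 b22 b23 b24.
clear - b1 b2 b3 b4 b5 b6 b7 b8 b9 b10 b11 b12 b13 b14 b15 b16 b17 b18 b19 b20 b21 b22 b23 b24.
by split; split; try (split; apply: eq_complexP; rewrite /=; lra);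
  apply: eq_complexP; rewrite /=; lra.
Qed.

Lemma lt_complex_zero mu D : lorentz_tensor mu D -> sym3_zero (lt_complex D) ->
  forall a b c d, D a b c d = 0.
Proof.
move=> hD.
have [[[k1 k2 k3] [k4 k5 k6] [[k7 k8 k9] [k10 k11 k12] [k13 k14 k15]]
  [[k16 k17 k18] [k19 k20 k21] [k22 k23 k24]]] _] := lt_table hD.
move=> [[[z1 w1] [z2 w2] [z3 w3]] [[z4 w4] [z5 w5] [z6 w6]]].
have pairs_r a b : [/\ D a b i0 i1 = 0, D a b i0 i2 = 0 & D a b i0 i3 = 0] ->
    [/\ D a b i2 i3 = 0, D a b i3 i1 = 0 & D a b i1 i2 = 0] -> forall c d, D a b c d = 0.
  move=> [e1 e2 e3] [e4 e5 e6].
  by apply: ord4_ind; apply: ord4_ind;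
    rewrite !(lt_boost1 hD, lt_boost2 hD, lt_boost3 hD, lt_rot1 hD, lt_rot2 hD, lt_rot3 hD,
      lt_diag_r hD, e1, e2, e3, e4, e5, e6) ?oppr0.
have zero : [/\ forall c d, D i0 i1 c d = 0, forall c d, D i0 i2 c d = 0 &
   forall c d, D i0 i3 c d = 0] /\ [/\ forall c d, D i2 i3 c d = 0, forall c d, D i3 i1 c d = 0 &
   forall c d, D i1 i2 c d = 0].
  by split; split; apply: pairs_r; split;
    rewrite ?(k1, k2, k3, k4, k5, k6, k7, k8, k9, k10, k11, k12, k13, k14, k15, k16, k17, k18,
      k19, k20, k21, k22, k23, k24) ?(z1, z2, z3, z4, z5, z6, w1, w2, w3, w4, w5, w6) ?oppr0.
have [[e1 e2 e3] [e4 e5 e6]] := zero.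
by apply: ord4_ind; apply: ord4_ind => c d;
  rewrite !(lt_pairs_l hD, e1, e2, e3, e4, e5, e6) ?oppr0.
Qed.

(** [D e] stands for the covariant derivative of the curvature along the frame vector [e]. Nothing
    links [D] to [K] but the linearized semi-symmetry condition. *)
Theorem lorentz_rigidity lam K (D : 'I_4 -> 'I_4 -> 'I_4 -> 'I_4 -> 'I_4 -> R) :
  lam != 0 -> lorentz_tensor lam K -> (forall e, lorentz_tensor 0 (D e)) ->
  (forall a b c d e f, semi_comp K K a b c d e f = 0) ->
  (forall e a b c d f h, semi_comp K (D e) a b c d f h + semi_comp (D e) K a b c d f h = 0) ->
  (forall e a b c d, D e a b c d + D a b e c d + D b e a c d = 0) ->
  forall e a b c d, D e a b c d = 0.
Proof.
move=> lam0 hK hD hS hSD hB.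
have two : 2 != 0 :> R[i] by rewrite pnatr_eq0.
have three : 3 != 0 :> R[i] by rewrite pnatr_eq0.
have w0 : (Complex 0 1 : R[i]) != 0 by rewrite eq_complex /= oner_eq0 andbF.
have tK : tr3 (lt_complex K) != 0.
  by rewrite (lt_complex_tr hK) eq_complex /= negb_and lam0.
have tD e : tr3 (lt_complex (D e)) = 0 by rewrite (lt_complex_tr (hD e)).
have cK : cofactor_scalar (lt_complex K) (lt_complex K).
  by apply: (semi_comp_cofactor hK hK) => *; rewrite !hS addr0.
have cD e : cofactor_scalar (lt_complex K) (lt_complex (D e)).
  by apply: (semi_comp_cofactor hK (hD e)) => *; exact: hSD.
have [z0 z1 z2 z3] := sym3_rigidity two three w0 tK cK (cD i0) (cD i1) (cD i2) (cD i3)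
  (tD _) (tD _) (tD _) (tD _) (lt_complex_bianchi hD hB).
by apply: ord4_ind; [exact: lt_complex_zero (hD _) z0|exact: lt_complex_zero (hD _) z1
  |exact: lt_complex_zero (hD _) z2|exact: lt_complex_zero (hD _) z3].
Qed.

End LorentzRigidity.

(** * Curvature tensors and change of frame *)

Ltac tens_module :=
  repeat match goal with |- context [tens ?T ?u ?v ?w] => generalize (tens T u v w); intro end;
  apply/matrixP => ? ?; rewrite !(addmxE, oppmxE, scalemxE); ring.

Section TensorContractions.
Context {A : comNzRingType} {n : nat}.
Implicit Types (T D dT : 'I_n -> 'I_n -> 'M[A]_n) (L : 'M[A]_n) (u v w x y z : 'rV[A]_n).

(** Frame-free counterpart of [semi_comp], with [D] inside and [T] outside. *)
Definition semi_form T D u v x y w : 'rV[A]_n :=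
  tens T u v (tens D x y w) - tens T x y (tens D u v w)
  - tens T (tens D u v x) y w - tens T x (tens D u v y) w.

Lemma vec_ind (Q : 'rV[A]_n -> Prop) :
  (forall a, Q (delta_mx 0 a)) -> (forall c u v, Q u -> Q v -> Q (c *: u + v)) ->
  (Q 0) -> forall u, Q u.
Proof.
move=> Qd Ql Q0 u; rewrite (row_sum_delta u).
by elim/big_rec : _ => // a v _ Qv; exact: Ql.
Qed.

Lemma tens_add T D u v w :
  tens (fun a b => T a b + D a b) u v w = tens T u v w + tens D u v w.
Proof.
rewrite /tens -big_split; apply: eq_bigr => a _; rewrite -big_split.
by apply: eq_bigr => b _; rewrite mulmxDr scalerDr.
Qed.

Definition tensP := (@tensD1 A n, @tensD2 A n, @tensD3 A n, @tensZ1 A n, @tensZ2 A n,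
  @tensZ3 A n, @tens01 A n, @tens02 A n, @tens03 A n).

Lemma tens_anti_comp T : (forall a b, T b a = - T a b) ->
  forall u v w, tens T v u w = - tens T u v w.
Proof.
move=> hT u v w; rewrite /tens exchange_big -sumrN; apply: eq_bigr => a _ /=.
by rewrite -sumrN; apply: eq_bigr => b _; rewrite hT mulmxN scalerN mulrC.
Qed.

Lemma tens_bianchi_comp T : (forall a b c d, T a b c d + T b c a d + T c a b d = 0) ->
  forall u v w, tens T u v w + tens T v w u + tens T w u v = 0.
Proof.
move=> hT.
have lin k (p q r p' q' r' : 'rV[A]_n) : p + q + r = 0 -> p' + q' + r' = 0 ->
    k *: p + p' + (k *: q + q') + (k *: r + r') = 0.
  move=> e e'; transitivity (k *: (p + q + r) + (p' + q' + r')); last by rewrite e e' scaler0 addr0.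
  by apply/matrixP => i j; rewrite !(addmxE, scalemxE); ring.
apply: vec_ind => [a|k u u' eu eu' v w|v w]; last by rewrite !tensP !addr0.
  apply: vec_ind => [b|k v v' ev ev' w|w]; last by rewrite !tensP !addr0.
    apply: vec_ind => [c|k w w' ew ew'|]; last by rewrite !tensP !addr0.
      by apply/matrixP => i d; rewrite !addmxE ord1 !tens_deltaE hT mxE.
    by rewrite !tensP; exact: lin.
  by rewrite !tensP; exact: lin.
by rewrite !tensP; exact: lin.
Qed.

Lemma semi_form_lin1 T D k u u' v x y w : semi_form T D (k *: u + u') v x y w =
  k *: semi_form T D u v x y w + semi_form T D u' v x y w.
Proof. by rewrite /semi_form !tensP; tens_module. Qed.
Lemma semi_form_lin2 T D k u v v' x y w : semi_form T D u (k *: v + v') x y w =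
  k *: semi_form T D u v x y w + semi_form T D u v' x y w.
Proof. by rewrite /semi_form !tensP; tens_module. Qed.
Lemma semi_form_lin3 T D k u v x x' y w : semi_form T D u v (k *: x + x') y w =
  k *: semi_form T D u v x y w + semi_form T D u v x' y w.
Proof. by rewrite /semi_form !tensP; tens_module. Qed.
Lemma semi_form_lin4 T D k u v x y y' w : semi_form T D u v x (k *: y + y') w =
  k *: semi_form T D u v x y w + semi_form T D u v x y' w.
Proof. by rewrite /semi_form !tensP; tens_module. Qed.
Lemma semi_form_lin5 T D k u v x y w w' : semi_form T D u v x y (k *: w + w') =
  k *: semi_form T D u v x y w + semi_form T D u v x y w'.
Proof. by rewrite /semi_form !tensP; tens_module. Qed.

(** Stated for the symmetrized sum so as to serve both for the linearized condition and, with
    [D = T], for twice the condition itself. *)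
Lemma semi_form_comp T D :
  (forall a b c d e, semi_form T D (delta_mx 0 a) (delta_mx 0 b) (delta_mx 0 c)
      (delta_mx 0 d) (delta_mx 0 e) + semi_form D T (delta_mx 0 a) (delta_mx 0 b)
      (delta_mx 0 c) (delta_mx 0 d) (delta_mx 0 e) = 0) ->
  forall u v x y w, semi_form T D u v x y w + semi_form D T u v x y w = 0.
Proof.
move=> hT.
have lin k (p q p' q' : 'rV[A]_n) : p + q = 0 -> p' + q' = 0 ->
    k *: p + p' + (k *: q + q') = 0.
  by move=> e e'; rewrite addrACA -scalerDr e e' scaler0 addr0.
have zero : semi_form T D 0 0 0 0 0 = 0 by rewrite /semi_form !tensP !subr0.
apply: vec_ind => [a|k u u' eu eu' v x y w|v x y w]; last 1 first.
- by rewrite /semi_form !tensP !subr0 addr0.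
- apply: vec_ind => [b|k v v' ev ev' x y w|x y w]; last 1 first.
  + by rewrite /semi_form !tensP !subr0 addr0.
  + apply: vec_ind => [c|k x x' ex ex' y w|y w]; last 1 first.
    * by rewrite /semi_form !tensP !subr0 addr0.
    * apply: vec_ind => [d|k y y' ey ey' w|w]; last 1 first.
      -- by rewrite /semi_form !tensP !subr0 addr0.
      -- apply: vec_ind => [e|k w w' ew ew'|]; first exact: hT.
           by rewrite !semi_form_lin5; exact: lin.
         by rewrite /semi_form !tensP !subr0 addr0.
      -- by rewrite !semi_form_lin4; exact: lin.
    * by rewrite !semi_form_lin3; exact: lin.
  + by rewrite !semi_form_lin2; exact: lin.
- by rewrite !semi_form_lin1; exact: lin.
Qed.

Definition tens_mx T v w : 'M[A]_n := \matrix_(c, d) tens T (delta_mx 0 c) v w 0 d.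

Lemma tens_mxE T u v w : tens T u v w = u *m tens_mx T v w.
Proof.
rewrite {1}(row_sum_delta u) tens_comb1 (mulmx_sum_row u); apply: eq_bigr => c _.
by congr (_ *: _); apply/rowP => d; rewrite !mxE.
Qed.

(** Cyclicity of the trace: in the Ricci contraction of [gl_act], the terms where [L] meets the
    contracted indices cancel. *)
Lemma tens_trace T v w L :
  \sum_c tens T (delta_mx 0 c *m L) v w 0 c = \sum_c (tens T (delta_mx 0 c) v w *m L) 0 c.
Proof.
under eq_bigr do rewrite tens_mxE -mulmxA -rowE mxE.
under [RHS]eq_bigr do rewrite tens_mxE -mulmxA -rowE mxE.
exact: mxtrace_mulC.
Qed.

Lemma semi_form_add T D D' u v x y w :
  semi_form T (fun a b => D a b + D' a b) u v x y w =
  semi_form T D u v x y w + semi_form T D' u v x y w.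
Proof. by rewrite /semi_form !tens_add !tensP; tens_module. Qed.

Lemma semi_form_add_l T D D' u v x y w :
  semi_form (fun a b => D a b + D' a b) T u v x y w =
  semi_form D T u v x y w + semi_form D' T u v x y w.
Proof. by rewrite /semi_form !tens_add; tens_module. Qed.

(* The Lie algebra acts by derivations on the contractions defining [semi_form]. *)
Lemma semi_form_gl_act T L : (forall u v x y w, semi_form T T u v x y w = 0) ->
  forall u v x y w, semi_form T (gl_act L T) u v x y w + semi_form (gl_act L T) T u v x y w = 0.
Proof.
move=> hT u v x y w.
transitivity (semi_form T T u v x y w *m L - semi_form T T (u *m L) v x y w
  - semi_form T T u (v *m L) x y w - semi_form T T u v (x *m L) y w
  - semi_form T T u v x (y *m L) w - semi_form T T u v x y (w *m L)); last first.
  by rewrite !hT mul0mx !subr0.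
have mB : semi_form T T u v x y w *m L = tens T u v (tens T x y w) *m L
    - tens T x y (tens T u v w) *m L - tens T (tens T u v x) y w *m L
    - tens T x (tens T u v y) w *m L by rewrite /semi_form !mulmxBl.
have gE p q r : tens (gl_act L T) p q r = tens T p q r *m L - tens T p q (r *m L)
    - tens T (p *m L) q r - tens T p (q *m L) r by exact: tens_gl_act.
rewrite mB /semi_form !gE !(tensP, tensN1, tensN2, tensN3).
repeat match goal with |- context [@mulmx ?A ?p ?q ?r (tens ?T' ?u' ?v' ?w') L] =>
  generalize (@mulmx A p q r (tens T' u' v' w') L); intro end.
by tens_module.
Qed.

Lemma semi_form_deriv T dT L : (forall u v x y w, semi_form T T u v x y w = 0) ->
  (forall u v x y w, semi_form T dT u v x y w + semi_form dT T u v x y w = 0) ->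
  forall u v x y w, semi_form T (fun a b => dT a b + gl_act L T a b) u v x y w
    + semi_form (fun a b => dT a b + gl_act L T a b) T u v x y w = 0.
Proof.
move=> hT hd u v x y w; rewrite semi_form_add semi_form_add_l addrACA hd add0r.
exact: semi_form_gl_act.
Qed.

End TensorContractions.

Section CurvatureTensor.
Context {R : realType} {n : nat}.
Implicit Types (T D dT : 'I_n -> 'I_n -> 'M[R]_n) (G dG L P : 'M[R]_n) (u v w x y z : 'rV[R]_n).

(** Quantifying over vectors instead of indices lets the identities be evaluated in any frame. The
    covariant derivatives of the curvature have [lam = 0], since the metric is parallel and the
    Einstein constant does not vary. *)
Record curv_tensor G (lam : R) T : Prop := CurvTensor {
  ct_anti : forall u v w, tens T v u w = - tens T u v w;
  ct_skew : forall u v w z, pairing G (tens T u v w) z = - pairing G (tens T u v z) w;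
  ct_bianchi : forall u v w, tens T u v w + tens T v w u + tens T w u v = 0;
  ct_ricci : forall v w, \sum_c tens T (delta_mx 0 c) v w 0 c = lam * pairing G v w
}.

Lemma pairingD1 G u u' v : pairing G (u + u') v = pairing G u v + pairing G u' v.
Proof. by rewrite /pairing !mulmxDl mxE. Qed.
Lemma pairingD2 G u v v' : pairing G u (v + v') = pairing G u v + pairing G u v'.
Proof. by rewrite /pairing linearD mulmxDr mxE. Qed.
Lemma pairingZ1 G c u v : pairing G (c *: u) v = c * pairing G u v.
Proof. by rewrite /pairing -!scalemxAl mxE. Qed.
Lemma pairingZ2 G c u v : pairing G u (c *: v) = c * pairing G u v.
Proof. by rewrite /pairing linearZ -scalemxAr mxE. Qed.
Lemma pairing01 G v : pairing G 0 v = 0.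
Proof. by rewrite /pairing !mul0mx mxE. Qed.
Lemma pairing02 G u : pairing G u 0 = 0.
Proof. by rewrite /pairing trmx0 mulmx0 mxE. Qed.
Lemma pairingN1 G u v : pairing G (- u) v = - pairing G u v.
Proof. by rewrite -scaleN1r pairingZ1 mulN1r. Qed.
Lemma pairing_delta G a b : pairing G (delta_mx 0 a) (delta_mx 0 b) = G a b.
Proof. by rewrite /pairing -rowE trmx_delta -colE !mxE. Qed.
Lemma pairing_lie G L u v :
  pairing (L *m G + G *m L^T) u v = pairing G (u *m L) v + pairing G u (v *m L).
Proof. by rewrite /pairing mulmxDr mulmxDl mxE trmx_mul !mulmxA. Qed.

Lemma trmx_add p q (A B : 'M[R]_(p, q)) : (A + B)^T = A^T + B^T.
Proof. exact: raddfD. Qed.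

Lemma tens_skew_comp G T : G^T = G -> (forall a b, T a b *m G + G *m (T a b)^T = 0) ->
  forall u v w z, pairing G (tens T u v w) z = - pairing G (tens T u v z) w.
Proof.
move=> hG hT u v w z; rewrite /tens /pairing !mulmx_suml !summxE -sumrN; apply: eq_bigr => a _.
rewrite !mulmx_suml !summxE -sumrN; apply: eq_bigr => b _.
rewrite -!scalemxAl !scalemxE -mulrN; congr (_ * _).
have e : T a b *m G = - (G *m (T a b)^T) by apply/eqP; rewrite -addr_eq0 hT.
have -> : w *m T a b *m G *m z^T = - (z *m T a b *m G *m w^T)^T.
  by rewrite !trmx_mul trmxK hG -(mulmxA w) e mulmxN mulNmx !mulmxA.
by rewrite oppmxE trmxE.
Qed.

Lemma tens_ricci_comp T G lam : (forall a b, \sum_c T c a b c = lam * G a b) ->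
  forall v w, \sum_c tens T (delta_mx 0 c) v w 0 c = lam * pairing G v w.
Proof.
move=> hT; apply: vec_ind => [a|k v v' ev ev' w|w].
- apply: vec_ind => [b|k w w' ew ew'|].
  + by rewrite pairing_delta -hT; apply: eq_bigr => c _; rewrite tens_deltaE.
  + rewrite pairingD2 pairingZ2 mulrDr mulrCA -ew -ew' mulr_sumr -big_split.
    by apply: eq_bigr => c _; rewrite tensD3 tensZ3 addmxE scalemxE.
  + by rewrite pairing02 mulr0 big1 // => c _; rewrite tens03 mxE.
- rewrite pairingD1 pairingZ1 mulrDr mulrCA -ev -ev' mulr_sumr -big_split.
  by apply: eq_bigr => c _; rewrite tensD2 tensZ2 addmxE scalemxE.
- by rewrite pairing01 mulr0 big1 // => c _; rewrite tens02 mxE.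
Qed.

Lemma tens_skew_deriv_comp G dG T dT : G^T = G -> dG^T = dG ->
  (forall a b, dT a b *m G + G *m (dT a b)^T + (T a b *m dG + dG *m (T a b)^T) = 0) ->
  forall u v w z, pairing G (tens dT u v w) z + pairing dG (tens T u v w) z =
    - (pairing G (tens dT u v z) w + pairing dG (tens T u v z) w).
Proof.
move=> hG hdG hT u v w z; rewrite /tens /pairing !mulmx_suml !summxE -!big_split -sumrN.
apply: eq_bigr => a _; rewrite !mulmx_suml !summxE -!big_split -sumrN.
apply: eq_bigr => b _ /=.
rewrite -!scalemxAl !scalemxE -!mulrDr -mulrN; congr (_ * _).
have e : dT a b *m G + T a b *m dG = - (G *m (dT a b)^T + dG *m (T a b)^T).
  by apply/eqP; rewrite -addr_eq0 addrACA hT.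
rewrite -!addmxE.
have -> : w *m dT a b *m G *m z^T + w *m T a b *m dG *m z^T =
    - (z *m dT a b *m G *m w^T + z *m T a b *m dG *m w^T)^T.
  have -> : w *m dT a b *m G *m z^T + w *m T a b *m dG *m z^T =
      w *m (dT a b *m G + T a b *m dG) *m z^T by rewrite mulmxDr mulmxDl !mulmxA.
  rewrite e mulmxN mulNmx; congr (- _).
  by rewrite trmx_add !trmx_mul trmxK hG hdG mulmxDr mulmxDl !mulmxA.
by rewrite oppmxE trmxE.
Qed.

(** For [L] a connection matrix, [L *m G + G *m L^T] is the coordinate derivative of the metric. The
    hypotheses are thus the differentiated identities of [T], and the [gl_act] term cancels every
    contribution of the derivative of [G]. *)
Lemma curv_tensor_deriv G lam T dT L : G^T = G -> curv_tensor G lam T ->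
  (forall a b, dT b a = - dT a b) ->
  (forall a b, dT a b *m G + G *m (dT a b)^T
     + (T a b *m (L *m G + G *m L^T) + (L *m G + G *m L^T) *m (T a b)^T) = 0) ->
  (forall a b c d, dT a b c d + dT b c a d + dT c a b d = 0) ->
  (forall a b, \sum_c dT c a b c = lam * (L *m G + G *m L^T) a b) ->
  curv_tensor G 0 (fun a b => dT a b + gl_act L T a b).
Proof.
move=> hG [anti skew bianchi ricci] /tens_anti_comp danti dskew /tens_bianchi_comp dbianchi dricci.
have hdG : (L *m G + G *m L^T)^T = L *m G + G *m L^T.
  by rewrite trmx_add !trmx_mul trmxK hG addrC.
have {}dskew := tens_skew_deriv_comp hG hdG dskew.
have {}dricci := tens_ricci_comp dricci.
have E u v w : tens (fun a b => dT a b + gl_act L T a b) u v w =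
    tens dT u v w + (tens T u v w *m L - tens T u v (w *m L)
      - tens T (u *m L) v w - tens T u (v *m L) w).
  by rewrite -tens_gl_act -tens_add.
split=> [u v w|u v w z|u v w|v w].
- rewrite !E.
  have eL : tens T v u w *m L = - (tens T u v w *m L) by rewrite anti; exact: mulNmx.
  rewrite (danti u v w) eL (anti u v (w *m L)) (anti u (v *m L) w) (anti (u *m L) v w).
  by generalize (tens T u v w *m L) => *; tens_module.
- rewrite !E; have := dskew u v w z; rewrite !pairing_lie => e.
  rewrite !(pairingD1, pairingN1) (skew (u *m L) v w) (skew u (v *m L) w) (skew u v (w *m L)).
  rewrite (skew u v (z *m L)) !opprK.
  by lra.
- rewrite !E; have b1 := bianchi (u *m L) v w; have b2 := bianchi u (v *m L) w.
  have b3 := bianchi u v (w *m L); have b0 := bianchi u v w; have d0 := dbianchi u v w.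
  transitivity ((tens dT u v w + tens dT v w u + tens dT w u v)
    + (tens T u v w + tens T v w u + tens T w u v) *m L
    - (tens T (u *m L) v w + tens T v w (u *m L) + tens T w (u *m L) v)
    - (tens T u (v *m L) w + tens T (v *m L) w u + tens T w u (v *m L))
    - (tens T u v (w *m L) + tens T v (w *m L) u + tens T (w *m L) u v)).
    rewrite !mulmxDl; move: (tens T u v w *m L) (tens T v w u *m L) (tens T w u v *m L) => *.
    by tens_module.
  by rewrite b0 b1 b2 b3 d0 mul0mx !subr0 addr0.
- under eq_bigr do rewrite E.
  rewrite mul0r.
  transitivity (\sum_c tens dT (delta_mx 0 c) v w 0 c
    + \sum_c (tens T (delta_mx 0 c) v w *m L) 0 c
    - \sum_c tens T (delta_mx 0 c) v (w *m L) 0 c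
    - \sum_c tens T (delta_mx 0 c *m L) v w 0 c
    - \sum_c tens T (delta_mx 0 c) (v *m L) w 0 c).
    rewrite -big_split -!sumrB; apply: eq_bigr => c _ /=.
    by rewrite !(addmxE, oppmxE) !addrA.
  by rewrite dricci !ricci tens_trace pairing_lie; ring.
Qed.

End CurvatureTensor.

(** * Derivatives along arbitrary vectors *)

Section Combination.
Context {A : comNzRingType} {n : nat}.
Implicit Types (T : 'I_n -> 'I_n -> 'M[A]_n) (D : 'I_n -> 'I_n -> 'I_n -> 'M[A]_n).
Implicit Types (p u v w : 'rV[A]_n).

(** The covariant derivative along [p]: the change of frame also affects the direction of
    differentiation. *)
Definition comb D p a b : 'M[A]_n := \sum_f p 0 f *: D f a b.

Lemma comb_ind (Q : ('I_n -> 'I_n -> 'M[A]_n) -> Prop) D p :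
  Q (fun _ _ => 0) -> (forall f, Q (D f)) ->
  (forall k T T', Q T -> Q T' -> Q (fun a b => k *: T a b + T' a b)) -> Q (comb D p).
Proof.
move=> Q0 QD Qlin; rewrite /comb.
elim: (index_enum _) => [|f r IH].
  rewrite [X in Q X](_ : _ = fun _ _ => 0) //.
  by apply/funext => a; apply/funext => b; rewrite big_nil.
rewrite [X in Q X](_ : _ = fun a b => p 0 f *: D f a b + \sum_(f0 <- r) p 0 f0 *: D f0 a b).
  exact: Qlin.
by apply/funext => a; apply/funext => b; rewrite big_cons.
Qed.

Lemma tens_linear T T' k u v w :
  tens (fun a b => k *: T a b + T' a b) u v w = k *: tens T u v w + tens T' u v w.
Proof.
rewrite tens_add; congr (_ + _); rewrite /tens scaler_sumr; apply: eq_bigr => a _.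
rewrite scaler_sumr; apply: eq_bigr => b _.
by rewrite -scalemxAr !scalerA mulrC.
Qed.

Lemma tens_zero u v w : tens (fun _ _ => 0 : 'M[A]_n) u v w = 0.
Proof. by rewrite /tens big1 // => a _; rewrite big1 // => b _; rewrite mulmx0 scaler0. Qed.

Lemma tens_comb D p u v w : tens (comb D p) u v w = \sum_f p 0 f *: tens (D f) u v w.
Proof.
rewrite /comb; elim: (index_enum _) => [|f r IH].
  rewrite big_nil -[RHS](tens_zero u v w); congr (tens _ u v w).
  by apply/funext => a; apply/funext => b; rewrite big_nil.
rewrite big_cons -IH -tens_linear; congr (tens _ u v w).
by apply/funext => a; apply/funext => b; rewrite big_cons.
Qed.

Lemma comb_cyclic D : (forall e a b, D e a b + D a b e + D b e a = 0) ->
  forall p u v w, tens (comb D p) u v w + tens (comb D u) v p w + tens (comb D v) p u w = 0.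
Proof.
move=> hD p u v w.
have E q s t : tens (comb D q) s t w =
    \sum_f \sum_a \sum_b (q 0 f * s 0 a * t 0 b) *: (w *m D f a b).
  rewrite tens_comb; apply: eq_bigr => f _; rewrite /tens scaler_sumr; apply: eq_bigr => a _.
  by rewrite scaler_sumr; apply: eq_bigr => b _; rewrite scalerA mulrA.
rewrite !E.
have -> : \sum_f \sum_a \sum_b (u 0 f * v 0 a * p 0 b) *: (w *m D f a b) =
    \sum_f \sum_a \sum_b (p 0 f * u 0 a * v 0 b) *: (w *m D a b f).
  under eq_bigr do rewrite exchange_big /=.
  rewrite exchange_big; apply: eq_bigr => f _; apply: eq_bigr => a _; apply: eq_bigr => b _.
  by congr (_ *: _); ring.
have -> : \sum_f \sum_a \sum_b (v 0 f * p 0 a * u 0 b) *: (w *m D f a b) =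
    \sum_f \sum_a \sum_b (p 0 f * u 0 a * v 0 b) *: (w *m D b f a).
  rewrite exchange_big; apply: eq_bigr => f _; rewrite exchange_big.
  apply: eq_bigr => a _; apply: eq_bigr => b _.
  by congr (_ *: _); ring.
rewrite -!big_split big1 // => f _; rewrite -!big_split big1 // => a _.
rewrite -!big_split big1 // => b _ /=.
by rewrite -!scalerDr -!mulmxDr hD mulmx0 scaler0.
Qed.

End Combination.

(** * From coordinates to an orthonormal frame *)

Section FrameRigidity.
Context {R : realType}.
Variables (G P : 'M[R]_4) (lam : R) (T : 'I_4 -> 'I_4 -> 'M[R]_4)
  (D : 'I_4 -> 'I_4 -> 'I_4 -> 'M[R]_4).
Hypotheses (P_unit : P \in unitmx) (lam_neq0 : lam != 0).
Hypothesis frame : P *m G *m P^T = diag_mx (\row_k (if k == 0%N :> nat then -1 else 1)).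

Definition frame_comp (S : 'I_4 -> 'I_4 -> 'M[R]_4) a b c d : R :=
  (tens S (row a P) (row b P) (row c P) *m invmx P) 0 d.

Lemma frame_pairing a b : pairing G (row a P) (row b P) = if a == b then eta4 a else 0.
Proof.
have E u v : pairing G (u *m P) (v *m P) = pairing (P *m G *m P^T) u v.
  by rewrite /pairing trmx_mul !mulmxA.
rewrite !rowE E pairing_delta frame !mxE /eta4.
by case: (a == b); rewrite ?mulr1n ?mulr0n.
Qed.

Lemma frame_comp_eta S a b c d : frame_comp S a b c d * eta4 d =
  pairing G (tens S (row a P) (row b P) (row c P)) (row d P).
Proof.
rewrite /frame_comp; move: (tens _ _ _ _) => t.
have -> : pairing G t (row d P) = (t *m invmx P *m (P *m G *m P^T)) 0 d.
  rewrite !mulmxA mulmxKV // /pairing rowE trmx_mul trmx_delta mulmxA -colE.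
  by rewrite !mxE.
by rewrite frame mul_mx_diag !mxE.
Qed.

Lemma sum_frame_coord (t : 'rV[R]_4) : \sum_h (t *m invmx P) 0 h *: row h P = t.
Proof. by rewrite -mulmx_sum_row mulmxKV. Qed.

Lemma lorentz_frame_comp mu S : curv_tensor G mu S -> lorentz_tensor mu (frame_comp S).
Proof.
move=> [anti skew bianchi ricci]; split=> [a b c d|a b c d|a b c d|a b].
- by rewrite /frame_comp anti mulNmx oppmxE.
- by rewrite !frame_comp_eta skew.
- by rewrite /frame_comp -!addmxE -!mulmxDl bianchi mul0mx mxE.
- rewrite -frame_pairing -ricci /frame_comp.
  under eq_bigr do rewrite rowE tens_mxE -!mulmxA -rowE mxE.
  under [RHS]eq_bigr do rewrite tens_mxE -rowE mxE.
  (* The Ricci contraction is a trace, unchanged by conjugation with [P]. *)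
  rewrite -!/(mxtrace _) mulmxA mxtrace_mulC mulmxA mulVmx // mul1mx.
  by [].
Qed.

(** Each sum over [h] recombines the inner value from its frame coordinates; [E1], [E2] and [E3] do
    so in the three slots of the outer tensor. *)
Lemma semi_frame_comp S S' a b c d e f :
  semi_comp (frame_comp S) (frame_comp S') a b c d e f =
  (semi_form S S' (row a P) (row b P) (row c P) (row d P) (row e P) *m invmx P) 0 f.
Proof.
have E1 t u v : \sum_h (t *m invmx P) 0 h * (tens S u v (row h P) *m invmx P) 0 f =
    (tens S u v t *m invmx P) 0 f.
  rewrite -[in RHS](sum_frame_coord t) tens_comb3 mulmx_suml summxE.
  by apply: eq_bigr => h _; rewrite -scalemxAl scalemxE.
have E2 t u v : \sum_h (t *m invmx P) 0 h * (tens S (row h P) u v *m invmx P) 0 f =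
    (tens S t u v *m invmx P) 0 f.
  rewrite -[in RHS](sum_frame_coord t) tens_comb1 mulmx_suml summxE.
  by apply: eq_bigr => h _; rewrite -scalemxAl scalemxE.
have E3 t u v : \sum_h (t *m invmx P) 0 h * (tens S u (row h P) v *m invmx P) 0 f =
    (tens S u t v *m invmx P) 0 f.
  rewrite -[in RHS](sum_frame_coord t) tens_comb2 mulmx_suml summxE.
  by apply: eq_bigr => h _; rewrite -scalemxAl scalemxE.
rewrite /semi_comp /frame_comp E1 E1 E2 E3 /semi_form.
by rewrite !mulmxBl !(addmxE, oppmxE).
Qed.

Lemma curv_tensor_comb p : (forall e, curv_tensor G 0 (D e)) -> curv_tensor G 0 (comb D p).
Proof.
move=> hD; apply: comb_ind => [|//|k S S' [a1 s1 b1 r1] [a2 s2 b2 r2]].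
  split=> *; rewrite ?tens_zero ?oppr0 ?addr0 ?pairing01 ?oppr0 //.
  by rewrite mul0r big1 // => c _; rewrite tens_zero mxE.
split=> [u v w|u v w z|u v w|v w].
- by rewrite !tens_linear a1 a2 scalerN opprD.
- by rewrite !tens_linear !pairingD1 !pairingZ1 s1 s2 mulrN opprD.
- transitivity (k *: (tens S u v w + tens S v w u + tens S w u v)
    + (tens S' u v w + tens S' v w u + tens S' w u v)); last by rewrite b1 b2 scaler0 addr0.
  by rewrite !tens_linear; tens_module.
- under eq_bigr do rewrite tens_linear addmxE scalemxE.
  by rewrite big_split /= -mulr_sumr r1 r2 !mul0r mulr0 addr0.
Qed.

Lemma semi_form_comb p : (forall e u v x y w,
    semi_form T (D e) u v x y w + semi_form (D e) T u v x y w = 0) ->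
  forall u v x y w, semi_form T (comb D p) u v x y w + semi_form (comb D p) T u v x y w = 0.
Proof.
move=> hD; apply: (@comb_ind _ _ (fun S => forall u v x y w,
    semi_form T S u v x y w + semi_form S T u v x y w = 0))
  => [u v x y w|//|k S S' e1 e2 u v x y w].
  by rewrite /semi_form !tens_zero !tensP !subr0 addr0.
transitivity (k *: (semi_form T S u v x y w + semi_form S T u v x y w)
  + (semi_form T S' u v x y w + semi_form S' T u v x y w)).
  by rewrite /semi_form !tens_linear !tensP; tens_module.
by rewrite e1 e2 scaler0 addr0.
Qed.

Theorem curvature_rigidity : curv_tensor G lam T -> (forall e, curv_tensor G 0 (D e)) ->
  (forall u v x y w, semi_form T T u v x y w = 0) ->
  (forall e u v x y w, semi_form T (D e) u v x y w + semi_form (D e) T u v x y w = 0) ->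
  (forall e a b, D e a b + D a b e + D b e a = 0) ->
  forall e u v w, tens (D e) u v w = 0.
Proof.
move=> hT hD hS hSD hB.
have zero e a b c d : frame_comp (comb D (row e P)) a b c d = 0.
  apply: (lorentz_rigidity lam_neq0 (lorentz_frame_comp hT)
    (fun e => lorentz_frame_comp (curv_tensor_comb (row e P) hD))) => {e a b c d}.
  - by move=> a b c d e f; rewrite semi_frame_comp hS mul0mx mxE.
  - move=> e a b c d f h; rewrite !semi_frame_comp -addmxE -mulmxDl semi_form_comb //.
    by rewrite mul0mx mxE.
  - move=> e a b c d; rewrite /frame_comp -!addmxE -!mulmxDl comb_cyclic //.
    by rewrite mul0mx mxE.
have row_zero e a b c : tens (comb D (row e P)) (row a P) (row b P) (row c P) = 0.
  rewrite -[LHS](mulmxKV P_unit); apply/rowP => d.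
  rewrite [X in (X *m P) 0 d](_ : _ = 0) ?mul0mx //.
  by apply/rowP => h; rewrite [RHS]mxE; exact: zero.
have frame_zero e u v w : tens (comb D (row e P)) u v w = 0.
  rewrite -(sum_frame_coord u) tens_comb1 big1 // => a _.
  rewrite -(sum_frame_coord v) tens_comb2 big1 ?scaler0 // => b _.
  rewrite -(sum_frame_coord w) tens_comb3 big1 ?scaler0 // => c _.
  by rewrite row_zero scaler0.
move=> e u v w.
(* The coordinate direction [e] is expanded in the frame in its turn. *)
transitivity (\sum_f (delta_mx 0 e : 'rV[R]_4) 0 f *: tens (D f) u v w).
  rewrite (bigD1 e) //= mxE !eqxx scale1r big1 ?addr0 // => f /negPf fe.
  by rewrite mxE eqxx fe scale0r.
rewrite -{1}(sum_frame_coord (delta_mx 0 e)).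
under eq_bigr do rewrite summxE scaler_suml.
rewrite exchange_big big1 // => h _.
under eq_bigr do rewrite scalemxE -scalerA.
by rewrite -scaler_sumr -tens_comb frame_zero scaler0.
Qed.

End FrameRigidity.

(** * Derivatives of the curvature identities *)

Section SemiMatrix.
Context {A : comNzRingType} {n : nat}.
Implicit Types (T D : 'I_n -> 'I_n -> 'M[A]_n).

(** Matrix of [semi_form] in its last argument at basis vectors: a polynomial in the entries, to
    which the product rule applies. *)
Definition semi_mx T D a b c d : 'M[A]_n :=
  D c d *m T a b - D a b *m T c d - \sum_h D a b c h *: T h d - \sum_h D a b d h *: T c h.

Lemma semi_form_delta T D a b c d e :
  semi_form T D (delta_mx 0 a) (delta_mx 0 b) (delta_mx 0 c) (delta_mx 0 d) (delta_mx 0 e)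
  = delta_mx 0 e *m semi_mx T D a b c d.
Proof.
rewrite /semi_form /semi_mx !mulmxBr !mulmxA !tens_delta; congr (_ - _ - _).
  rewrite {1}(row_sum_delta (_ *m D a b)) tens_comb1 mulmx_sumr; apply: eq_bigr => h _.
  by rewrite tens_delta -rowE mxE scalemxAr.
rewrite {1}(row_sum_delta (_ *m D a b)) tens_comb2 mulmx_sumr; apply: eq_bigr => h _.
by rewrite tens_delta -rowE mxE scalemxAr.
Qed.

Lemma semi_mx_eq0 T D a b c d : (forall e, semi_form T D (delta_mx 0 a) (delta_mx 0 b)
    (delta_mx 0 c) (delta_mx 0 d) (delta_mx 0 e) = 0) -> semi_mx T D a b c d = 0.
Proof.
move=> h; apply/row_matrixP => e; rewrite rowE -semi_form_delta h.
by apply/rowP => f; rewrite !mxE.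
Qed.

(** [p1] to [p4] have the shape in which the product rule yields the derivatives of the four terms
    of [semi_mx T T], when [D] is the derivative of [T]. *)
Lemma semi_mx_polar T D a b c d (p1 p2 p3 p4 : 'M[A]_n) :
  p1 = D c d *m T a b + T c d *m D a b -> p2 = D a b *m T c d + T a b *m D c d ->
  p3 = \sum_h (D a b c h *: T h d + T a b c h *: D h d) ->
  p4 = \sum_h (D a b d h *: T c h + T a b d h *: D c h) ->
  p1 - p2 - p3 - p4 = 0 -> semi_mx T D a b c d + semi_mx D T a b c d = 0.
Proof.
move=> -> -> -> ->; rewrite !big_split /semi_mx => e; rewrite -[RHS]e.
move: (\sum_h _) (\sum_h _) (\sum_h _) (\sum_h _) => s1 s2 s3 s4.
by apply/matrixP => i j; rewrite !(addmxE, oppmxE); ring.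
Qed.

Lemma cyclic_sum_alg (p1 q1 r1 t1 u1 p2 q2 r2 t2 u2 p3 q3 r3 t3 u3 : 'M[A]_n) :
  (p1 + q1 - r1) + (p2 + q2 - r2) + (p3 + q3 - r3) = 0 ->
  t1 = - u2 -> t2 = - u3 -> t3 = - u1 ->
  (p1 + (q1 - r1 - t1 - u1)) + (p2 + (q2 - r2 - t2 - u2)) + (p3 + (q3 - r3 - t3 - u3)) = 0.
Proof.
move=> e -> -> ->; rewrite -[RHS]e.
by apply/matrixP => i j; rewrite !(addmxE, oppmxE); ring.
Qed.

End SemiMatrix.

Section CoordinateRigidity.
Context {R : realType} {n : nat}.
Variables (g : 'rV[R]_n -> 'M[R]_n) (U : set 'rV[R]_n).
Hypotheses (oU : open U) (sg : smooth_entries U g).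
Hypothesis g_sym : forall x, U x -> (g x)^T = g x.
Hypothesis g_unit : forall x, U x -> g x \in unitmx.
Implicit Types (x : 'rV[R]_n) (a b c d e : 'I_n).

Local Notation gam := (gam g).
Local Notation riem := (riem g).
Local Notation nabla_riem := (nabla_riem g).
Local Notation T x := (fun a b => riem a b x).
Local Notation dT k x := (fun a b => partial_mx k (riem a b) x).
Let sR a b : smooth_entries U (riem a b) := smooth_riem oU sg g_sym g_unit a b.

Lemma smooth_coord a : smooth_entries U (@coord_field R n a).
Proof. exact: smooth_entries_cst. Qed.

Lemma curvature_coord a b c x : U x ->
  curvature g (coord_field a) (coord_field b) (coord_field c) x =
  tens (T x) (delta_mx 0 a) (delta_mx 0 b) (delta_mx 0 c).
Proof.
by move=> Ux; rewrite (curvature_tens oU sg g_sym g_unit Ux);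
  [|exact: smooth_coord..].
Qed.

Lemma ricciE a b x : U x -> ricci g x a b = \sum_c riem c a x b c.
Proof.
move=> Ux; rewrite mxE; apply: eq_bigr => c _.
by rewrite curvature_coord // tens_deltaE.
Qed.

Lemma partial_mx0 p q k (F : 'rV[R]_n -> 'M[R]_(p, q)) x : U x ->
  (forall y, U y -> F y = 0) -> partial_mx k F x = 0.
Proof.
move=> Ux F0; rewrite -(partial_mx_cst k (0 : 'M[R]_(p, q)) x).
by apply: (partial_mx_ext oU) => // y /[!inE]; exact: F0.
Qed.

Lemma partial_riem_anti k a b x : U x ->
  partial_mx k (riem b a) x = - partial_mx k (riem a b) x.
Proof.
move=> Ux; apply/eqP; rewrite -addr_eq0 -(partial_mxD oU k Ux (sR b a) (sR a b)); apply/eqP.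
by apply: partial_mx0 => // y _; rewrite riem_anti addNr.
Qed.

Lemma partial_riem_skew k a b x : U x ->
  partial_mx k (riem a b) x *m g x + g x *m (partial_mx k (riem a b) x)^T
  + (riem a b x *m (gam k x *m g x + g x *m (gam k x)^T)
     + (gam k x *m g x + g x *m (gam k x)^T) *m (riem a b x)^T) = 0.
Proof.
move=> Ux; rewrite -(metric_compat oU g_sym g_unit k Ux).
have sRt := smooth_entries_tr oU (sR a b).
have s1 := smooth_entries_mul oU (sR a b) sg.
have s2 := smooth_entries_mul oU sg sRt.
have : partial_mx k (fun y => riem a b y *m g y + g y *m (riem a b y)^T) x = 0.
  by apply: partial_mx0 => // y; exact: riem_skew.
rewrite (partial_mxD oU k Ux s1 s2) (partial_mxM oU k Ux (sR a b) sg).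
rewrite (partial_mxM oU k Ux sg sRt) partial_mx_tr => <-.
by rewrite addrACA; congr (_ + _); exact: addrC.
Qed.

Lemma partial_riem_bianchi k a b c d x : U x ->
  partial_mx k (riem a b) x c d + partial_mx k (riem b c) x a d
  + partial_mx k (riem c a) x b d = 0.
Proof.
move=> Ux.
have add3 (p q r p' q' r' : R) : p = p' -> q = q' -> r = r' -> p' + q' + r' = 0 -> p + q + r = 0.
  by move=> -> -> ->.
apply: (add3 _ _ _ _ _ _ (partial_mxE k _ x c d) (partial_mxE k _ x a d) (partial_mxE k _ x b d)).
have s12 := smoothD oU (sR a b c d) (sR b c a d).
apply: etrans (congr1 (+%R ^~ _) (esym (partialD k Ux (sR a b c d) (sR b c a d)))) _.
apply: etrans (esym (partialD k Ux s12 (sR c a b d))) _.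
apply: etrans (partial_cst k 0 x); apply: (partial_ext oU) => // y /[!inE] Uy.
exact: (riem_bianchi1 oU g_sym a b c d Uy).
Qed.

Lemma partial_riem_ricci lam k a b x : U x ->
  (forall y, U y -> \sum_c riem c a y b c = lam * g y a b) ->
  \sum_c partial_mx k (riem c a) x b c =
  lam * (gam k x *m g x + g x *m (gam k x)^T) a b.
Proof.
move=> Ux hE; rewrite -(metric_compat oU g_sym g_unit k Ux) partial_mxE.
under eq_bigr do rewrite partial_mxE.
rewrite -(partial_sum oU _ k Ux) => [|c]; last exact: sR.
transitivity (partial k (fun y => cst lam y * g y a b) x).
  by apply: (partial_ext oU) => // y /[!inE] Uy; apply: etrans (hE y Uy) _.
apply: etrans (partialM k Ux (smooth_cst U lam) (sg a b)) _.
by rewrite [partial k (cst lam) x](partial_cst k lam x) mul0r add0r.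
Qed.

Lemma partial_semi k a b c d x : U x ->
  (forall y, U y -> semi_mx (T y) (T y) a b c d = 0) ->
  semi_mx (T x) (dT k x) a b c d + semi_mx (dT k x) (T x) a b c d = 0.
Proof.
move=> Ux hS.
pose P1 y := riem c d y *m riem a b y; pose P2 y := riem a b y *m riem c d y.
pose P3 h y := riem a b y c h *: riem h d y; pose P4 h y := riem a b y d h *: riem c h y.
have s1 : smooth_entries U P1 by exact: smooth_entries_mul.
have s2 : smooth_entries U P2 by exact: smooth_entries_mul.
have s3 h : smooth_entries U (P3 h).
  by apply: smooth_entriesZ => //; exact: sR.
have s4 h : smooth_entries U (P4 h).
  by apply: smooth_entriesZ => //; exact: sR.
have s3s := smooth_entries_sum oU (index_enum _) s3.
have s4s := smooth_entries_sum oU (index_enum _) s4.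
have s12 := smooth_entriesB oU s1 s2; have s123 := smooth_entriesB oU s12 s3s.
have e3 h : partial_mx k (P3 h) x = partial_mx k (riem a b) x c h *: riem h d x
    + riem a b x c h *: partial_mx k (riem h d) x.
  apply: etrans (partial_mxZ oU k Ux (sR a b c h) (sR h d)) _.
  exact: (congr1 (fun t => t *: riem h d x + _) (esym (partial_mxE _ _ _ _ _))).
have e4 h : partial_mx k (P4 h) x = partial_mx k (riem a b) x d h *: riem c h x
    + riem a b x d h *: partial_mx k (riem c h) x.
  apply: etrans (partial_mxZ oU k Ux (sR a b d h) (sR c h)) _.
  exact: (congr1 (fun t => t *: riem c h x + _) (esym (partial_mxE _ _ _ _ _))).
apply: (semi_mx_polar (partial_mxM oU k Ux (sR c d) (sR a b))
  (partial_mxM oU k Ux (sR a b) (sR c d))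
  (etrans (partial_mx_sum oU _ k Ux s3) (eq_bigr _ (fun h _ => e3 h)))
  (etrans (partial_mx_sum oU _ k Ux s4) (eq_bigr _ (fun h _ => e4 h)))).
have z : partial_mx k (fun y => P1 y - P2 y - \sum_h P3 h y - \sum_h P4 h y) x = 0.
  by apply: partial_mx0 => // y; exact: hS.
exact: (etrans (esym (etrans (partial_mxB oU k Ux s123 s4s) (congr1 (fun t => t - _)
  (etrans (partial_mxB oU k Ux s12 s3s) (congr1 (fun t => t - _)
  (partial_mxB oU k Ux s1 s2)))))) z).
Qed.

(** Beyond [riem_bianchi2] there remain six Christoffel terms, which cancel in pairs by
    torsion-freeness and the antisymmetry of the curvature. *)
Lemma nabla_riem_bianchi2 e a b x : U x ->
  nabla_riem e x a b + nabla_riem a x b e + nabla_riem b x e a = 0.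
Proof.
move=> Ux; have B := riem_bianchi2 oU sg g_sym g_unit e a b Ux.
have S p q r : \sum_d gam p x q d *: riem d r x = - \sum_d gam q x p d *: riem r d x.
  rewrite -sumrN; apply: eq_bigr => d _.
  by rewrite (torsion_free oU g_sym p q d Ux) (riem_anti g r d) scalerN.
exact: (cyclic_sum_alg B (S e a b) (S a b e) (S b e a)).
Qed.

End CoordinateRigidity.

Section CoordinateRigidity4.
Context {R : realType}.
Variables (g : 'rV[R]_4 -> 'M[R]_4) (U : set 'rV[R]_4).
Hypotheses (oU : open U) (sg : smooth_entries U g).
Hypothesis g_sym : forall x, U x -> (g x)^T = g x.
Hypothesis g_unit : forall x, U x -> g x \in unitmx.

Theorem semi_symmetric_nabla_riem (lam : R) : lam != 0 ->
  (forall x, U x -> exists2 P : 'M[R]_4, P \in unitmx &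
     P *m g x *m P^T = diag_mx (\row_k (if k == 0%N :> nat then -1 else 1))) ->
  (forall x, U x -> ricci g x = lam *: g x) ->
  (forall x a b c d e, U x -> semi_form (fun a b => riem g a b x) (fun a b => riem g a b x)
     (delta_mx 0 a) (delta_mx 0 b) (delta_mx 0 c) (delta_mx 0 d) (delta_mx 0 e) = 0) ->
  forall x e u v w, U x -> tens (nabla_riem g e x) u v w = 0.
Proof.
move=> lam0 frame einstein semi x e u v w Ux.
have ric y : U y -> forall a b, \sum_c riem g c a y b c = lam * g y a b.
  move=> Uy a b; rewrite -(ricciE oU sg g_sym g_unit) //.
  by rewrite einstein // mxE.
have hT : curv_tensor (g x) lam (fun a b => riem g a b x).
  split.
  - by apply: tens_anti_comp => a b; exact: riem_anti.
  - by apply: tens_skew_comp; [exact: g_sym|move=> a b; exact: (riem_skew oU sg g_sym g_unit)].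
  - by apply: tens_bianchi_comp => a b c d; exact: (riem_bianchi1 oU g_sym).
  - by apply: tens_ricci_comp; exact: ric.
have hS u1 u2 u3 u4 u5 :
    semi_form (fun a b => riem g a b x) (fun a b => riem g a b x) u1 u2 u3 u4 u5 = 0.
  (* [semi_form_comp] yields twice the wanted value. *)
  have h : semi_form (fun a b => riem g a b x) (fun a b => riem g a b x) u1 u2 u3 u4 u5
      + semi_form (fun a b => riem g a b x) (fun a b => riem g a b x) u1 u2 u3 u4 u5 = 0.
    by apply: semi_form_comp => a b c d f; rewrite semi // addr0.
  by move/eqP: h; rewrite -mulr2n -scaler_nat scaler_eq0 pnatr_eq0 /= => /eqP.
have hD k : curv_tensor (g x) 0 (nabla_riem g k x).
  apply: (curv_tensor_deriv (g_sym Ux) hT).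
  - by move=> a b; exact: (partial_riem_anti oU sg g_sym g_unit).
  - by move=> a b; exact: (partial_riem_skew oU sg g_sym g_unit).
  - by move=> a b c d; exact: (partial_riem_bianchi oU sg g_sym g_unit).
  - by move=> a b; apply: (partial_riem_ricci oU sg g_sym g_unit) => // y Uy; exact: ric.
have hSD k u1 u2 u3 u4 u5 : semi_form (fun a b => riem g a b x) (nabla_riem g k x) u1 u2 u3 u4 u5
    + semi_form (nabla_riem g k x) (fun a b => riem g a b x) u1 u2 u3 u4 u5 = 0.
  apply: (semi_form_deriv _ hS) => {u1 u2 u3 u4 u5}.
  apply: semi_form_comp => a b c d f; rewrite !semi_form_delta -mulmxDr.
  rewrite (partial_semi oU sg g_sym g_unit) ?mulmx0 // => y Uy.
  by apply: semi_mx_eq0 => f'; exact: semi.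
have [P P_unit hP] := frame x Ux.
apply: (curvature_rigidity P_unit lam0 hP hT hD hS hSD) => {e u v w} e a b.
exact: (nabla_riem_bianchi2 oU sg g_sym g_unit).
Qed.

End CoordinateRigidity4.

(** * Parallel curvature implies semi-symmetry *)

Section CommutatorAlgebra.
Context {A : comNzRingType} {n : nat}.

(** [xa], [xab] and [rx] stand for the first and second covariant derivatives of [X] and for the
    curvature applied to [X]. Terms in which two arguments are differentiated once each occur on
    both sides. *)
Lemma tens_commutator_alg (T : 'I_n -> 'I_n -> 'M[A]_n)
    (X Y Z xa xb ya yb za zb xab xba yab yba zab zba rx ry rz : 'rV[A]_n) :
  xab = xba + rx -> yab = yba + ry -> zab = zba + rz ->
  (tens T xab Y Z + tens T xb ya Z + tens T xb Y za)
  + (tens T xa yb Z + tens T X yab Z + tens T X yb za)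
  + (tens T xa Y zb + tens T X ya zb + tens T X Y zab)
  = (tens T xba Y Z + tens T xa yb Z + tens T xa Y zb)
  + (tens T xb ya Z + tens T X yba Z + tens T X ya zb)
  + (tens T xb Y za + tens T X yb za + tens T X Y zba)
  + (tens T rx Y Z + tens T X ry Z + tens T X Y rz).
Proof. by move=> -> -> ->; rewrite !(tensD1, tensD2, tensD3); tens_module. Qed.

End CommutatorAlgebra.

Section ParallelCurvature.
Context {R : realType} {n : nat}.
Variables (g : 'rV[R]_n -> 'M[R]_n) (U : set 'rV[R]_n).
Hypotheses (oU : open U) (sg : smooth_entries U g).
Hypothesis g_sym : forall x, U x -> (g x)^T = g x.
Hypothesis g_unit : forall x, U x -> g x \in unitmx.
Hypothesis parallel : forall e x u v w, U x -> tens (nabla_riem g e x) u v w = 0.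
Implicit Types (X Y Z : 'rV[R]_n -> 'rV[R]_n) (x : 'rV[R]_n).

Local Notation cov := (cov g).
Local Notation riemt := (riemt g).
Let scov a Z (sZ : smooth_entries U Z) : smooth_entries U (cov a Z) :=
  smooth_cov oU sg g_sym g_unit a sZ.
Let sriemt X Y Z (sX : smooth_entries U X) (sY : smooth_entries U Y) (sZ : smooth_entries U Z) :
  smooth_entries U (fun x => riemt x (X x) (Y x) (Z x)) :=
  smooth_riemt oU sg g_sym g_unit sX sY sZ.

Lemma cov_riemt_parallel e X Y Z x : U x ->
  smooth_entries U X -> smooth_entries U Y -> smooth_entries U Z ->
  cov e (fun y => riemt y (X y) (Y y) (Z y)) x =
  riemt x (cov e X x) (Y x) (Z x) + riemt x (X x) (cov e Y x) (Z x)
  + riemt x (X x) (Y x) (cov e Z x).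
Proof.
move=> Ux sX sY sZ.
by apply: etrans (cov_riemt oU sg g_sym g_unit e Ux sX sY sZ) _; rewrite parallel // add0r.
Qed.

Lemma cov2_riemt_parallel a b X Y Z x : U x ->
  smooth_entries U X -> smooth_entries U Y -> smooth_entries U Z ->
  cov a (cov b (fun y => riemt y (X y) (Y y) (Z y))) x =
  (riemt x (cov a (cov b X) x) (Y x) (Z x) + riemt x (cov b X x) (cov a Y x) (Z x)
   + riemt x (cov b X x) (Y x) (cov a Z x))
  + (riemt x (cov a X x) (cov b Y x) (Z x) + riemt x (X x) (cov a (cov b Y) x) (Z x)
   + riemt x (X x) (cov b Y x) (cov a Z x))
  + (riemt x (cov a X x) (Y x) (cov b Z x) + riemt x (X x) (cov a Y x) (cov b Z x)
   + riemt x (X x) (Y x) (cov a (cov b Z) x)).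
Proof.
move=> Ux sX sY sZ.
have [cX cY cZ] := And3 (scov b sX) (scov b sY) (scov b sZ).
have s1 := sriemt cX sY sZ; have s2 := sriemt sX cY sZ; have s3 := sriemt sX sY cZ.
have s12 := smooth_entriesD oU s1 s2.
transitivity (cov a (fun y => riemt y (cov b X y) (Y y) (Z y)
    + riemt y (X y) (cov b Y y) (Z y) + riemt y (X y) (Y y) (cov b Z y)) x).
  by apply: (cov_ext g oU a Ux) => y /[!inE] Uy; exact: cov_riemt_parallel.
apply: etrans (covD g oU a Ux s12 s3) _.
apply: etrans (congr1 (fun t => t + _) (covD g oU a Ux s1 s2)) _.
by rewrite !cov_riemt_parallel.
Qed.

(* The curvature operator is the commutator of two derivations of [riemt]. *)
Lemma riem_derivation_parallel a b X Y Z x : U x ->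
  smooth_entries U X -> smooth_entries U Y -> smooth_entries U Z ->
  riemt x (X x) (Y x) (Z x) *m riem g a b x =
  riemt x (X x *m riem g a b x) (Y x) (Z x) + riemt x (X x) (Y x *m riem g a b x) (Z x)
  + riemt x (X x) (Y x) (Z x *m riem g a b x).
Proof.
move=> Ux sX sY sZ.
have comm W : smooth_entries U W -> cov a (cov b W) x = cov b (cov a W) x + W x *m riem g a b x.
  move=> sW; apply/eqP; rewrite addrC -subr_eq; apply/eqP.
  exact: (cov_comm oU sg g_sym g_unit a b Ux sW).
have E k l := cov2_riemt_parallel k l Ux sX sY sZ.
apply: (addrI (cov b (cov a (fun y => riemt y (X y) (Y y) (Z y))) x)).
apply: etrans (esym (comm _ (sriemt sX sY sZ))) _.
apply: etrans (E a b) _; apply: etrans _ (congr1 (fun t => t + _) (esym (E b a))).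
exact: (@tens_commutator_alg R n (fun a b => riem g a b x) (X x) (Y x) (Z x)
  (cov a X x) (cov b X x) (cov a Y x) (cov b Y x) (cov a Z x) (cov b Z x)
  _ _ _ _ _ _ _ _ _ (comm X sX) (comm Y sY) (comm Z sZ)).
Qed.

Lemma parallel_semi_form x a b c d e : U x ->
  semi_form (fun a b => riem g a b x) (fun a b => riem g a b x)
    (delta_mx 0 a) (delta_mx 0 b) (delta_mx 0 c) (delta_mx 0 d) (delta_mx 0 e) = 0.
Proof.
move=> Ux; have sC := @smooth_coord R n U.
have := riem_derivation_parallel a b Ux (sC c) (sC d) (sC e).
rewrite /semi_form !(tens_delta _ a b) /riemt /coord_field => ->.
by move: (tens _ _ _ _) (tens _ _ _ _) (tens _ _ _ _) => p q r; apply/matrixP => i j;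
  rewrite !(addmxE, oppmxE) [RHS]mxE; ring.
Qed.

End ParallelCurvature.

(** * Charts *)

Section Charts.
Context {R : realType} {n : nat}.
Variable M : smooth_manifold R n.
Implicit Types (i j k : chart M) (U : set M) (p : M).

Local Notation crd i := (@Defs.coord R n M i).
Local Notation prm i := (@param R n M i).

(** [in_chart i U] is the part of the open chart image that [param i], continuous there, sends into
    [U]. *)
Lemma open_in_chart i U : open U -> open (in_chart i U).
Proof.
move=> oU; rewrite openE => x [p [ip Up] <-].
have oI := @chart_image_open _ _ M i.
have cont : {in crd i @` chart_dom i, continuous (prm i)}.
  by rewrite -(continuous_open_subspace _ oI); exact: param_continuous.
have Ip : (crd i @` chart_dom i) (crd i p) by exists p.
have nU : nbhs (prm i (crd i p)) U by rewrite coordK //; exact: open_nbhs_nbhs.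
have nP : nbhs (crd i p) (prm i @^-1` U) by exact: (cont _ (mem_set Ip) _ nU).
suff sub : (crd i @` chart_dom i) `&` (prm i @^-1` U) `<=` in_chart i U.
  exact: (filterS sub (filterI (open_nbhs_nbhs (conj oI Ip)) nP)).
by move=> y [[q iq <-]] /=; rewrite coordK // => Uq; exists q.
Qed.

Lemma transition_coord i j p : chart_dom i p -> transition i j (crd i p) = crd j p.
Proof. by move=> ip; rewrite /transition /= coordK. Qed.

Lemma in_chart_coord i U p : chart_dom i p -> U p -> in_chart i U (crd i p).
Proof. by move=> ip Up; exists p. Qed.

Lemma in_chart_sub i U U' : U `<=` U' -> in_chart i U `<=` in_chart i U'.
Proof. by move=> UU x [p [ip Up] <-]; exists p => //; split => //; exact: UU. Qed.

Lemma open_transition i j : open (in_chart i (chart_dom j)).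
Proof. exact: open_in_chart (@chart_dom_open _ _ M j). Qed.

Lemma smooth_transition i j : smooth_on (in_chart i (chart_dom j)) (transition i j).
Proof. exact: transition_smooth. Qed.

Lemma transition_in_chart i j x : in_chart i (chart_dom j) x ->
  in_chart j (chart_dom i) (transition i j x).
Proof.
by move=> [p [ip jp] <-]; rewrite transition_coord //; exact: in_chart_coord.
Qed.

Lemma transition_chain i j k p v : chart_dom i p -> chart_dom j p -> chart_dom k p ->
  'D_v (transition i k) (crd i p) =
  'd (transition j k) (crd j p) ('D_v (transition i j) (crd i p)).
Proof.
move=> ip jp kp.
have ijE := transition_coord j ip.
have dij : differentiable (transition i j) (crd i p).
  exact: (smooth_differentiable (smooth_transition i j) (in_chart_coord ip jp)).
have djk : differentiable (transition j k) (transition i j (crd i p)).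
  rewrite ijE.
  exact: (smooth_differentiable (smooth_transition j k) (in_chart_coord jp kp)).
have oV : open (in_chart i (chart_dom j `&` chart_dom k)).
  by apply: open_in_chart; apply: openI; exact: (@chart_dom_open _ _ M).
have Vp : in_chart i (chart_dom j `&` chart_dom k) (crd i p) by exact: in_chart_coord.
have chain : {in in_chart i (chart_dom j `&` chart_dom k),
    transition i k =1 transition j k \o transition i j}.
  move=> y /[!inE] -[q [iq [jq kq]] <-] /=.
  by rewrite (transition_coord k iq) (transition_coord j iq) (transition_coord k jq).
apply: etrans (derive_ext v oV Vp chain) _.
apply: etrans (deriveE v (differentiable_comp dij djk)) _.
apply: etrans (congr1 (fun h : 'rV[R]_n -> 'rV[R]_n => h v) (diff_comp dij djk)) _.
apply: etrans (congr1 (fun z => 'd (transition j k) z _) ijE) _.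
exact: (congr1 ('d (transition j k) (crd j p)) (esym (deriveE v dij))).
Qed.

Definition coord_extension i (a : 'I_n) j (y : 'rV[R]_n) : 'rV[R]_n :=
  'D_(delta_mx 0 a) (transition i j) (transition j i y).

Lemma coord_extensionE i a p : chart_dom i p ->
  coord_extension i a i (crd i p) = delta_mx 0 a.
Proof.
move=> ip; rewrite /coord_extension (transition_coord i ip).
rewrite -[RHS](derive_id (crd i p)).
have oV : open (in_chart i setT) by apply: open_in_chart; exact: openT.
apply: (derive_ext (delta_mx 0 a : 'rV[R]_n) oV); first exact: in_chart_coord.
by move=> y /[!inE] -[q [iq _] <-]; rewrite (transition_coord i iq).
Qed.

Lemma coord_extension_field i a : vector_field_on (chart_dom i) (coord_extension i a).
Proof.
split=> [j|j k y [p [jp [kp ip]] <-]].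
- apply: smooth_mx; first exact: open_transition.
  move=> u l; apply: (@smooth_comp R n _ (in_chart j (chart_dom i)) (in_chart i (chart_dom j))
    (fun z => 'D_(delta_mx 0 a) (transition i j) z u l) (transition j i)).
  + exact: open_transition.
  + exact: smooth_transition.
  + exact: transition_in_chart.
  + apply: smooth_entry; first exact: open_transition.
    exact: (smooth_derive _ (smooth_transition i j)).
- rewrite /coord_extension (transition_coord k jp) (transition_coord i kp) (transition_coord i jp).
  exact: transition_chain.
Qed.

End Charts.

(** * The two conditions in terms of components *)

Section MetricCharts.
Context {R : realType} {n : nat} {M : smooth_manifold R n} (g : pseudo_metric M).
Implicit Types (i : chart M) (U : set M).

Lemma gram_smooth_sub i U : open U -> smooth_entries (in_chart i U) (g i).
Proof.
move=> oU; apply: smooth_on_entries; first exact: open_in_chart.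
by apply: smooth_sub (gram_smooth g i); exact: in_chart_sub.
Qed.

Lemma gram_sym_sub i U x : in_chart i U x -> (g i x)^T = g i x.
Proof. by move=> Ux; apply: gram_sym; apply: in_chart_sub Ux. Qed.

Lemma gram_unit_sub i U x : in_chart i U x -> g i x \in unitmx.
Proof. by move=> Ux; apply: gram_nondegenerate; apply: in_chart_sub Ux. Qed.

(** By tensoriality the condition at a point only sees the values of the fields there. The
    coordinate fields test it on basis vectors, and multilinearity gives it back for all fields. *)
Lemma semi_symmetricP : semi_symmetric g <->
  forall i x a b c d e, in_chart i setT x ->
    semi_form (fun a b => riem (g i) a b x) (fun a b => riem (g i) a b x)
      (delta_mx 0 a) (delta_mx 0 b) (delta_mx 0 c) (delta_mx 0 d) (delta_mx 0 e) = 0.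
Proof.
have curvE i U X Y Z : open U -> smooth_entries (in_chart i U) X ->
    smooth_entries (in_chart i U) Y -> smooth_entries (in_chart i U) Z ->
    forall x, in_chart i U x -> curvature (g i) X Y Z x = riemt (g i) x (X x) (Y x) (Z x).
  move=> oU sX sY sZ x Ux.
  exact: (curvature_tens (open_in_chart oU) (gram_smooth_sub i oU) (@gram_sym_sub i U)
    (@gram_unit_sub i U) Ux sX sY sZ).
have scurv i U X Y Z : open U -> smooth_entries (in_chart i U) X ->
    smooth_entries (in_chart i U) Y -> smooth_entries (in_chart i U) Z ->
    smooth_entries (in_chart i U) (curvature (g i) X Y Z).
  move=> oU sX sY sZ.
  exact: (smooth_curvature (open_in_chart oU) (gram_smooth_sub i oU) (@gram_sym_sub i U)
    (@gram_unit_sub i U) sX sY sZ).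
have E i U X Y Z T W : open U -> smooth_entries (in_chart i U) X ->
    smooth_entries (in_chart i U) Y -> smooth_entries (in_chart i U) Z ->
    smooth_entries (in_chart i U) T -> smooth_entries (in_chart i U) W ->
    forall x, in_chart i U x ->
    let K := curvature (g i) in
    semi_form (fun a b => riem (g i) a b x) (fun a b => riem (g i) a b x)
      (X x) (Y x) (Z x) (T x) (W x) =
    K X Y (K Z T W) x - K Z T (K X Y W) x - (K (K X Y Z) T W x + K Z (K X Y T) W x).
  move=> oU sX sY sZ sT sW x Ux K; rewrite /K.
  rewrite (curvE i U X Y (curvature (g i) Z T W) oU sX sY (scurv i U _ _ _ oU sZ sT sW) x Ux).
  rewrite (curvE i U Z T (curvature (g i) X Y W) oU sZ sT (scurv i U _ _ _ oU sX sY sW) x Ux).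
  rewrite (curvE i U (curvature (g i) X Y Z) T W oU (scurv i U _ _ _ oU sX sY sZ) sT sW x Ux).
  rewrite (curvE i U Z (curvature (g i) X Y T) W oU sZ (scurv i U _ _ _ oU sX sY sT) sW x Ux).
  rewrite (curvE i U Z T W oU sZ sT sW x Ux) (curvE i U X Y W oU sX sY sW x Ux).
  rewrite (curvE i U X Y Z oU sX sY sZ x Ux) (curvE i U X Y T oU sX sY sT x Ux).
  by rewrite /semi_form /riemt opprD addrA.
split=> [hS i x a b c d e [p [ip _] <-]|hS U X Y Z T W oU vX vY vZ vT vW i x Ux].
- have f a' := coord_extension_field i a'.
  have sf a' : smooth_entries (in_chart i (chart_dom i)) (coord_extension i a' i).
    apply: smooth_on_entries; first exact: open_transition.
    exact: (vector_field_smooth (f a') i).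
  have := hS _ _ _ _ _ _ (@chart_dom_open _ _ M i) (f a) (f b) (f c) (f d) (f e) i
    (Defs.coord i p) (in_chart_coord ip ip).
  move=> /= h.
  have := E i _ _ _ _ _ _ (@chart_dom_open _ _ M i) (sf a) (sf b) (sf c) (sf d) (sf e) _
    (in_chart_coord ip ip).
  by rewrite /= h subrr !(coord_extensionE _ ip).
- apply/subr0_eq; have sm Y' : vector_field_on U Y' -> smooth_entries (in_chart i U) (Y' i).
    move=> vY'; apply: smooth_on_entries; first exact: open_in_chart.
    exact: (vector_field_smooth vY' i).
  rewrite -(E i U _ _ _ _ _ oU (sm _ vX) (sm _ vY) (sm _ vZ) (sm _ vT) (sm _ vW) x Ux).
  have h : forall u v y z w, semi_form (fun a b => riem (g i) a b x) (fun a b => riem (g i) a b x) u v y z w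
      + semi_form (fun a b => riem (g i) a b x) (fun a b => riem (g i) a b x) u v y z w = 0.
    apply: semi_form_comp => a b c d e; rewrite hS ?addr0 //.
    by apply: in_chart_sub Ux.
  have /eqP := h (X i x) (Y i x) (Z i x) (T i x) (W i x).
  by rewrite -mulr2n -scaler_nat scaler_eq0 pnatr_eq0 /= => /eqP.
Qed.

Lemma locally_symmetricP : locally_symmetric g <->
  forall i e x u v w, in_chart i setT x -> tens (nabla_riem (g i) e x) u v w = 0.
Proof.
have E i U V X Y Z : open U -> smooth_entries (in_chart i U) V ->
    smooth_entries (in_chart i U) X -> smooth_entries (in_chart i U) Y ->
    smooth_entries (in_chart i U) Z -> forall x, in_chart i U x ->
    nabla_curvature (g i) V X Y Z x =
    \sum_e V x 0 e *: tens (nabla_riem (g i) e x) (X x) (Y x) (Z x).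
  move=> oU sV sX sY sZ x Ux.
  exact: (nabla_curvature_tens (open_in_chart oU) (gram_smooth_sub i oU) (@gram_sym_sub i U)
    (@gram_unit_sub i U) Ux sV sX sY sZ).
split=> [hS i e x u v w [p [ip _] <-]|hS U V X Y Z oU vV vX vY vZ i x Ux].
- have f a' := coord_extension_field i a'.
  have sf a' : smooth_entries (in_chart i (chart_dom i)) (coord_extension i a' i).
    apply: smooth_on_entries; first exact: open_transition.
    exact: (vector_field_smooth (f a') i).
  have Ip := in_chart_coord ip ip.
  have comp a b c : tens (nabla_riem (g i) e (Defs.coord i p)) (delta_mx 0 a) (delta_mx 0 b)
      (delta_mx 0 c) = 0.
    have := E i _ _ _ _ _ (@chart_dom_open _ _ M i) (sf e) (sf a) (sf b) (sf c) _ Ip.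
    rewrite (hS _ _ _ _ _ (@chart_dom_open _ _ M i) (f e) (f a) (f b) (f c) i _ Ip).
    rewrite !(coord_extensionE _ ip) (bigD1 e) //= mxE !eqxx scale1r big1 ?addr0 => [<- //|k ke].
    by rewrite mxE (negPf ke) andbF scale0r.
  rewrite (row_sum_delta u) tens_comb1 big1 // => a _.
  rewrite (row_sum_delta v) tens_comb2 big1 ?scaler0 // => b _.
  rewrite (row_sum_delta w) tens_comb3 big1 ?scaler0 // => c _.
  by rewrite comp scaler0.
- have sm Y' : vector_field_on U Y' -> smooth_entries (in_chart i U) (Y' i).
    move=> vY'; apply: smooth_on_entries; first exact: open_in_chart.
    exact: (vector_field_smooth vY' i).
  rewrite (E i U _ _ _ _ oU (sm _ vV) (sm _ vX) (sm _ vY) (sm _ vZ) x Ux) big1 // => e _.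
  by rewrite hS ?scaler0 //; apply: in_chart_sub Ux.
Qed.

End MetricCharts.

Theorem theorem3p2 (R : realType) (M : smooth_manifold R 4)
  (g : pseudo_metric M) (s : R)
  (g_lorentzian : lorentzian g) (g_einstein : einstein g)
  (g_scalar : constant_scalar_curvature g s) (s_neq0 : s != 0) :
  semi_symmetric g <-> locally_symmetric g.
Proof.
apply: (iff_trans (semi_symmetricP g)); apply: iff_sym.
apply: (iff_trans (locally_symmetricP g)); apply: iff_sym.
have oV i : open (in_chart i [set: M]) by apply: open_in_chart; exact: openT.
have sg i := gram_smooth_sub g i (@openT M).
split=> [semi i e x u v w Ux|parallel i x a b c d e Ux]; last first.
  exact: (parallel_semi_form (oV i) (sg i) (@gram_sym_sub _ _ _ g i setT)
    (@gram_unit_sub _ _ _ g i setT) (fun e x u v w => parallel i e x u v w) a b c d e Ux).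
have [lam hlam] := g_einstein.
(* The point [x] serves here: on an empty manifold [s != 0] would say nothing about [lam]. *)
have lam0 : lam != 0.
  apply: contraNneq s_neq0 => lam0; rewrite -(g_scalar i x Ux) /scalar_curvature.
  by rewrite hlam // lam0 scale0r mulmx0 mxtrace0.
exact: (semi_symmetric_nabla_riem (oV i) (sg i) (@gram_sym_sub _ _ _ g i setT)
  (@gram_unit_sub _ _ _ g i setT) lam0 (g_lorentzian i) (hlam i) (semi i)).
Qed.
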